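(* Let $A\Rightarrow M$ be a Lie algebroid and let $\mathfrak{k}\subset A$ be a bundle of ideals such that: (i) $\mathfrak{k}$ is a locally trivial Lie algebra bundle; (ii) the typical fiber $(\mathfrak{g},[\cdot,\cdot])$ of $\mathfrak{k}$ satisfies $H^0(\mathfrak{g},\mathfrak{g})=H^1(\mathfrak{g},\mathfrak{g})=0$. Then $\mathfrak{k}\subset A$ is of principal type, and in particular it is partially split.
   Context: A bundle of ideals in a Lie algebroid $A\Rightarrow M$ (bracket $[\cdot,\cdot]$, anchor $\rho$) is a vector subbundle $\mathfrak{k}\subset\ker\rho$ with $[\Gamma(A),\Gamma(\mathfrak{k})]\subset\Gamma(\mathfrak{k})$; its fibres are Lie algebras. $H^i(\mathfrak{g},\mathfrak{g})$ is Lie algebra (Chevalley–Eilenberg) cohomology with coefficients in the adjoint representation. Principal type: $\mathfrak{k}\subset A$ is of principal type if there are a transitive Lie algebroid $A'\Rightarrow M$ (surjective anchor), a Lie algebroid $B\Rightarrow M$ and an isomorphism of $A$ with the fibre product Lie algebroid $A'\times_{TM}B=\{(\alpha,\beta):\rho_{A'}(\alpha)=\rho_B(\beta)\}$ (whose inclusion in the product $A'\times B$ is a Lie algebroid morphism), under which $\mathfrak{k}$ corresponds to the kernel of the projection $A'\times_{TM}B\to B$. Partially split: there exist a linear map $L:\Gamma(A)\to\Omega^1(M,\mathfrak{k})$ and a bundle map $l:A\to\mathfrak{k}$ with $l|_{\mathfrak{k}}=\mathrm{id}$, $L(f\alpha)=fL(\alpha)+df\otimes l(\alpha)$ and $$L([\alpha,\beta])=\mathcal{L}_\alpha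 L(\beta)-\mathcal{L}_\beta L(\alpha),\qquad l([\alpha,\beta])=[\alpha,l(\beta)]-i_{\rho(\beta)}L(\alpha),$$ where $(\mathcal{L}_\alpha\gamma)(X)=[\alpha,\gamma(X)]-\gamma([\rho(\alpha),X])$ for $\gamma\in\Omega^1(M,\mathfrak{k})$ (equivalently, there is a VB subalgebroid $E\Rightarrow TM$ of the tangent algebroid $TA\Rightarrow TM$ complementary to the image of $A\times_M\mathfrak{k}\hookrightarrow TA$, $(a,\gamma)\mapsto\frac{d}{d\tau}|_{0}(a+\tau\gamma)$). *)

(* Defs.v *)
From HB Require Import structures.
From mathcomp Require Import all_boot all_order all_algebra.
From mathcomp Require Import all_classical all_reals all_analysis.
From mathcomp Require Import ring.
Import Order.TTheory GRing.Theory Num.Theory.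
Import numFieldNormedType.Exports.
Set Implicit Arguments.
Unset Strict Implicit.
Unset Printing Implicit Defensive.
Local Open Scope classical_set_scope.
Local Open Scope ring_scope.

Fixpoint Ck (R : realType) (n : nat) (k : nat) (U : set 'rV[R]_n)
    (f : 'rV[R]_n -> R) : Prop :=
  if k is k'.+1 then
    (forall x, U x -> differentiable f x) /\
    (forall i : 'I_n, Ck k' U (fun x => 'D_(delta_mx 0 i) f x))
  else forall x, U x -> {for x, continuous f}.

Lemma near_eq_differentiable (R : realType) (V W : normedModType R)
    (f g : V -> W) (x : V) :
  (\near x, f x = g x) -> differentiable f x -> differentiable g x.
Proof.
move=> fg df; have [dfc dxf] := (diff_locallyP x f).1 df.
have dxg : g \o shift x = cst (g x) + 'd f x +o_ 0 id.
  apply/eqaddoP => e e0.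
  have /eqaddoP/(_ _ e0) H := dxf.
  have fg0 : \forall h \near 0, f (h + x) = g (h + x).
    by move: fg; rewrite (near_shift 0) /=; apply: filterS => h; rewrite subr0.
  near=> h.
  have := near H h; rewrite /= /GRing.add/= /GRing.opp/= => He.
  rewrite -(nbhs_singleton fg).
  have <- : f (h + x) = g (h + x) by near: h.
  by near: h.
apply/diffP => /=.
apply: (@getPex _ (fun (df : {linear V -> W}) => continuous df /\
  forall y, g y = g (lim (nbhs x)) + df (y - lim (nbhs x))
                  +o_(y \near x) (y - lim (nbhs x)))).
exists ('d f x); split=> //; apply: eqaddoEx => z.
have hdf h : (g \o shift x = cst (g x) + h +o_ 0 id) ->
    h = g \o shift x - cst (g x) +o_ 0 id.
  move=> hdf; apply: eqaddoE.
  rewrite hdf addrAC -!addrA addrC !addrA subrK.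
  rewrite -[LHS]addr0 -addrA; congr (_ + _).
  by apply/eqP; rewrite eq_sym addrC addr_eq0 oppo.
rewrite (hdf _ dxg) !addrA lim_id // /(_ \o _) /= subrK [g _ + _]addrC addrK.
rewrite -addrA -[LHS]addr0; congr (_ + _).
apply/eqP; rewrite eq_sym addrC addr_eq0 oppox; apply/eqP.
rewrite [in LHS]littleo_center0 (comp_centerK x id).
by rewrite -[- _ in RHS](comp_centerK x).
Unshelve. all: by end_near. Qed.

Lemma near_eq_continuous (T U : topologicalType) (f g : T -> U) (x : T) :
  (\near x, f x = g x) -> {for x, continuous f} -> {for x, continuous g}.
Proof.
move=> fg cf; rewrite /prop_for /continuous_at -(nbhs_singleton fg).
by apply: (cvg_trans _ cf); exact: near_eq_cvg.
Qed.

Definition Cinfty (R : realType) (n : nat) (U : set 'rV[R]_n)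
    (f : 'rV[R]_n -> R) : Prop := forall k, Ck k U f.

Lemma Ck_ext (R : realType) (n k : nat) (U : set 'rV[R]_n)
    (f g : 'rV[R]_n -> R) :
  open U -> (forall x, U x -> f x = g x) -> Ck k U f -> Ck k U g.
Proof.
move=> oU; have nearU x : U x -> nbhs x U by move=> Ux; exact: open_nbhs_nbhs.
elim: k f g => [|k IH] f g fg /=.
  move=> cf x Ux; apply: near_eq_continuous (cf x Ux).
  by near=> y; apply: fg; near: y; exact: nearU.
move=> [df Df]; split=> [x Ux|i].
  apply: near_eq_differentiable (df x Ux).
  by near=> y; apply: fg; near: y; exact: nearU.
apply: IH (Df i) => x Ux; apply: near_eq_derive.
by near=> y; apply: fg; near: y; exact: nearU.
Unshelve. all: by end_near. Qed.

Lemma Ck_sub (R : realType) (n k : nat) (U V : set 'rV[R]_n)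
    (f : 'rV[R]_n -> R) : U `<=` V -> Ck k V f -> Ck k U f.
Proof.
move=> UV; elim: k f => [|k IH] f /=; first by move=> cf x /UV; exact: cf.
by move=> [df Df]; split=> [x /UV|i]; [exact: df|exact: IH].
Qed.

Lemma Ck_le (R : realType) (n k : nat) (U : set 'rV[R]_n)
    (f : 'rV[R]_n -> R) : Ck k.+1 U f -> Ck k U f.
Proof.
elim: k f => [|k IH] f; first by case=> df _ x /df /differentiable_continuous.
by case=> df Df; split=> // i; apply: IH; exact: Df.
Qed.

Lemma Ck_cst (R : realType) (n k : nat) (U : set 'rV[R]_n) (c : R) :
  Ck k U (cst c).
Proof.
elim: k c => [|k IH] c /=; first by move=> x _; exact: cst_continuous.
split=> [x _|i]; first exact: differentiable_cst.
have -> : (fun x : 'rV[R]_n => 'D_(delta_mx 0 i) (cst c) x) = cst 0.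
  by apply/funext => x; rewrite derive_cst.
exact: IH.
Qed.

Lemma CkD (R : realType) (n k : nat) (U : set 'rV[R]_n)
    (f g : 'rV[R]_n -> R) : open U -> Ck k U f -> Ck k U g -> Ck k U (f + g).
Proof.
move=> oU; elim: k f g => [|k IH] f g /=.
  by move=> cf cg x Ux; exact: (continuousD (cf x Ux) (cg x Ux)).
move=> [df Df] [dg Dg]; split=> [x Ux|i].
  by apply: differentiableD; [exact: df|exact: dg].
apply: (Ck_ext oU _ (IH _ _ (Df i) (Dg i))) => x Ux.
by rewrite deriveD //; apply: diff_derivable; [exact: df|exact: dg].
Qed.

Lemma CkM (R : realType) (n k : nat) (U : set 'rV[R]_n)
    (f g : 'rV[R]_n -> R) : open U -> Ck k U f -> Ck k U g -> Ck k U (f * g).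
Proof.
move=> oU; elim: k f g => [|k IH] f g.
  by move=> cf cg x Ux; exact: (continuousM (cf x Ux) (cg x Ux)).
move=> Cf Cg; have [df Df] := Cf; have [dg Dg] := Cg; split=> [x Ux|i].
  by apply: differentiableM; [exact: df|exact: dg].
have := CkD oU (IH _ _ (Ck_le Cf) (Dg i)) (IH _ _ (Ck_le Cg) (Df i)).
apply: Ck_ext oU _ => x Ux.
by rewrite deriveM //; apply: diff_derivable; [exact: df|exact: dg].
Qed.

Record chart (R : realType) (X : topologicalType) (n : nat) := Chart {
  chart_dom : set X;
  chart_cod : set 'rV[R]_n;
  chart_map :> X -> 'rV[R]_n;
  chart_inv : 'rV[R]_n -> X;
  chart_dom_open : open chart_dom;
  chart_cod_open : open chart_cod;
  chart_mapP : forall x, chart_dom x -> chart_cod (chart_map x);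
  chart_invP : forall v, chart_cod v -> chart_dom (chart_inv v);
  chart_mapK : forall x, chart_dom x -> chart_inv (chart_map x) = x;
  chart_invK : forall v, chart_cod v -> chart_map (chart_inv v) = v;
  chart_map_cont : forall x, chart_dom x -> {for x, continuous chart_map};
  chart_inv_cont : forall v, chart_cod v -> {for v, continuous chart_inv};
}.

(* The atlas need not be maximal: smooth_on gives the same functions for an
   atlas and for the maximal atlas containing it. *)
Record manifold (R : realType) := Manifold {
  carrier :> topologicalType;
  mdim : nat;
  atlas : set (chart R carrier mdim);
  manifold_hausdorff : hausdorff_space carrier;
  manifold_countable : @second_countable carrier;
  atlas_cover : forall x, exists2 c, atlas c & chart_dom c x;
  atlas_compat : forall c d, atlas c -> atlas d -> forall j,
    Cinfty (chart_cod c `&` chart_inv c @^-1` chart_dom d)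
      (fun v => d (chart_inv c v) 0 j);
}.

Definition smooth_on (R : realType) (M : manifold R) (U : set M) (f : M -> R) :
    Prop :=
  forall c, @atlas R M c ->
    Cinfty (chart_cod c `&` chart_inv c @^-1` U) (f \o chart_inv c).

Lemma chart_open (R : realType) (X : topologicalType) (n : nat)
    (c : chart R X n) (U : set X) :
  open U -> open (chart_cod c `&` chart_inv c @^-1` U).
Proof.
move=> oU; rewrite openE => v [cv Uv]; apply: filterI.
  by apply: open_nbhs_nbhs; split=> //; exact: chart_cod_open.
by apply: (chart_inv_cont cv); apply: open_nbhs_nbhs; split.
Qed.

Lemma smooth_on_sub (R : realType) (M : manifold R) (U V : set M) (f : M -> R) :
  U `<=` V -> smooth_on V f -> smooth_on U f.
Proof.
move=> UV sf c Mc k; apply: Ck_sub (sf c Mc k).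
by move=> v [cv Uv]; split=> //; exact: UV.
Qed.

Lemma smooth_on_cst (R : realType) (M : manifold R) (U : set M) (a : R) :
  smooth_on U (cst a).
Proof. by move=> c _ k; exact: Ck_cst. Qed.

Lemma smooth_onD (R : realType) (M : manifold R) (U : set M) (f g : M -> R) :
  open U -> smooth_on U f -> smooth_on U g -> smooth_on U (f + g).
Proof.
move=> oU sf sg c Mc k.
by apply: CkD; [exact: chart_open|exact: sf|exact: sg].
Qed.

Lemma smooth_onM (R : realType) (M : manifold R) (U : set M) (f g : M -> R) :
  open U -> smooth_on U f -> smooth_on U g -> smooth_on U (f * g).
Proof.
move=> oU sf sg c Mc k.
by apply: CkM; [exact: chart_open|exact: sf|exact: sg].
Qed.

Lemma smooth_onZ (R : realType) (M : manifold R) (U : set M) (a : R)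
    (f : M -> R) : open U -> smooth_on U f -> smooth_on U (a *: f).
Proof. by move=> oU; apply: smooth_onM => //; exact: smooth_on_cst. Qed.

Lemma smooth_on0 (R : realType) (M : manifold R) (U : set M) :
  smooth_on U (0 : M -> R).
Proof. exact: (smooth_on_cst U 0). Qed.

Lemma smooth_onN (R : realType) (M : manifold R) (U : set M) (f : M -> R) :
  open U -> smooth_on U f -> smooth_on U (- f).
Proof. by move=> oU sf; rewrite -scaleN1r; exact: smooth_onZ. Qed.

Definition smooth_pred (R : realType) (M : manifold R) : {pred M -> R} :=
  fun f => `[< smooth_on setT f >].

Record smooth (R : realType) (M : manifold R) := Smooth {
  smooth_fun :> M -> R;
  smooth_mem : smooth_fun \in @smooth_pred R M;
}.

HB.instance Definition _ (R : realType) (M : manifold R) :=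
  [isSub for (@smooth_fun R M)].
HB.instance Definition _ (R : realType) (M : manifold R) :=
  [Choice of smooth M by <:].

Lemma smooth_subring (R : realType) (M : manifold R) :
  subring_closed (@smooth_pred R M).
Proof.
split=> [|f g|f g]; first exact/asboolP/smooth_on_cst.
  move=> /asboolP sf /asboolP sg; apply/asboolP/smooth_onD => //.
    exact: openT.
  by apply: smooth_onN => //; exact: openT.
move=> /asboolP sf /asboolP sg; apply/asboolP/smooth_onM => //; exact: openT.
Qed.

HB.instance Definition _ (R : realType) (M : manifold R) :=
  GRing.isSubringClosed.Build _ (@smooth_pred R M) (@smooth_subring R M).

Lemma smooth_scaler (R : realType) (M : manifold R) :
  scaler_closed (@smooth_pred R M).
Proof.
move=> a f /asboolP sf; apply/asboolP/smooth_onZ => //; exact: openT.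
Qed.

HB.instance Definition _ (R : realType) (M : manifold R) :=
  GRing.isScaleClosed.Build R (M -> R) (@smooth_pred R M) (@smooth_scaler R M).

HB.instance Definition _ (R : realType) (M : manifold R) :=
  GRing.SubChoice_isSubComPzRing.Build (M -> R) (@smooth_pred R M) (smooth M)
    (subringClosedP _).
HB.instance Definition _ (R : realType) (M : manifold R) :=
  [SubZmodule_isSubLmodule of smooth M by <:].

(* Tangent vectors at p are the derivations at p of the algebra of smooth
   functions on M. *)
Definition derivation_at (R : realType) (M : manifold R) (p : M) :
    {pred smooth M -> R} :=
  fun v => `[< (forall (a : R) f g, v (a *: f + g) = a * v f + v g) /\
               (forall f g, v (f * g) = f p * v g + g p * v f) >].

Record tangent (R : realType) (M : manifold R) (p : M) := Tangent {
  tangent_fun :> smooth M -> R;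
  tangent_mem : tangent_fun \in derivation_at p;
}.

HB.instance Definition _ (R : realType) (M : manifold R) (p : M) :=
  [isSub for (@tangent_fun R M p)].
HB.instance Definition _ (R : realType) (M : manifold R) (p : M) :=
  [Choice of tangent p by <:].

Lemma derivation_at_submod (R : realType) (M : manifold R) (p : M) :
  submod_closed (derivation_at p).
Proof.
split.
  by apply/asboolP; split=> [a f g|f g]; [change (0 = a * 0 + 0 :> R)|change (0 = f p * 0 + g p * 0 :> R)]; ring.
move=> a v w /asboolP[vL vM] /asboolP[wL wM].
have E f : (a *: v + w) f = a * v f + w f by [].
apply/asboolP; split=> [b f g|f g]; rewrite !E ?vL ?wL ?vM ?wM; ring.
Qed.

HB.instance Definition _ (R : realType) (M : manifold R) (p : M) :=
  GRing.isSubmodClosed.Build R (smooth M -> R) (derivation_at p)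
    (@derivation_at_submod R M p).
HB.instance Definition _ (R : realType) (M : manifold R) (p : M) :=
  [SubChoice_isSubLmodule of tangent p by <:].

Lemma tangentP (R : realType) (M : manifold R) (p : M) (v : tangent p)
    (a : R) (f g : smooth M) : v (a *: f + g) = a * v f + v g.
Proof. by have /asboolP[vL _] := tangent_mem v; exact: vL. Qed.

Lemma tangentM (R : realType) (M : manifold R) (p : M) (v : tangent p)
    (f g : smooth M) : v (f * g) = f p * v g + g p * v f.
Proof. by have /asboolP[_ vM] := tangent_mem v; exact: vM. Qed.

Lemma tangentD (R : realType) (M : manifold R) (p : M) (v : tangent p)
    (f g : smooth M) : v (f + g) = v f + v g.
Proof. by have := tangentP v 1 f g; rewrite scale1r mul1r. Qed.

Definition smooth_field_on (R : realType) (M : manifold R) (U : set M)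
    (X : forall p : M, tangent p) : Prop :=
  forall f : smooth M, smooth_on U (fun p => X p f).

Record vfield (R : realType) (M : manifold R) := VField {
  vfield_at :> forall p : M, tangent p;
  vfield_smooth : smooth_field_on setT vfield_at;
}.

Definition vfield_app (R : realType) (M : manifold R) (X : vfield M)
    (f : smooth M) : smooth M :=
  Smooth (asboolT (vfield_smooth X f)).

Definition vbracket_fun (R : realType) (M : manifold R) (X Y : vfield M)
    (p : M) (f : smooth M) : R :=
  X p (vfield_app Y f) - Y p (vfield_app X f).

Lemma vfield_appP (R : realType) (M : manifold R) (X : vfield M) (a : R)
    (f g : smooth M) :
  vfield_app X (a *: f + g) = a *: vfield_app X f + vfield_app X g.
Proof. by apply: val_inj; apply/funext => p; exact: tangentP. Qed.

Lemma vfield_appM (R : realType) (M : manifold R) (X : vfield M)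
    (f g : smooth M) :
  vfield_app X (f * g) = f * vfield_app X g + g * vfield_app X f.
Proof. by apply: val_inj; apply/funext => p; exact: tangentM. Qed.

Lemma vbracket_mem (R : realType) (M : manifold R) (X Y : vfield M) (p : M) :
  vbracket_fun X Y p \in derivation_at p.
Proof.
apply/asboolP; rewrite /vbracket_fun; split=> [a f g|f g].
  by rewrite !vfield_appP !tangentP; ring.
by rewrite !vfield_appM !tangentD !tangentM /=; ring.
Qed.

Lemma vbracket_smooth (R : realType) (M : manifold R) (X Y : vfield M) :
  smooth_field_on setT (fun p => Tangent (vbracket_mem X Y p)).
Proof.
move=> f; apply: smooth_onD; first exact: openT.
  exact: vfield_smooth.
by apply: smooth_onN; [exact: openT|exact: vfield_smooth].
Qed.

Definition vbracket (R : realType) (M : manifold R) (X Y : vfield M) :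
  vfield M := VField (vbracket_smooth X Y).

Record local_triv (R : realType) (M : manifold R) (E : M -> lmodType R)
    (r : nat) := LocalTriv {
  triv_dom : set M;
  triv_map :> forall p : M, {linear E p -> 'rV[R]_r};
  triv_open : open triv_dom;
  triv_bij : forall p, triv_dom p -> bijective (triv_map p);
}.

(* A vector bundle is given by its fibres and an atlas of local trivializations;
   the smooth structure of the total space is the one determined by the atlas.
   Outside triv_dom the value of triv_map is irrelevant. *)
Record vbundle (R : realType) (M : manifold R) := VBundle {
  fibre :> M -> lmodType R;
  vb_rank : nat;
  trivs : set (local_triv fibre vb_rank);
  trivs_cover : forall p : M, exists2 t, trivs t & triv_dom t p;
  trivs_compat : forall t u, trivs t -> trivs u ->
    exists2 G : M -> 'M[R]_vb_rank,
      (forall p a, triv_dom t p -> triv_dom u p -> u p a = t p a *m G p) &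
      (forall i j, smooth_on (triv_dom t `&` triv_dom u) (fun p => G p i j));
}.

Definition smooth_section_on (R : realType) (M : manifold R) (E : vbundle M)
    (U : set M) (s : forall p : M, E p) : Prop :=
  forall t, @trivs R M E t -> forall j,
    smooth_on (triv_dom t `&` U) (fun p => t p (s p) 0 j).

Record section (R : realType) (M : manifold R) (E : vbundle M) := MkSection {
  section_at :> forall p : M, E p;
  section_smooth : smooth_section_on setT section_at;
}.

Lemma section_ext (R : realType) (M : manifold R) (E : vbundle M)
    (s s' : section E) : (forall p, s p = s' p) -> s = s'.
Proof.
case: s s' => [s sP] [s' s'P] /= ss'.
have e : s = s' by exact: functional_extensionality_dep.
by rewrite e in sP *; congr MkSection; exact: Prop_irrelevance.
Qed.

Lemma section0_smooth (R : realType) (M : manifold R) (E : vbundle M) :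
  smooth_section_on setT (fun p => 0 : E p).
Proof.
move=> t _ j; rewrite (_ : (fun p => _) = cst 0); first exact: smooth_on_cst.
by apply/funext => p; rewrite linear0 mxE.
Qed.

Lemma sectionD_smooth (R : realType) (M : manifold R) (E : vbundle M)
    (s s' : section E) : smooth_section_on setT (fun p => s p + s' p).
Proof.
move=> t Et j.
have oT : open (triv_dom t `&` setT) by rewrite setIT; exact: triv_open.
have := smooth_onD oT (section_smooth s Et j) (section_smooth s' Et j).
by congr smooth_on; apply/funext => p; rewrite linearD mxE.
Qed.

Lemma sectionZ_smooth (R : realType) (M : manifold R) (E : vbundle M)
    (f : smooth M) (s : section E) :
  smooth_section_on setT (fun p => f p *: s p).
Proof.
move=> t Et j.
have oT : open (triv_dom t `&` setT) by rewrite setIT; exact: triv_open.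
have /asboolP/(smooth_on_sub (@subsetT _ (triv_dom t `&` setT))) sf :=
  smooth_mem f.
have := smooth_onM oT sf (section_smooth s Et j).
by congr smooth_on; apply/funext => p; rewrite linearZ mxE.
Qed.

Definition section0 (R : realType) (M : manifold R) (E : vbundle M) :
  section E := MkSection (@section0_smooth R M E).

Definition section_add (R : realType) (M : manifold R) (E : vbundle M)
  (s s' : section E) : section E := MkSection (sectionD_smooth s s').

Definition section_scale (R : realType) (M : manifold R) (E : vbundle M)
  (f : smooth M) (s : section E) : section E := MkSection (sectionZ_smooth f s).

Lemma section_addA (R : realType) (M : manifold R) (E : vbundle M) :
  associative (@section_add R M E).
Proof. by move=> s t u; apply: section_ext => p /=; rewrite addrA. Qed.

Lemma section_addC (R : realType) (M : manifold R) (E : vbundle M) :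
  commutative (@section_add R M E).
Proof. by move=> s t; apply: section_ext => p /=; rewrite addrC. Qed.

Lemma section_add0 (R : realType) (M : manifold R) (E : vbundle M) :
  left_id (section0 E) (@section_add R M E).
Proof. by move=> s; apply: section_ext => p /=; rewrite add0r. Qed.

Lemma section_addN (R : realType) (M : manifold R) (E : vbundle M) :
  left_inverse (section0 E) (section_scale (-1)) (@section_add R M E).
Proof.
by move=> s; apply: section_ext => p /=; rewrite scaleN1r addNr.
Qed.

HB.instance Definition _ (R : realType) (M : manifold R) (E : vbundle M) :=
  gen_eqMixin (section E).
HB.instance Definition _ (R : realType) (M : manifold R) (E : vbundle M) :=
  gen_choiceMixin (section E).
HB.instance Definition _ (R : realType) (M : manifold R) (E : vbundle M) :=
  GRing.isZmodule.Build (section E) (@section_addA R M E)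
    (@section_addC R M E) (@section_add0 R M E) (@section_addN R M E).

Lemma section_scaleA (R : realType) (M : manifold R) (E : vbundle M)
    (f g : smooth M) (s : section E) :
  section_scale f (section_scale g s) = section_scale (f * g) s.
Proof. by apply: section_ext => p /=; rewrite scalerA. Qed.

Lemma section_scale1 (R : realType) (M : manifold R) (E : vbundle M) :
  left_id 1 (@section_scale R M E).
Proof. by move=> s; apply: section_ext => p /=; rewrite scale1r. Qed.

Lemma section_scaleDr (R : realType) (M : manifold R) (E : vbundle M) :
  right_distributive (@section_scale R M E) +%R.
Proof. by move=> f s t; apply: section_ext => p /=; rewrite scalerDr. Qed.

Lemma section_scaleDl (R : realType) (M : manifold R) (E : vbundle M)
    (s : section E) : {morph (@section_scale R M E)^~ s : f g / f + g}.
Proof. by move=> f g; apply: section_ext => p /=; rewrite scalerDl. Qed.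

(* The module structure is over the ring of smooth functions; a real constant
   a acts through the constant function a *: 1. *)
HB.instance Definition _ (R : realType) (M : manifold R) (E : vbundle M) :=
  GRing.Zmodule_isLmodule.Build (smooth M) (section E) (@section_scaleA R M E)
    (@section_scale1 R M E) (@section_scaleDr R M E) (@section_scaleDl R M E).

(* Bundle maps cover the identity of the base; smoothness is expressed by
   their effect on local sections. *)
Record bundle_map (R : realType) (M : manifold R) (E F : vbundle M) :=
  BundleMap {
  bmap_at :> forall p : M, {linear E p -> F p};
  bmap_smooth : forall (U : set M) (s : forall p, E p), open U ->
    smooth_section_on U s -> smooth_section_on U (fun p => bmap_at p (s p));
}.

Definition bmap_app (R : realType) (M : manifold R) (E F : vbundle M)
    (h : bundle_map E F) (s : section E) : section F :=
  MkSection (bmap_smooth h openT (section_smooth s)).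

(* The sections e i form a local frame of k. *)
Definition vector_subbundle (R : realType) (M : manifold R) (E : vbundle M)
    (k : forall p : M, set (E p)) : Prop :=
  exists q : nat, forall p0 : M, exists (U : set M) (e : 'I_q -> forall p, E p),
    [/\ open U, U p0, forall i, smooth_section_on U (e i) &
        forall p, U p -> forall a : E p,
          k p a <-> exists! c : 'I_q -> R, a = \sum_(i < q) c i *: e i p].

Definition section_in (R : realType) (M : manifold R) (E : vbundle M)
    (k : forall p : M, set (E p)) (s : section E) : Prop :=
  forall p, k p (s p).

Record lie_algebroid (R : realType) (M : manifold R) := LieAlgebroid {
  la_bundle :> vbundle M;
  anchor : forall p : M, {linear la_bundle p -> tangent p};
  anchor_smooth : forall (U : set M) (s : forall p, la_bundle p), open U ->
    smooth_section_on U s -> smooth_field_on U (fun p => anchor p (s p));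
  br : section la_bundle -> section la_bundle -> section la_bundle;
  rho := fun s : section la_bundle =>
    VField (anchor_smooth openT (section_smooth s));
  br_linear : forall (a : R) (s t u : section la_bundle),
    br s ((a *: (1 : smooth M)) *: t + u) =
    (a *: (1 : smooth M)) *: br s t + br s u;
  br_anti : forall s t, br s t = - br t s;
  br_jacobi : forall s t u, br s (br t u) = br (br s t) u + br t (br s u);
  br_leibniz : forall s (f : smooth M) t,
    br s (f *: t) = f *: br s t + vfield_app (rho s) f *: t;
  rho_br : forall s t p, rho (br s t) p = vbracket (rho s) (rho t) p;
}.

Definition la_transitive (R : realType) (M : manifold R) (A : lie_algebroid M) :
  Prop := forall (p : M) (v : tangent p), exists a : A p, anchor A p a = v.

Definition la_morphism (R : realType) (M : manifold R) (A B : lie_algebroid M)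
    (h : bundle_map A B) : Prop :=
  (forall p (a : A p), anchor B p (h p a) = anchor A p a) /\
  (forall s t : section A, bmap_app h (br s t) = br (bmap_app h s) (bmap_app h t)).

Definition la_isomorphism (R : realType) (M : manifold R)
    (A B : lie_algebroid M) (h : bundle_map A B) : Prop :=
  la_morphism h /\ exists h' : bundle_map B A,
    [/\ la_morphism h', forall p, cancel (h p) (h' p) &
        forall p, cancel (h' p) (h p)].

(* P, with its projections to A' and B, is the fibre product of A' and B over
   TM: the pair of projections identifies the fibre of P at p with the pairs
   of equal anchor.  The pair of projections is a Lie algebroid morphism into
   A' x B, over the diagonal of M, exactly when both projections are. *)
Definition fibre_product (R : realType) (M : manifold R)
    (A' B P : lie_algebroid M) (pr1 : bundle_map P A') (pr2 : bundle_map P B) :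
    Prop :=
  [/\ la_morphism pr1, la_morphism pr2 &
      forall p (a : A' p) (b : B p), anchor A' p a = anchor B p b ->
        exists! c : P p, pr1 p c = a /\ pr2 p c = b].

Definition bundle_of_ideals (R : realType) (M : manifold R)
    (A : lie_algebroid M) (k : forall p : M, set (A p)) : Prop :=
  [/\ vector_subbundle k,
      forall p a, k p a -> anchor A p a = 0 &
      forall s t : section A, section_in k t -> section_in k (br s t)].

Definition principal_type (R : realType) (M : manifold R)
    (A : lie_algebroid M) (k : forall p : M, set (A p)) : Prop :=
  exists (A' B P : lie_algebroid M) (pr1 : bundle_map P A')
         (pr2 : bundle_map P B) (h : bundle_map A P),
    [/\ la_transitive A', fibre_product pr1 pr2, la_isomorphism h &
        forall p (a : A p), k p a <-> pr2 p (h p a) = 0].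

(* The tangent bundle enters only through its fibres tangent p and its local
   vector fields, so a bundle map from TM to k is a smooth family of linear
   maps tangent p -> A p with values in k. *)
Record form1 (R : realType) (M : manifold R) (A : vbundle M)
    (k : forall p : M, set (A p)) := Form1 {
  form_at :> forall p : M, {linear tangent p -> A p};
  form_in : forall p v, k p (form_at p v);
  form_smooth : forall (U : set M) (X : forall p, tangent p), open U ->
    smooth_field_on U X -> smooth_section_on U (fun p => form_at p (X p));
}.

Definition form_app (R : realType) (M : manifold R) (A : vbundle M)
    (k : forall p : M, set (A p)) (w : form1 k) (X : vfield M) : section A :=
  MkSection (form_smooth w openT (vfield_smooth X)).

Definition lie_deriv (R : realType) (M : manifold R) (A : lie_algebroid M)
    (k : forall p : M, set (A p)) (s : section A) (w : form1 k)
    (X : vfield M) : section A :=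
  br s (form_app w X) - form_app w (vbracket (rho s) X).

Definition partially_split (R : realType) (M : manifold R)
    (A : lie_algebroid M) (k : forall p : M, set (A p)) : Prop :=
  exists (L : section A -> form1 k) (l : bundle_map A A),
    [/\ forall p a, k p (l p a),
        forall p a, k p a -> l p a = a,
        forall (c : R) (s t : section A) p (v : tangent p),
          L ((c *: (1 : smooth M)) *: s + t) p v = c *: L s p v + L t p v,
        forall (f : smooth M) (s : section A) p (v : tangent p),
          L (f *: s) p v = f p *: L s p v + v f *: l p (s p) &
        forall s t : section A,
          (forall X : vfield M, form_app (L (br s t)) X =
             lie_deriv s (L t) X - lie_deriv t (L s) X) /\
          bmap_app l (br s t) =
            br s (bmap_app l t) - form_app (L s) (rho t)].

Record lie_algebra (R : realType) := LieAlgebra {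
  lie_space :> vectType R;
  lie : lie_space -> lie_space -> lie_space;
  lie_linear : forall (a : R) x y z, lie x (a *: y + z) = a *: lie x y + lie x z;
  lie_anti : forall x y, lie x y = - lie y x;
  lie_jacobi : forall x y z, lie x (lie y z) = lie (lie x y) z + lie y (lie x z);
}.

(* The bracket of the fibre of k at p, computed by extending the two arguments
   to sections of k: as k lies in the kernel of the anchor, the bracket of
   sections of k is bilinear over the smooth functions. *)
Definition fibre_bracket (R : realType) (M : manifold R) (A : lie_algebroid M)
    (k : forall p : M, set (A p)) (p : M) (a b : A p) : A p :=
  xget 0 [set c | exists s t : section A,
    [/\ section_in k s, section_in k t, s p = a, t p = b & c = br s t p]].

Definition lie_algebra_bundle (R : realType) (M : manifold R)
    (A : lie_algebroid M) (k : forall p : M, set (A p)) (g : lie_algebra R) :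
    Prop :=
  forall p0 : M, exists (U : set M) (h : forall p, {linear g -> A p}),
    [/\ open U, U p0, forall x, smooth_section_on U (fun p => h p x),
        forall p, U p -> injective (h p) /\ (forall a, k p a <-> range (h p) a) &
        forall p, U p -> forall x y,
          h p (lie x y) = fibre_bracket k (h p x) (h p y)].

Definition replace_arg (T : Type) (n : nat) (x : 'I_n -> T) (i : 'I_n) (v : T) :
  'I_n -> T := fun m => if m == i then v else x m.

Definition cochain (R : realType) (g : lie_algebra R) (V : lmodType R) (n : nat)
    (w : ('I_n -> g) -> V) : Prop :=
  (forall x i (c : R) u v, w (replace_arg x i (c *: u + v)) =
     c *: w (replace_arg x i u) + w (replace_arg x i v)) /\
  (forall x i j, i != j -> x i = x j -> w x = 0).

(* The Chevalley-Eilenberg differential with coefficients in the module V, on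
   which g acts by act.  In the second sum the pair (i, j), i < j, contributes
   (-1)^j w(x_0, .., [x_i, x_j], .., ^x_j, .., x_n) with [x_i, x_j] in place i
   and x_j omitted; moving the bracket to the front gives the usual sign
   (-1)^(i + j). *)
Definition ce_diff (R : realType) (g : lie_algebra R) (V : lmodType R)
    (act : g -> V -> V) (n : nat) (w : ('I_n -> g) -> V) (x : 'I_n.+1 -> g) : V :=
  \sum_(i < n.+1) (-1) ^+ i *: act (x i) (w (fun m => x (lift i m))) +
  \sum_(j < n.+1) \sum_(i < n | (i < j)%N)
    (-1) ^+ j *: w (replace_arg (fun m => x (lift j m)) i
                     (lie (x (lift j i)) (x j))).

Definition ce_cocycle (R : realType) (g : lie_algebra R) (V : lmodType R)
    (act : g -> V -> V) (n : nat) (w : ('I_n -> g) -> V) : Prop :=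
  cochain w /\ forall x, ce_diff act w x = 0.

Definition ce_coboundary (R : realType) (g : lie_algebra R) (V : lmodType R)
    (act : g -> V -> V) (n : nat) : (('I_n -> g) -> V) -> Prop :=
  match n with
  | 0 => fun w => forall x, w x = 0
  | m.+1 => fun w => exists2 z : ('I_m -> g) -> V,
      cochain z & forall x, w x = ce_diff act z x
  end.

Definition adjoint_cohomology_zero (R : realType) (g : lie_algebra R)
    (n : nat) : Prop :=
  forall w : ('I_n -> g) -> g, ce_cocycle (@lie R g) w ->
    ce_coboundary (@lie R g) w.

(* Main.v *)
Require Import Defs.
From HB Require Import structures.
From mathcomp Require Import all_boot all_order all_algebra.
From mathcomp Require Import all_classical all_reals all_analysis.
From mathcomp Require Import ring lra.
Import Order.TTheory GRing.Theory Num.Theory.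
Import numFieldNormedType.Exports.
Set Implicit Arguments.
Unset Strict Implicit.
Unset Printing Implicit Defensive.
Local Open Scope classical_set_scope.
Local Open Scope ring_scope.

(* As H^0(g, g) = 0, the adjoint map of g is injective, and as H^1(g, g) = 0 its
   image consists of all derivations.  Local Lie connections, flat in local
   trivializations, glue to a global connection nab on k by derivations of the
   fibre bracket.  Every derivation of k over a vector field X is then nab_X + ad z
   for a unique section z of k, which is smooth if the derivation is.  Hence the
   derivations of k are the sections of A' = TM + k, and their commutator makes A'
   a transitive Lie algebroid.  Since A acts on k by derivations, there is a morphism
   (rho, l) : A -> A', where l is a projection onto k; as A / k is identified with
   B = ker l, this exhibits A as the fibre product of A' and B over TM.  The form
   L(a) of the partial splitting sends X to minus the k-component of the bracket
   of (rho a, l a) and (X, 0) in A'.  That TM is a vector bundle, which A' requires,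
   rests on Hadamard's lemma. *)

(** * Functions of class C^k on open sets of R^n *)

(** Existence is settled point by point and smoothness afterwards. Over one point, a derivation
    minus [nab] is linear over the functions, hence an endomorphism of the fibre, so both cohomology
    hypotheses are applied to [g] alone. Smoothness of z rests on the fact that in a Lie algebra
    trivialization the matrix of ad is constant: being injective, it has a constant one-sided
    inverse. Brackets and tangent vectors accept only global sections and functions, which is why
    local objects are cut off throughout. The gluing uses, in place of a locally finite partition of
    unity, a countable cover with bump functions psi_n and the recursion w_(n+1) = w_n + (1 - w_n)
    psi_n: once some psi_n equals 1 at a point, the weight there is 1 and the connection no longer
    changes. The equation for L([a, b]) is the Jacobi identity in A' for (X, 0) and the images of a
    and b; the one for l([a, b]) comes from splitting the image of b into its parts in TM and in
    k. *)

Lemma cvg_sumv (R : realType) (T : topologicalType) (V : normedModType R)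
    (I : Type) (r : seq I) (P : pred I) (f : I -> T -> V) (x : T) :
  (forall i, P i -> {for x, continuous (f i)}) ->
  {for x, continuous (fun y => \sum_(i <- r | P i) f i y)}.
Proof.
move=> cf; apply: (@cvg_big V I +%R 0 P _ T (nbhs x) r f (fun i => f i x)).
  exact: add_continuous.
exact: cf.
Qed.

Lemma differentiable_of_near (R : realType) (V W : normedModType R)
    (f : V -> W) (df : {linear V -> W}) (x : V) : continuous df ->
  (forall e, 0 < e ->
     \forall h \near (0 : V), `|f (h + x) - f x - df h| <= e * `|h|) ->
  differentiable f x /\ 'd f x = df :> (V -> W).
Proof.
move=> cdf H.
have E : f \o shift x = cst (f x) + df +o_ 0 id.
  apply/eqaddoP => e e0; near=> h.
  rewrite /= /GRing.opp /GRing.add /= opprD addrA.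
  by near: h; exact: H.
have D := diff_unique cdf E.
by split=> //; apply/diff_locallyP; rewrite D.
Unshelve. all: by end_near. Qed.

Lemma linear_rV_continuous (R : realType) (n : nat)
    (df : {linear 'rV[R]_n -> R}) : continuous (df : 'rV[R]_n -> R).
Proof.
move=> h; rewrite (_ : (df : _ -> R) = fun h => \sum_(i < n) h 0 i *: df (delta_mx 0 i)).
  apply: cvg_sumv => i _; apply: (@cvgZr_tmp _ _ _ (nbhs h)).
  exact: (@coord_continuous R 1 n 0 i h).
apply/funext => v; rewrite {1}[v]row_sum_delta linear_sum.
by apply: eq_bigr => i _; rewrite linearZ.
Qed.

Lemma diff_partials (R : realType) (n : nat) (f : 'rV[R]_n -> R)
    (x v : 'rV[R]_n) : differentiable f x ->
  'd f x v = \sum_i v 0 i * 'D_(delta_mx 0 i) f x.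
Proof.
move=> df; rewrite {1}[v]row_sum_delta linear_sum.
by apply: eq_bigr => i _; rewrite linearZ deriveE.
Qed.

Lemma continuous_rV (R : realType) (T : topologicalType) (n : nat)
    (g : T -> 'rV[R]_n) (x : T) :
  (forall j, {for x, continuous (fun y => g y 0 j)}) -> {for x, continuous g}.
Proof.
move=> cg; rewrite /prop_for /continuous_at.
rewrite (_ : g = fun y => \sum_(j < n) g y 0 j *: delta_mx 0 j).
  apply: (@cvg_sumv R T 'rV[R]_n 'I_n (index_enum 'I_n) xpredT
    (fun j y => g y 0 j *: (delta_mx 0 j))) => j _.
  by apply: cvgZr_tmp; exact: cg.
by apply/funext => y; rewrite -row_sum_delta.
Qed.

Lemma differentiable_rV (R : realType) (n m : nat) (g : 'rV[R]_n -> 'rV[R]_m)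
    (x : 'rV[R]_n) :
  (forall j, differentiable (fun y => g y 0 j) x) -> differentiable g x.
Proof.
move=> dg.
rewrite (_ : g = \sum_(j < m) (fun y => g y 0 j *: (delta_mx 0 j : 'rV[R]_m))).
  apply: differentiable_sum => j; exact: differentiableZl.
by apply/funext => y; rewrite fct_sumE -row_sum_delta.
Qed.

Lemma Ck_sum (R : realType) (n k : nat) (U : set 'rV[R]_n) (I : Type)
    (r : seq I) (P : pred I) (f : I -> 'rV[R]_n -> R) :
  open U -> (forall i, P i -> Ck k U (f i)) ->
  Ck k U (fun x => \sum_(i <- r | P i) f i x).
Proof.
move=> oU Cf; rewrite (_ : (fun x => _) = \sum_(i <- r | P i) f i).
  elim/big_rec: _ => [|i g Pi Cg]; first exact: (Ck_cst _ _ 0).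
  by apply: CkD => //; exact: Cf.
by apply/funext => x; rewrite fct_sumE.
Qed.

Lemma derive_comp_rV (R : realType) (n m : nat) (F : 'rV[R]_m -> R)
    (g : 'rV[R]_n -> 'rV[R]_m) (x v : 'rV[R]_n) :
  (forall j, differentiable (fun y => g y 0 j) x) -> differentiable F (g x) ->
  'D_v (F \o g) x =
    \sum_j 'D_v (fun y => g y 0 j) x * 'D_(delta_mx 0 j) F (g x).
Proof.
move=> dg dF; have dg' := differentiable_rV dg.
rewrite deriveE; last exact: differentiable_comp.
rewrite diff_comp //= diff_partials //; apply: eq_bigr => j _; congr (_ * _).
by rewrite -deriveE // derive_mx ?mxE //; exact: diff_derivable.
Qed.

(** The induction generalizes [F] and keeps [g]: by the chain rule, a partial derivative of F o g is
    a sum of partial derivatives of [g] times partial derivatives of [F] composed with the same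
    [g]. *)
Lemma Ck_comp (R : realType) (n m k : nat) (U : set 'rV[R]_n)
    (V : set 'rV[R]_m) (F : 'rV[R]_m -> R) (g : 'rV[R]_n -> 'rV[R]_m) :
  open U -> (forall j, Ck k U (fun x => g x 0 j)) ->
  (forall x, U x -> V (g x)) -> Ck k V F -> Ck k U (F \o g).
Proof.
move=> oU; elim: k F => [|k IH] F.
  move=> cg UV cF x Ux; apply: continuous_comp; last exact: cF (UV _ Ux).
  by apply: continuous_rV => j; exact: cg.
move=> Cg UV [dF DF]; split=> [x Ux|i].
  apply: differentiable_comp; last exact/dF/UV.
  by apply: differentiable_rV => j; have [+ _] := Cg j; exact.
have : Ck k U (fun x => \sum_j 'D_(delta_mx 0 i) (fun y => g y 0 j) x *
    ('D_(delta_mx 0 j) F \o g) x).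
  apply: Ck_sum => // j _; apply: (CkM oU); first by have [_ +] := Cg j; exact.
  by apply: IH (DF j) => // l; exact/Ck_le/Cg.
apply: Ck_ext oU _ => x Ux; rewrite derive_comp_rV //; last exact/dF/UV.
by move=> j; have [+ _] := Cg j; exact.
Qed.

Lemma CkV (R : realType) (n k : nat) (U : set 'rV[R]_n) (f : 'rV[R]_n -> R) :
  open U -> (forall x, U x -> f x != 0) -> Ck k U f ->
  Ck k U (fun x => (f x)^-1).
Proof.
move=> oU f0; elim: k f f0 => [|k IH] f f0.
  by move=> cf x Ux; apply: continuousV; [exact: f0|exact: cf].
move=> Cf; have [df Df] := Cf; split=> [x Ux|i].
  by apply: differentiableV; [exact: df|exact: f0].
have CV := IH f f0 (Ck_le Cf).
have := CkM oU (Ck_cst k U (-1)) (CkM oU (CkM oU CV CV) (Df i)).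
apply: Ck_ext oU _ => x Ux.
rewrite deriveV ?f0 //; last exact/diff_derivable/df.
by rewrite !fctE /cst scaleNr mulN1r /GRing.scale /= expr2 invfM.
Qed.

Lemma derive_coord (R : realType) (n : nat) (i j : 'I_n) (x : 'rV[R]_n) :
  'D_(delta_mx 0 i) (fun y : 'rV[R]_n => y 0 j) x = (i == j)%:R.
Proof.
have := @derive_mx R _ 1 n id x (delta_mx 0 i) (@derivable_id _ _ _ _).
rewrite derive_id => /matrixP/(_ 0 j); rewrite !mxE /= => <-.
by rewrite eq_sym.
Qed.

Lemma Ck_coord (R : realType) (n k : nat) (U : set 'rV[R]_n) (j : 'I_n) :
  Ck k U (fun x => x 0 j).
Proof.
case: k => [|k]; first by move=> x _; exact: coord_continuous.
split=> [x _|i]; first exact: differentiable_coord.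
rewrite (_ : (fun x => _) = cst ((i == j)%:R)); first exact: Ck_cst.
by apply/funext => x; rewrite derive_coord.
Qed.

(** The derivatives in [Ck] are taken in the whole space, so [Ck k V f] is a condition at each
    single point of [V]. *)
Lemma Ck_local (R : realType) (n k : nat) (U : set 'rV[R]_n)
    (f : 'rV[R]_n -> R) :
  (forall x, U x -> exists2 V : set 'rV[R]_n, V x & Ck k V f) -> Ck k U f.
Proof.
elim: k f => [|k IH] f H /=.
  by move=> x /H[V Vx]; exact.
split=> [x /H[V Vx [+ _]]|i]; first exact.
by apply: IH => x /H[V Vx [_ CV]]; exists V => //; exact: CV.
Qed.

(** * Bump functions *)

(* The functions x^-m exp(-1/x), extended by 0, are closed under derivation up to
   linear combinations. *)
Definition flat (R : realType) (m : nat) (x : R) : R :=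
  if 0 < x then x^-1 ^+ m * expR (- x^-1) else 0.

Lemma flat_le0 (R : realType) (m : nat) (x : R) : x <= 0 -> flat m x = 0.
Proof. by rewrite /flat; case: ltgtP. Qed.

Lemma flat_gt0 (R : realType) (m : nat) (x : R) : 0 < x -> 0 < flat m x.
Proof.
by move=> x0; rewrite /flat x0 mulr_gt0 ?expR_gt0 // exprn_gt0 // invr_gt0.
Qed.

Lemma flat_ge0 (R : realType) (m : nat) (x : R) : 0 <= flat m x.
Proof. by case: (ltP 0 x) => [/flat_gt0/ltW //|/flat_le0 ->]. Qed.

Lemma flatS (R : realType) (m : nat) (x : R) : flat m x = x * flat m.+1 x.
Proof.
rewrite /flat; case: ltP => [x0|]; last by rewrite mulr0.
by rewrite exprS mulrA [x * _]mulrA mulfV ?gt_eqF // mul1r.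
Qed.

(** This is e^y >= y^(m+1) / (m+1)! at y = 1/x. The decay claimed at 0 is only linear; a further
    factor x is gained from [flatS]. *)
Lemma flat_bound (R : realType) (m : nat) (x : R) :
  `|flat m x| <= m.+1`!%:R * `|x|.
Proof.
case: (ltP 0 x) => [x0|/flat_le0 ->]; last by rewrite normr0 mulr_ge0.
rewrite ger0_norm ?flat_ge0 // gtr0_norm // /flat x0 expRN.
have y0 : 0 <= x^-1 by rewrite invr_ge0 ltW.
rewrite ler_pdivrMr ?expR_gt0 //.
have H := le_trans (_ : _ <= 1 + _) (expR_ge1Dxn m y0).
have {H} : x^-1 ^+ m.+1 / m.+1`!%:R <= expR x^-1 by apply: H; rewrite lerDr.
rewrite ler_pdivrMr ?ltr0n ?fact_gt0 // exprS => H.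
rewrite -(ler_pM2l (_ : 0 < x^-1)) ?invr_gt0 // (le_trans H) //.
rewrite [leRHS](_ : _ = expR x^-1 * m.+1`!%:R) //.
by field; rewrite gt_eqF.
Qed.

Lemma is_derive_flat (R : realType) (m : nat) (x : R) :
  is_derive x 1 (flat m) (flat m.+2 x - m%:R * flat m.+1 x).
Proof.
case: (ltgtP x 0) => [x0|x0|->].
- rewrite !flat_le0 ?ltW // mulr0 subrr.
  have E : \forall y \near x, (cst 0 : R -> R) y = flat m y.
    by near=> y; rewrite flat_le0 // ltW //; near: y; exact: lt_nbhsl.
  exact: near_eq_is_derive E (is_derive_cst 0 x 1).
- pose f (y : R) := y^-1 ^+ m * expR (- y^-1).
  have E : \forall y \near x, f y = flat m y.
    by near=> y; rewrite /flat /f ifT //; near: y; exact: lt_nbhsr.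
  have x0' : x != 0 by rewrite gt_eqF.
  apply: near_eq_is_derive E _; rewrite /flat x0 {}/f.
  have DV : is_derive x 1 (fun y : R => y^-1) (- x ^- 2).
    by apply: is_derive_eq (is_deriveV x0' (is_derive_id x 1)) _; rewrite scaler1.
  have DE : is_derive x 1 (fun y : R => expR (- y^-1)) (x ^- 2 * expR (- x^-1)).
    rewrite -[x ^- 2]opprK mulrC.
    exact: (is_derive1_comp (is_derive_expR _) (is_deriveN DV)).
  have DX : is_derive x 1 ((fun y : R => y^-1) ^+ m)
      ((m%:R * x^-1 ^+ m.-1) *: (- x ^- 2)).
    case: m => [|m]; last exact: is_deriveX.
    by rewrite mul0r scale0r expr0; exact: is_derive_cst.
  have := is_deriveM DX DE.
  rewrite (_ : (fun y : R => y^-1) ^+ m * _ = fun y => y^-1 ^+ m * expR (- y^-1)).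
    move=> D; apply: is_derive_eq D _; rewrite /GRing.scale /= exprfctE.
    have key (e y : R) : y ^+ m * (y ^+ 2 * e) + e * (m%:R * y ^+ m.-1 * - y ^+ 2) =
        y ^+ m.+2 * e - m%:R * (y ^+ m.+1 * e).
      by case: m {DX DE} => [|m] /=; rewrite ?exprS ?expr0; ring.
    by rewrite -exprVn; exact: key.
  by apply/funext => y; rewrite fctE exprfctE.
- rewrite !flat_le0 // mulr0 subrr.
  have [D1 D2] : differentiable (flat m) (0 : R) /\
      'd (flat m) (0 : R) = (\0 : {linear R -> R}) :> (R -> R).
    apply: (@differentiable_of_near R R R).
      by move=> y; exact: cst_continuous.
    move=> e e0; near=> h; rewrite addr0 (flat_le0 m (lexx 0)) !subr0.
    (* [flat m h] is h times [flat m.+1 h], and the second factor is at most (m+2)! |h|, hence at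
       most e as soon as |h| < e / (m+2)!. *)
    rewrite flatS normrM mulrC ler_pM //.
    rewrite (le_trans (flat_bound _ _)) // -ler_pdivlMl ?ltr0n ?fact_gt0 //.
    near: h; apply/nbhs_ballP; exists (m.+2`!%:R^-1 * e) => /=.
      by rewrite mulr_gt0 // invr_gt0 ltr0n fact_gt0.
    by move=> y; rewrite /ball /= sub0r normrN => /ltW.
  apply: DeriveDef; first exact/derivable1_diffP.
  by rewrite deriveE // D2.
Unshelve. all: by end_near. Qed.

Lemma derive_comp1 (R : realType) (n : nat) (phi : R -> R) (d : R)
    (f : 'rV[R]_n -> R) (x v : 'rV[R]_n) :
  is_derive (f x) 1 phi d -> differentiable f x ->
  differentiable (phi \o f) x /\ 'D_v (phi \o f) x = d * 'D_v f x.
Proof.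
move=> [/derivable1_diffP dphi phid] df.
have dc : differentiable (phi \o f) x by exact: differentiable_comp.
split=> //; rewrite deriveE // diff_comp //= deriv1E; last exact/derivable1_diffP.
by rewrite derive1E phid /= deriveE // mulrC.
Qed.

(** The induction has to range over all [m], since the derivative of [flat m] involves [flat m.+1]
    and [flat m.+2]. *)
Lemma Ck_flat (R : realType) (n k m : nat) (U : set 'rV[R]_n)
    (f : 'rV[R]_n -> R) : open U -> Ck k U f -> Ck k U (flat m \o f).
Proof.
move=> oU; elim: k m f => [|k IH] m f.
  move=> cf x Ux; apply: continuous_comp; first exact: cf.
  apply/differentiable_continuous/derivable1_diffP.
  by have [] := is_derive_flat m (f x).
move=> Cf; have [df Df] := Cf.
split=> [x Ux|i]; first by have [] := derive_comp1 0 (is_derive_flat m (f x)) (df x Ux).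
have C j := IH j f (Ck_le Cf).
have := CkM oU (CkD oU (C m.+2) (CkM oU (Ck_cst k U (- m%:R)) (C m.+1))) (Df i).
apply: Ck_ext oU _ => x Ux.
have [_ ->] := derive_comp1 (delta_mx 0 i) (is_derive_flat m (f x)) (df x Ux).
by rewrite !fctE /cst /= mulNr.
Qed.

Definition smooth_step (R : realType) (x : R) : R :=
  flat 0 x / (flat 0 x + flat 0 (1 - x)).

Lemma smooth_step_den (R : realType) (x : R) : 0 < flat 0 x + flat 0 (1 - x).
Proof.
case: (ltP 0 x) => x0; first by rewrite ltr_pwDl ?flat_gt0 ?flat_ge0.
by rewrite ltr_wpDl ?flat_ge0 // flat_gt0 // subr_gt0 (le_lt_trans x0).
Qed.

Lemma smooth_step0 (R : realType) (x : R) : x <= 0 -> smooth_step x = 0.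
Proof. by move=> x0; rewrite /smooth_step flat_le0 // mul0r. Qed.

Lemma smooth_step1 (R : realType) (x : R) : 1 <= x -> smooth_step x = 1.
Proof.
move=> x1; rewrite /smooth_step (flat_le0 _ (_ : 1 - x <= 0)) ?subr_le0 //.
by rewrite addr0 divff // gt_eqF // flat_gt0 // (lt_le_trans _ x1).
Qed.

Lemma Ck_smooth_step (R : realType) (n k : nat) (U : set 'rV[R]_n)
    (f : 'rV[R]_n -> R) : open U -> Ck k U f -> Ck k U (@smooth_step R \o f).
Proof.
move=> oU Cf; have C1 := Ck_flat 0 oU Cf.
have C2 := Ck_flat 0 oU (CkD oU (Ck_cst k U 1) (CkM oU (Ck_cst k U (-1)) Cf)).
have /(CkV oU) := CkD oU C1 C2; have E x :
   ((flat 0 \o f) + (flat 0 \o (cst 1 + cst (-1) * f))) x =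
   flat 0 (f x) + flat 0 (1 - f x).
  by rewrite !fctE /cst /= mulN1r.
move=> /(_ _)/(CkM oU C1) H; apply: Ck_ext oU _ (H _) => x Ux.
  by rewrite fctE E.
by rewrite E gt_eqF // smooth_step_den.
Qed.

(** The norm of the row space is the sup norm, which is not smooth, so the bump is a function of the
    squared Euclidean distance Q from [x0]: [smooth_step] of 2 - Q/r is 1 for Q <= r and 0 for Q >=
    2r. With r = e^2/4 one has 2r < e^2, which places [K] inside the sup ball of radius e contained
    in [U]. *)
Lemma rV_bump (R : realType) (n : nat) (U : set 'rV[R]_n) (x0 : 'rV[R]_n) :
  open U -> U x0 -> exists b : 'rV[R]_n -> R, exists W K : set 'rV[R]_n,
  [/\ Cinfty setT b, open W /\ W x0, forall x, W x -> b x = 1,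
      compact K /\ K `<=` U & forall x, ~ K x -> b x = 0].
Proof.
move=> oU Ux0.
have [e /= e0 eU] := (nbhs_ballP _ _).1 (open_nbhs_nbhs (conj oU Ux0)).
pose Q (x : 'rV[R]_n) := \sum_i (x 0 i - x0 0 i) ^+ 2.
pose r := e ^+ 2 / 4; have r0 : 0 < r by rewrite divr_gt0 // exprn_gt0.
have CQ k : Ck k setT Q.
  apply: Ck_sum => [|i _]; first exact: openT.
  have := CkD openT (Ck_coord k setT i) (Ck_cst k setT (- x0 0 i)).
  by move=> C; exact: (CkM openT C C).
have cQ : continuous Q by move=> x; exact: (CQ 0).
exists (@smooth_step R \o (cst 2 + cst (- r^-1) * Q)).
exists (Q @^-1` [set y | y < r]), (Q @^-1` [set y | y <= 2 * r]).
have Qi (x : 'rV[R]_n) i : `|x 0 i - x0 0 i| ^+ 2 <= Q x.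
  rewrite real_normK ?num_real // /Q (bigD1 i) //= lerDl sumr_ge0 // => j _.
  exact: sqr_ge0.
split.
- move=> k; apply: Ck_smooth_step; first exact: openT.
  apply: CkD; [exact: openT|exact: Ck_cst|].
  by apply: CkM; [exact: openT|exact: Ck_cst|].
- split; first by apply: open_comp => [x _|]; [exact: cQ|exact: open_lt].
  by rewrite /= /Q big1 // => i _; rewrite subrr expr0n.
- move=> x /= Qr; rewrite smooth_step1 // !fctE /cst mulNr lerBrDr -lerBrDl.
  by rewrite ler_pdivrMl // (le_trans (ltW Qr)) //; lra.
- split.
    have cK : closed (Q @^-1` [set y | y <= 2 * r]).
      by apply: closed_comp => [x _|]; [exact: cQ|exact: closed_le].
    apply: (subclosed_compact cK
      (@rV_compact _ _ (fun i => `[x0 0 i - e, x0 0 i + e]%classic) _)).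
      by move=> i; exact: segment_compact.
    move=> x /= Qx i; rewrite in_itv /= -ler_distl.
    rewrite -(ler_pXn2r (_ : 0 < 2)%N) ?nnegrE ?(ltW e0) //.
    by rewrite (le_trans (Qi x i)) // (le_trans Qx) // /r; nra.
  move=> x /= Qx; apply: eU; split=> // i j; rewrite ord1 /ball /= distrC.
  rewrite -(ltr_pXn2r (_ : 0 < 2)%N) ?nnegrE ?(ltW e0) //.
  rewrite (le_lt_trans (Qi x j)) // (le_lt_trans Qx) // /r.
  have : 0 < e ^+ 2 by rewrite exprn_gt0.
  by lra.
- move=> x /= /negP; rewrite -ltNge => Qx; rewrite smooth_step0 //.
  by rewrite !fctE /cst mulNr subr_le0 ler_pdivlMl // mulrC ltW.
Qed.

(** * Hadamard's lemma *)

Definition int01 (R : realType) (f : R -> R) : R :=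
  \int[@lebesgue_measure R]_(t in `[0, 1]%classic) f t.

Definition cont01 (R : realType) (f : R -> R) : Prop :=
  forall t, 0 <= t <= 1 -> {for t, continuous f}.

Lemma cont01_within (R : realType) (f : R -> R) : cont01 f ->
  {within `[0, 1]%classic, continuous f}.
Proof.
by move=> cf; apply: continuous_in_subspaceT => t; rewrite inE /= in_itv; exact: cf.
Qed.

Lemma cont01_integrable (R : realType) (f : R -> R) : cont01 f ->
  (@lebesgue_measure R).-integrable `[0, 1]%classic (EFin \o f).
Proof.
move=> cf; apply: continuous_compact_integrable; first exact: segment_compact.
exact: cont01_within.
Qed.

Lemma int01D (R : realType) (f g : R -> R) : cont01 f -> cont01 g ->
  int01 (fun t => f t + g t) = int01 f + int01 g.
Proof. by move=> cf cg; apply: RintegralD => //; exact: cont01_integrable. Qed.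

Lemma int01Z (R : realType) (a : R) (f : R -> R) : cont01 f ->
  int01 (fun t => a * f t) = a * int01 f.
Proof. by move=> cf; apply: RintegralZl => //; exact: cont01_integrable. Qed.

Lemma cont01D (R : realType) (f g : R -> R) : cont01 f -> cont01 g ->
  cont01 (fun t => f t + g t).
Proof. by move=> cf cg t t01; exact: (continuousD (cf t t01) (cg t t01)). Qed.

Lemma cont01M (R : realType) (f g : R -> R) : cont01 f -> cont01 g ->
  cont01 (fun t => f t * g t).
Proof. by move=> cf cg t t01; exact: (continuousM (cf t t01) (cg t t01)). Qed.

Lemma cont01_sum (R : realType) (n : nat) (f : 'I_n -> R -> R) :
  (forall i, cont01 (f i)) -> cont01 (fun t => \sum_i f i t).
Proof. by move=> cf t t01; apply: cvg_sumv => i _; exact: cf. Qed.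

Lemma int01_sum (R : realType) (n : nat) (f : 'I_n -> R -> R) :
  (forall i, cont01 (f i)) ->
  int01 (fun t => \sum_i f i t) = \sum_i int01 (f i).
Proof.
elim: n f => [|n IH] f cf.
  rewrite big_ord0 /int01 (_ : (fun t => _) = cst 0).
    by rewrite Rintegral_cst // mul0r.
  by apply/funext => t; rewrite big_ord0.
rewrite big_ord_recl -IH // -int01D //; last exact: cont01_sum.
by congr int01; apply/funext => t; rewrite big_ord_recl.
Qed.

Lemma int01_le (R : realType) (c : R) (f : R -> R) : cont01 f ->
  (forall t : R, 0 <= t <= 1 -> `|f t| <= c) -> `|int01 f| <= c.
Proof.
move=> cf fc; apply: le_trans (le_normr_Rintegral _ (cont01_integrable cf)) _ => //.
have -> : c = int01 (cst c).
  have L : @lebesgue_measure R `[0, 1]%classic = 1%E.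
    by rewrite lebesgue_measure_itv /= lte_fin ltr01 sube0.
  by rewrite /int01 Rintegral_cst //; move: L => /= ->; rewrite mulr1.
apply: le_Rintegral; [by []| | |by move=> t; rewrite /= in_itv; exact: fc].
- apply: (@cont01_integrable R (fun t => `|f t|)) => t t01.
  by apply: cvg_norm; exact: cf.
- by apply: cont01_integrable => t _; exact: cst_continuous.
Qed.

Lemma int01_FTC (R : realType) (f F : R -> R) : cont01 f ->
  (forall t : R, 0 <= t <= 1 -> is_derive t 1 F (f t)) -> int01 f = F 1 - F 0.
Proof.
move=> cf dF.
have cF t : 0 <= t <= 1 -> {for t, continuous F}.
  move=> /dF[/derivable1_diffP D _]; exact: differentiable_continuous.
have := @continuous_FTC2 R f F 0 1 ltr01 (cont01_within cf).
rewrite /int01 /Rintegral => ->; first by rewrite -EFinB.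
  split=> [t t01||].
  - move: t01; rewrite in_itv /= => /andP[/ltW t0 /ltW t1].
    by have [] := dF t _ => //; rewrite t0.
  - by apply: cvg_at_right_filter; apply: cF; rewrite lexx ler01.
  - by apply: cvg_at_left_filter; apply: cF; rewrite lexx ler01.
move=> t; rewrite in_itv /= => /andP[t0 t1]; rewrite derive1E.
by have [] := dF t _ => //; rewrite !ltW.
Qed.

Lemma cvg_dist_le (R : realType) (T : topologicalType) (f : T -> R) (x : T) :
  (forall e, 0 < e -> \forall y \near x, `|f x - f y| <= e) ->
  {for x, continuous f}.
Proof. by move=> H; apply/cvgrPdist_le. Qed.

Lemma near_forall_ord (T : topologicalType) (n : nat) (x : T)
    (P : 'I_n -> T -> Prop) :
  (forall j, \near x, P j x) -> \forall y \near x, forall j, P j y.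
Proof. by move=> H; apply: filter_forall. Qed.

Lemma differentiable_line (R : realType) (V : normedModType R) (p v : V) (t : R) :
  differentiable (fun s : R => p + s *: v) t /\
  'd (fun s : R => p + s *: v) t 1 = v.
Proof.
have [ds1 ds2] := is_diff_scalel t v.
have dc : differentiable (cst p : R -> V) t by exact: differentiable_cst.
split; first exact: (differentiableD dc ds1).
by rewrite (diffD dc ds1) diff_cst ds2 -[LHS]/(0 + 1 *: v) add0r scale1r.
Qed.

Section Hadamard.
Context (R : realType) (n : nat) (B : set 'rV[R]_n) (x0 : 'rV[R]_n).
Hypothesis oB : open B.
Hypothesis starB : forall x (t : R), B x -> 0 <= t <= 1 -> B (x0 + t *: (x - x0)).

Let ray (t : R) (x : 'rV[R]_n) : 'rV[R]_n := x0 + t *: (x - x0).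

(** The weight t^m makes the family stable under differentiation: each partial derivative along the
    ray brings out one more factor t. The coefficients of Hadamard's lemma are the case m = 0. *)
Definition ray_mean (m : nat) (F : 'rV[R]_n -> R) (x : 'rV[R]_n) : R :=
  int01 (fun t => t ^+ m * F (ray t x)).

(** Compactness of [0, 1] makes the neighbourhood of [x] uniform in t: the near-covering property is
    applied to the jointly continuous map sending (t, y) to F(ray t y). *)
Lemma ray_near (F : 'rV[R]_n -> R) (x : 'rV[R]_n) (e : R) :
  (forall y, B y -> {for y, continuous F}) -> B x -> 0 < e ->
  \forall y \near x, forall t : R, 0 <= t <= 1 -> `|F (ray t y) - F (ray t x)| < e.
Proof.
move=> cF Bx e0.
have cG (t : R) : 0 <= t <= 1 ->
    (fun z : R * 'rV[R]_n => F (ray z.1 z.2)) z @[z --> (t, x)] --> F (ray t x).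
  move=> t01.
  apply: (@cvg_comp _ _ _ (fun z : R * 'rV[R]_n => ray z.1 z.2) F _ (nbhs (ray t x))).
    apply: cvgD; first exact: cvg_cst.
    apply: cvgZ; first exact: cvg_fst.
    by apply: cvgB; [exact: cvg_snd|exact: cvg_cst].
  exact/cF/starB.
have /compact_near_coveringP/(_ _ (nbhs x) (fun y t => `|F (ray t y) - F (ray t x)| < e)) :
    compact (`[0, 1]%classic : set R) by exact: segment_compact.
move=> H; have {}H := H _ _; apply: filterS (H _ _) => [y Hy t t01|t].
  by apply: (Hy t); rewrite /= in_itv.
rewrite /= in_itv /= => t01.
have e2 : 0 < e / 2 by rewrite divr_gt0.
have /cvgrPdist_lt/(_ _ e2)[[/= P Q] [nP nQ] PQ] := cG t t01.
exists (P, Q) => //= -[s y] [/= Ps Qy].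
have H1 := PQ (s, y) (conj Ps Qy); have H2 := PQ (s, x) (conj Ps (nbhs_singleton nQ)).
rewrite /= in H1 H2.
rewrite -(subrK (F (ray t x)) (F (ray s y))) -addrA (splitr e).
by rewrite (le_lt_trans (ler_normD _ _)) // ltrD // distrC.
Qed.

Lemma cont01_ray (m : nat) (F : 'rV[R]_n -> R) (x : 'rV[R]_n) :
  (forall y, B y -> {for y, continuous F}) -> B x ->
  cont01 (fun t => t ^+ m * F (ray t x)).
Proof.
move=> cF Bx; apply: cont01M => t t01; first exact: exprn_continuous.
apply: (@cvg_comp _ _ _ (fun t => ray t x) F _ (nbhs (ray t x))).
  apply: cvgD; first exact: cvg_cst.
  by apply: cvgZr_tmp.
exact/cF/starB.
Qed.

Lemma ray_mean_continuous (m : nat) (F : 'rV[R]_n -> R) (x : 'rV[R]_n) :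
  (forall y, B y -> {for y, continuous F}) -> B x ->
  {for x, continuous (ray_mean m F)}.
Proof.
move=> cF Bx; apply: cvg_dist_le => e e0.
have nB : \forall y \near x, B y by exact: open_nbhs_nbhs.
apply: filterS (filterI nB (ray_near cF Bx e0)) => y [By Hy].
have cx := @cont01_ray m F x cF Bx; have cy := @cont01_ray m F y cF By.
have E : ray_mean m F x - ray_mean m F y =
    int01 (fun t => t ^+ m * F (ray t x) + -1 * (t ^+ m * F (ray t y))).
  rewrite int01D ?int01Z ?mulN1r //.
  by apply: cont01M => // t _; exact: cst_continuous.
rewrite E; apply: int01_le => [|t t01].
  by apply: cont01D => //; apply: cont01M => // t _; exact: cst_continuous.
rewrite mulN1r -mulrBr normrM -[e]mul1r ler_pM //.
  by rewrite normrX exprn_ile1 // ger0_norm; case/andP: t01.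
by rewrite distrC ltW // Hy.
Qed.

Lemma is_derive_line (F : 'rV[R]_n -> R) (p v : 'rV[R]_n) (t : R) :
  differentiable F (p + t *: v) ->
  is_derive t 1 (fun s => F (p + s *: v))
    (\sum_j v 0 j * 'D_(delta_mx 0 j) F (p + t *: v)).
Proof.
move=> dF; have [dL1 dL2] := differentiable_line p v t.
have dFL : differentiable (F \o (fun s : R => p + s *: v)) t.
  exact: differentiable_comp.
rewrite -diff_partials //; apply: DeriveDef; first exact/derivable1_diffP.
by rewrite deriveE // diff_comp //= dL2.
Qed.

(** Differentiation under the integral sign, by direct estimate: the increment of [F] from ray t x
    to ray t (x + h) is rewritten by the mean value theorem, and [ray_near] bounds the variation of
    the partial derivatives uniformly in t. The extra factor t comes from ray t (x + h) - ray t x =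
    t h. *)
Lemma ray_mean_differentiable (m : nat) (F : 'rV[R]_n -> R) (x : 'rV[R]_n) :
  Ck 1 B F -> B x -> differentiable (ray_mean m F) x /\
  forall i, 'D_(delta_mx 0 i) (ray_mean m F) x =
    ray_mean m.+1 (fun y => 'D_(delta_mx 0 i) F y) x.
Proof.
move=> [dF cDF] Bx.
have cF y : B y -> {for y, continuous F}.
  by move=> /dF; exact: differentiable_continuous.
pose D (h : 'rV[R]_n) : R := \sum_j h 0 j *
  ray_mean m.+1 (fun y => 'D_(delta_mx 0 j) F y) x.
have D_lin : linear D.
  move=> a u v; rewrite /D scaler_sumr -big_split; apply: eq_bigr => j _.
  by rewrite !mxE mulrDl -mulrA.
pose DM := GRing.isLinear.Build _ _ _ _ D D_lin.
pose DL : {linear 'rV[R]_n -> R} := HB.pack D DM.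
have [|d1 d2] := @differentiable_of_near R _ _ (ray_mean m F) DL x
  (@linear_rV_continuous R n DL).
  move=> e e0.
  (* Each of the n coordinates will contribute at most e' |h| to the error; dividing by n + 1 rather
     than n also covers n = 0. *)
  pose e' := e / n.+1%:R; have e'0 : 0 < e' by rewrite divr_gt0.
  have : \forall y \near x, B y /\ forall j (t : R), 0 <= t <= 1 ->
      `|'D_(delta_mx 0 j) F (ray t y) - 'D_(delta_mx 0 j) F (ray t x)| < e'.
    apply: filterI; first exact: open_nbhs_nbhs.
    apply: (@near_forall_ord 'rV[R]_n n x (fun j y => forall t : R, 0 <= t <= 1 ->
      `|'D_(delta_mx 0 j) F (ray t y) - 'D_(delta_mx 0 j) F (ray t x)| < e')) => j.
    by apply: (@ray_near (fun y => 'D_(delta_mx 0 j) F y)) => // y; exact: cDF.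
  move=> /nbhs_ballP[d /= d0 dH].
  apply/nbhs_ballP; exists d => //= h; rewrite -ball_normE /= sub0r normrN => hd.
  have xh (s : R) : 0 <= s <= 1 -> ball x d (x + s *: h).
    move=> /andP[s0 s1]; rewrite -ball_normE /= opprD addrA subrr sub0r normrN.
    by rewrite normrZ ger0_norm // (le_lt_trans _ hd) // ler_piMl.
  have Bh : B (h + x).
    by rewrite addrC -[h]scale1r; apply: (dH _ (xh 1 _)).1; rewrite ler01 lexx.
  have cj j : cont01 (fun t => h 0 j * (t ^+ m.+1 * 'D_(delta_mx 0 j) F (ray t x))).
    apply: cont01M => [t _|]; first exact: cst_continuous.
    by apply: (@cont01_ray m.+1 (fun y => 'D_(delta_mx 0 j) F y) x) => // y; exact: cDF.
  have c1 := @cont01_ray m F x cF Bx; have c2 := @cont01_ray m F _ cF Bh.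
  have c3 (f : R -> R) : cont01 f -> cont01 (fun t => -1 * f t).
    by move=> cf; apply: cont01M => // t _; exact: cst_continuous.
  have E : ray_mean m F (h + x) - ray_mean m F x - DL h =
      int01 (fun t => t ^+ m * F (ray t (h + x)) + -1 * (t ^+ m * F (ray t x)) +
        -1 * \sum_j h 0 j * (t ^+ m.+1 * 'D_(delta_mx 0 j) F (ray t x))).
    rewrite int01D; [|by apply: cont01D => //; exact: c3|exact/c3/cont01_sum].
    rewrite int01D; [|by []|exact: c3].
    rewrite !int01Z //; last exact: cont01_sum.
    rewrite !mulN1r int01_sum //; congr (_ - _); apply: eq_bigr => j _.
    rewrite int01Z //.
    by apply: (@cont01_ray m.+1 (fun y => 'D_(delta_mx 0 j) F y) x) => // y; exact: cDF.
  rewrite E; apply: int01_le => [|t t01].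
    by apply: cont01D; [apply: cont01D => //; exact: c3|exact/c3/cont01_sum].
  have rayE (s : R) : ray t (x + s *: h) = ray t x + s *: (t *: h).
    by rewrite /ray -[RHS]addrA scalerA mulrC -scalerA -scalerDr addrAC.
  have Bs (s : R) : 0 <= s <= 1 -> B (ray t x + s *: (t *: h)).
    by move=> s01; rewrite -rayE; apply: starB => //; exact: (dH _ (xh s s01)).1.
  have dline (s : R) : 0 <= s <= 1 -> is_derive s 1 (fun s => F (ray t x + s *: (t *: h)))
    (\sum_j (t *: h) 0 j * 'D_(delta_mx 0 j) F (ray t x + s *: (t *: h))).
    by move=> s01; apply: is_derive_line; exact/dF/Bs.
  have [||s s01] := @MVT_segment R (fun s => F (ray t x + s *: (t *: h)))
      (fun s => \sum_j (t *: h) 0 j * 'D_(delta_mx 0 j) F (ray t x + s *: (t *: h))) 0 1 ler01.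
  - by move=> s; rewrite in_itv /= => /andP[/ltW s0 /ltW s1]; apply: dline; rewrite s0.
  - apply: cont01_within => s s01; have [/derivable1_diffP D1 _] := dline s s01.
    exact: differentiable_continuous D1.
  rewrite in_itv /= in s01; rewrite scale1r scale0r addr0 subr0 mulr1 => MV.
  have rh : ray t (h + x) = ray t x + t *: h by rewrite addrC -{1}[h]scale1r rayE scale1r.
  rewrite rh !mulN1r -mulrBr MV mulr_sumr -sumrB.
  apply: le_trans (ler_norm_sum _ _ _) _.
  apply: (@le_trans _ _ (\sum_(j < n) (e' * `|h|))); last first.
    rewrite sumr_const card_ord -mulr_natr mulrAC ler_wpM2r //.
    by rewrite /e' -mulrA ler_piMr ?(ltW e0) // mulrC ler_pdivrMr // mul1r ler_nat.
  apply: ler_sum => j _; rewrite !mxE exprSr.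
  set a := 'D_ _ _ _; set b := 'D_ _ _ _.
  rewrite (_ : _ - _ = t ^+ m * t * h 0 j * (a - b)); last by ring.
  rewrite !normrM mulrC ler_pM //.
    by rewrite ltW // /a -rayE; exact: (dH _ (xh s s01)).2.
  have t1 : `|t| <= 1 by rewrite ger0_norm; case/andP: t01.
  rewrite -[leRHS]mul1r ler_pM //.
    by rewrite mulr_ile1 // normrX exprn_ile1.
  rewrite /Num.Def.normr /= mx_normrE.
  exact: (le_bigmax _ (fun i : 'I_1 * 'I_n => `|h i.1 i.2|) (0, j)).
split=> // i; rewrite deriveE // d2 /= /D (bigD1 i) //= big1 => [|j ji].
  by rewrite !mxE !eqxx mul1r addr0.
by rewrite !mxE (negPf ji) andbF mul0r.
Qed.

Lemma Ck_ray_mean (k m : nat) (F : 'rV[R]_n -> R) :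
  Ck k B F -> Ck k B (ray_mean m F).
Proof.
elim: k m F => [|k IH] m F CF; first by move=> x Bx; exact: ray_mean_continuous.
have C1 : Ck 1 B F.
  have [dF DF] := CF; split=> // i; elim: k {IH CF} DF => [|k IHk] DF; first exact: DF.
  by apply: IHk => j; exact: Ck_le.
split=> [x Bx|i]; first by have [] := ray_mean_differentiable m C1 Bx.
have := IH m.+1 _ (CF.2 i); apply: Ck_ext oB _ => x Bx.
by have [_ ->] := ray_mean_differentiable m C1 Bx.
Qed.

(** The coefficients are the integrals of the partial derivatives along the ray, and the expansion
    is the fundamental theorem of calculus for t -> F(x0 + t (x - x0)). At [x0] the ray is constant,
    which gives the last claim. *)
Lemma hadamard (F : 'rV[R]_n -> R) : B x0 -> Cinfty B F ->
  exists h : 'I_n -> 'rV[R]_n -> R,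
  [/\ forall j, Cinfty B (h j),
      forall x, B x -> F x = F x0 + \sum_j (x 0 j - x0 0 j) * h j x &
      forall j, h j x0 = 'D_(delta_mx 0 j) F x0].
Proof.
move=> Bx0 CF; exists (fun j => ray_mean 0 (fun y => 'D_(delta_mx 0 j) F y)); split.
- by move=> j k; apply: Ck_ray_mean; have [_] := CF k.+1; exact.
- move=> x Bx; have [dF cDF] := CF 1%N.
  have cj j : cont01 (fun t => t ^+ 0 * 'D_(delta_mx 0 j) F (ray t x)).
    by apply: (@cont01_ray 0 (fun y => 'D_(delta_mx 0 j) F y) x) => // y; exact: cDF.
  have cj' j : cont01 (fun t => (x - x0) 0 j * (t ^+ 0 * 'D_(delta_mx 0 j) F (ray t x))).
    by apply: cont01M => // t _; exact: cst_continuous.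
  have dray (t : R) : 0 <= t <= 1 -> is_derive t 1 (fun t => F (ray t x))
      (\sum_j (x - x0) 0 j * (t ^+ 0 * 'D_(delta_mx 0 j) F (ray t x))).
    move=> t01; apply: is_derive_eq (is_derive_line _) _; first exact/dF/starB.
    by apply: eq_bigr => j _; rewrite expr0 mul1r.
  have E : F x - F x0 = F (ray 1 x) - F (ray 0 x).
    congr (F _ - F _); first by rewrite /ray scale1r addrC subrK.
    by rewrite /ray scale0r addr0.
  apply/eqP; rewrite addrC -subr_eq E -(int01_FTC (cont01_sum cj') dray).
  rewrite int01_sum //; apply/eqP/eq_bigr => j _.
  by rewrite int01Z // !mxE.
- move=> j; rewrite /ray_mean /int01 (_ : (fun t => _) = cst ('D_(delta_mx 0 j) F x0)).
    have L : @lebesgue_measure R `[0, 1]%classic = 1%E.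
      by rewrite lebesgue_measure_itv /= lte_fin ltr01 sube0.
    by rewrite Rintegral_cst //; move: L => /= ->; rewrite mulr1.
  by apply/funext => t; rewrite /ray subrr scaler0 addr0 expr0 mul1r.
Qed.

End Hadamard.

(** * Smooth functions and tangent vectors of a manifold *)

Lemma smooth_on_glue (R : realType) (M : manifold R) (U : set M) (f : M -> R) :
  open U ->
  (forall p, U p -> exists (V : set M) (g : M -> R),
    [/\ open V, V p, smooth_on V g & forall q, V q -> U q -> f q = g q]) ->
  smooth_on U f.
Proof.
move=> oU H c Mc k; apply: Ck_local => x [cx Ux].
have [V [g [oV Vx sg fg]]] := H _ Ux.
exists (chart_cod c `&` chart_inv c @^-1` (V `&` U)) => //.
have oVU : open (V `&` U) by exact: openI.
apply: (Ck_ext (chart_open (c := c) oVU) (f := g \o chart_inv c)).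
  by move=> y [cy [Vy Uy]] /=; rewrite fg.
by apply: Ck_sub (sg c Mc k) => y [cy [Vy _]].
Qed.

Lemma smooth_on_ext (R : realType) (M : manifold R) (U : set M) (f g : M -> R) :
  open U -> (forall p, U p -> f p = g p) -> smooth_on U f -> smooth_on U g.
Proof.
move=> oU fg sf; apply: smooth_on_glue => // p Up.
by exists U, f; split=> // q _ /fg.
Qed.

Lemma smooth_on_sum (R : realType) (M : manifold R) (U : set M) (I : Type)
    (r : seq I) (P : pred I) (f : I -> M -> R) :
  open U -> (forall i, P i -> smooth_on U (f i)) ->
  smooth_on U (fun p => \sum_(i <- r | P i) f i p).
Proof.
move=> oU sf; rewrite (_ : (fun p => _) = \sum_(i <- r | P i) f i).
  elim/big_rec: _ => [|i g Pi sg]; first exact: smooth_on0.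
  by apply: smooth_onD => //; exact: sf.
by apply/funext => x; rewrite fct_sumE.
Qed.

Lemma smooth_on_prod (R : realType) (M : manifold R) (U : set M) (I : Type)
    (r : seq I) (P : pred I) (f : I -> M -> R) :
  open U -> (forall i, P i -> smooth_on U (f i)) ->
  smooth_on U (fun p => \prod_(i <- r | P i) f i p).
Proof.
move=> oU sf; rewrite (_ : (fun p => _) = \prod_(i <- r | P i) f i).
  elim/big_rec: _ => [|i g Pi sg]; first exact: smooth_on_cst.
  by apply: smooth_onM => //; exact: sf.
by apply/funext => x; elim/big_rec2: _ => // i y1 y2 _ ->; rewrite fctE.
Qed.

Lemma smooth_onV (R : realType) (M : manifold R) (U : set M) (f : M -> R) :
  open U -> (forall p, U p -> f p != 0) -> smooth_on U f ->
  smooth_on U (fun p => (f p)^-1).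
Proof.
move=> oU f0 sf c Mc k; apply: CkV (sf c Mc k); first exact: chart_open.
by move=> x [_ Ux]; exact: f0.
Qed.

Lemma smooth_onT (R : realType) (M : manifold R) (f : smooth M) (U : set M) :
  smooth_on U f.
Proof. by have /asboolP sf := smooth_mem f; exact: smooth_on_sub sf. Qed.

Lemma chart_open_preimage (R : realType) (M : manifold R)
    (c : chart R M (mdim M)) (V : set 'rV[R]_(mdim M)) :
  open V -> open (chart_dom c `&` c @^-1` V).
Proof.
move=> oV; rewrite openE => p [cp Vp]; apply: filterI.
  by apply: open_nbhs_nbhs; split=> //; exact: chart_dom_open.
by apply: (chart_map_cont cp); apply: open_nbhs_nbhs; split.
Qed.

(** Read in another chart [d], the function is [F] composed with a transition map; this uses
    [atlas_compat]. *)
Lemma smooth_pullback (R : realType) (M : manifold R)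
    (c : chart R M (mdim M)) (V : set 'rV[R]_(mdim M))
    (F : 'rV[R]_(mdim M) -> R) :
  atlas c -> open V -> Cinfty V F ->
  smooth_on (chart_dom c `&` c @^-1` V) (F \o c).
Proof.
move=> Mc oV CF d Md k.
apply: (@Ck_comp R _ _ k _ V F (fun v => c (chart_inv d v))) => //.
- exact/chart_open/chart_open_preimage.
- move=> j; apply: Ck_sub (atlas_compat Md Mc j k).
  by move=> v [dv [cv _]].
- by move=> v [dv [cv Vv]].
Qed.

Lemma smooth_onT_continuous (R : realType) (M : manifold R) (U : set M)
    (f : M -> R) (p : M) : open U -> smooth_on U f -> U p ->
  {for p, continuous f}.
Proof.
move=> oU sf Up; have [c Mc cp] := atlas_cover p.
have cf := sf c Mc 0%N (c p) (conj (chart_mapP cp) _).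
rewrite /= chart_mapK // in cf; have {}cf := cf Up.
have : {for p, continuous ((f \o chart_inv c) \o c)}.
  exact: continuous_comp (chart_map_cont cp) cf.
apply: near_eq_continuous.
have := open_nbhs_nbhs (conj (chart_dom_open c) cp).
by apply: filterS => q cq /=; rewrite chart_mapK.
Qed.

(** The bump of the chart is extended by 0. For this to be smooth, [S] must be closed in [M] and not
    only in the chart domain: it is the image of a compact set, and [M] is Hausdorff. *)
Lemma manifold_bump (R : realType) (M : manifold R) (U : set M) (p : M) :
  open U -> U p -> exists (chi : smooth M) (W S : set M),
  [/\ open W /\ W p, forall q, W q -> chi q = 1, closed S /\ S `<=` U &
      forall q, ~ S q -> chi q = 0].
Proof.
move=> oU Up; have [c Mc cp] := atlas_cover p.
have cpU : (chart_cod c `&` chart_inv c @^-1` U) (c p).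
  by split; [exact: chart_mapP|rewrite /= chart_mapK].
have [b [W [K [sb [oW Wp] b1 [cK KU] b0]]]] := rV_bump (chart_open oU) cpU.
pose chi q : R := if pselect (chart_dom c q) then b (c q) else 0.
pose S := chart_inv c @` K.
have clS : closed S.
  apply: compact_closed; first exact: manifold_hausdorff.
  apply: continuous_compact => //; apply: continuous_in_subspaceT => v.
  by rewrite inE => /KU[cv _]; exact: chart_inv_cont.
have chiE q : chart_dom c q -> chi q = b (c q).
  by rewrite /chi; case: pselect.
have chi0 q : ~ S q -> chi q = 0.
  rewrite /chi; case: pselect => // cq Sq; apply: b0 => Kq; apply: Sq.
  by exists (c q) => //; exact: chart_mapK.
have schi : smooth_on setT chi.
  apply: smooth_on_glue; first exact: openT.
  move=> q _; have [cq|ncq] := pselect (chart_dom c q).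
    exists (chart_dom c `&` c @^-1` setT), (b \o c); split=> //.
    - exact/chart_open_preimage/openT.
    - by apply: smooth_pullback => //; exact: openT.
    - by move=> q' [cq' _] _; exact: chiE.
  exists (~` S), (cst 0); split=> //.
  - exact: closed_openC.
  - by case=> v /KU[cv _] qE; apply: ncq; rewrite -qE; exact: chart_invP.
  - exact: smooth_on_cst.
  - by move=> q' Sq' _; exact: chi0.
exists (Smooth (asboolT schi)), (chart_dom c `&` c @^-1` W), S; split=> //=.
- by split=> //; exact: chart_open_preimage.
- by move=> q [cq Wq]; rewrite chiE // b1.
- by split=> // q [v /KU[cv Uv] <-].
Qed.

Lemma smooth_cutoff (R : realType) (M : manifold R) (V S : set M)
    (chi : smooth M) (f : M -> R) : open V -> closed S -> S `<=` V ->
  (forall q, ~ S q -> chi q = 0) -> smooth_on V f ->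
  smooth_on setT (fun q => chi q * f q).
Proof.
move=> oV cS SV chi0 sf; apply: smooth_on_glue; first exact: openT.
move=> q _; have [Vq|nVq] := pselect (V q).
  exists V, ((chi : M -> R) * f); split=> //; apply: smooth_onM => //.
  exact: smooth_onT.
exists (~` S), (cst 0); split=> //.
- exact: closed_openC.
- by move=> /SV.
- exact: smooth_on_cst.
- by move=> q' Sq' _; rewrite chi0 // mul0r.
Qed.

Lemma smoothE (R : realType) (M : manifold R) (f g : smooth M) (a : R) (p : M) :
  [/\ (f + g) p = f p + g p, (f * g) p = f p * g p, (- f) p = - f p,
      (a *: f) p = a * f p & (1 : smooth M) p = 1].
Proof. by split. Qed.

Lemma smooth_realE (R : realType) (M : manifold R) (c : R) (p : M) :
  (c *: (1 : smooth M)) p = c.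
Proof. by change (c * 1 = c); rewrite mulr1. Qed.

Lemma smooth_eq (R : realType) (M : manifold R) (f g : smooth M) :
  (forall p, f p = g p) -> f = g.
Proof. by move=> fg; apply: val_inj; apply/funext. Qed.

Lemma tangent_eq (R : realType) (M : manifold R) (p : M) (v w : tangent p) :
  (forall f, v f = w f) -> v = w.
Proof. by move=> vw; apply: val_inj; apply/funext. Qed.

Lemma tangentE (R : realType) (M : manifold R) (p : M) (v w : tangent p)
    (a : R) (f : smooth M) :
  [/\ (v + w) f = v f + w f, (a *: v) f = a * v f, (- v) f = - v f &
      (0 : tangent p) f = 0].
Proof. by split. Qed.

Lemma tangent_sumE (R : realType) (M : manifold R) (p : M) (I : Type)
    (r : seq I) (P : pred I) (v : I -> tangent p) (f : smooth M) :
  (\sum_(i <- r | P i) v i) f = \sum_(i <- r | P i) v i f.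
Proof. by elim/big_rec2: _ => // i y1 y2 _ <-. Qed.

Lemma tangentZ (R : realType) (M : manifold R) (p : M) (v : tangent p)
    (a : R) (f : smooth M) : v (a *: f) = a * v f.
Proof.
have v0 : v 0 = 0.
  have := tangentD v 0 0; rewrite addr0 => /eqP.
  by rewrite -subr_eq0 opprD addNKr oppr_eq0 => /eqP.
by rewrite -[a *: f]addr0 tangentP v0 addr0.
Qed.

Lemma tangentB (R : realType) (M : manifold R) (p : M) (v : tangent p)
    (f g : smooth M) : v (f - g) = v f - v g.
Proof. by rewrite tangentD -scaleN1r tangentZ mulN1r. Qed.

Lemma tangent0 (R : realType) (M : manifold R) (p : M) (v : tangent p) : v 0 = 0.
Proof. by rewrite -[0](scale0r (1 : smooth M)) tangentZ mul0r. Qed.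

Lemma tangent_sum (R : realType) (M : manifold R) (p : M) (v : tangent p)
    (I : Type) (r : seq I) (P : pred I) (f : I -> smooth M) :
  v (\sum_(i <- r | P i) f i) = \sum_(i <- r | P i) v (f i).
Proof.
elim/big_rec2: _ => [|i y1 y2 _ <-]; first exact: tangent0.
by rewrite tangentD.
Qed.

Lemma tangent1 (R : realType) (M : manifold R) (p : M) (v : tangent p) : v 1 = 0.
Proof.
have := tangentM v 1 1; have [_ _ _ _ ->] := smoothE 1 1 0 p.
rewrite !mul1r => /eqP; rewrite -subr_eq0 opprD addNKr oppr_eq0.
by move=> /eqP.
Qed.

(** For a bump [chi] at [p] supported in [W], the product chi (f - g) vanishes identically, and the
    Leibniz rule at [p], where chi = 1 and f - g = 0, reduces its derivative to v (f - g). *)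
Lemma tangent_local (R : realType) (M : manifold R) (p : M) (v : tangent p)
    (f g : smooth M) (W : set M) :
  open W -> W p -> (forall q, W q -> f q = g q) -> v f = v g.
Proof.
move=> oW Wp fg; apply/eqP; rewrite -subr_eq0 -tangentB.
have [chi [W' [S [[_ W'p] chi1 [_ SW] chi0]]]] := manifold_bump oW Wp.
have E : chi * (f - g) = 0.
  apply: smooth_eq => q; change (chi q * (f q - g q) = 0).
  have [Sq|nSq] := pselect (S q); last by rewrite chi0 // mul0r.
  by rewrite fg ?subrr ?mulr0 //; exact: SW.
have := tangentM v chi (f - g); rewrite E tangent0 chi1 // mul1r.
have -> : (f - g) p = 0 by change (f p - g p = 0); rewrite fg ?subrr.
by rewrite mul0r addr0 => <-.
Qed.

Section Coordinates.
Context (R : realType) (M : manifold R).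
Local Notation n := (mdim M).
Variable (c : chart R M n).
Hypothesis Mc : atlas c.

Definition partial_fun (i : 'I_n) (p : M) (f : smooth M) : R :=
  'D_(delta_mx 0 i) (f \o chart_inv c) (c p).

Lemma chart_differentiable (f : smooth M) (p : M) :
  chart_dom c p -> differentiable (f \o chart_inv c) (c p).
Proof.
move=> cp; have /asboolP/(_ c Mc 1%N)[+ _] := smooth_mem f.
by apply; split=> //; exact: chart_mapP.
Qed.

Lemma partial_derivation (i : 'I_n) (p : M) :
  chart_dom c p -> partial_fun i p \in derivation_at p.
Proof.
move=> cp; have D f := diff_derivable (v := delta_mx 0 i) (chart_differentiable f cp).
apply/asboolP; split=> [a f g|f g]; rewrite /partial_fun.
  rewrite (_ : (a *: f + g : smooth M) \o chart_inv c =
    (a \*: (f \o chart_inv c)) + (g \o chart_inv c)) //.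
  by rewrite deriveD ?deriveZ //; exact: derivableZ.
rewrite (_ : (f * g : smooth M) \o chart_inv c =
  (f \o chart_inv c) * (g \o chart_inv c)) //.
by rewrite deriveM //= chart_mapK.
Qed.

Definition partial (i : 'I_n) (p : M) : tangent p :=
  if pselect (chart_dom c p) is left cp then Tangent (partial_derivation i cp)
  else 0.

Lemma partialE (i : 'I_n) (p : M) (f : smooth M) :
  chart_dom c p -> partial i p f = partial_fun i p f.
Proof. by rewrite /partial; case: pselect. Qed.

Lemma partial_smooth (i : 'I_n) : smooth_field_on (chart_dom c) (partial i).
Proof.
move=> f.
have CF : Cinfty (chart_cod c) ('D_(delta_mx 0 i) (f \o chart_inv c)).
  move=> k; have /asboolP/(_ c Mc k.+1)[_ /(_ i)] := smooth_mem f.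
  by apply: Ck_sub => v cv; split.
have := smooth_pullback Mc (@chart_cod_open _ _ _ c) CF.
move=> /(smooth_on_sub (U := chart_dom c)) H.
apply: smooth_on_ext (H _) => [|p cp|p cp]; first exact: chart_dom_open.
  by rewrite partialE.
by split=> //; exact: chart_mapP.
Qed.

Lemma ball_star (m : nat) (x0 x : 'rV[R]_m) (e t : R) :
  ball x0 e x -> 0 <= t <= 1 -> ball x0 e (x0 + t *: (x - x0)).
Proof.
rewrite -ball_normE /= => xe /andP[t0 t1].
rewrite opprD addrA subrr sub0r normrN normrZ ger0_norm // distrC.
by rewrite (le_lt_trans _ xe) // ler_piMl.
Qed.

(** Hadamard's expansion of [f] at [p] holds only near [p], while [v] acts on global functions. It
    is therefore multiplied by eta^2, one factor extending the coordinate differences and the other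
    the coefficients. The term f(p) v(eta^2) then appears on both sides and cancels, and each
    remaining product has a first factor vanishing at [p]. *)
Lemma tangent_partials (W : set M) (X : 'I_n -> smooth M) (p : M)
    (v : tangent p) :
  open W -> W `<=` chart_dom c -> (forall q j, W q -> X j q = c q 0 j) ->
  W p -> v = \sum_j v (X j) *: partial j p.
Proof.
move=> oW Wc XE Wp; have cp := Wc _ Wp; apply: tangent_eq => f.
rewrite tangent_sumE.
set x0 := c p; have cx0 : chart_cod c x0 by exact: chart_mapP.
have [e /= e0 eC] := (nbhs_ballP _ _).1 (open_nbhs_nbhs (conj (@chart_cod_open _ _ _ c) cx0)).
have oB : open (ball x0 e) by exact: ball_open.
have CF : Cinfty (ball x0 e) (f \o chart_inv c).
  move=> k; have /asboolP/(_ c Mc k) := smooth_mem f; apply: Ck_sub => x /eC cx.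
  by split.
have [h [Ch fE h0]] := hadamard oB (fun x t => @ball_star n x0 x e t)
  (ballxx x0 e0) CF.
pose V := W `&` (chart_dom c `&` c @^-1` ball x0 e).
have oV : open V by apply: openI => //; exact: chart_open_preimage.
have Vp : V p by split=> //; split=> //; exact: ballxx.
have [eta [W' [S [[_ W'p] eta1 [cS SV] eta0]]]] := manifold_bump oV Vp.
have sk j : smooth_on setT (fun q => eta q * (h j \o c) q).
  apply: (smooth_cutoff oV cS SV eta0).
  by apply: smooth_on_sub (smooth_pullback Mc oB (Ch j)) => q [].
pose k j := Smooth (asboolT (sk j)).
pose l j : smooth M := eta * (X j - x0 0 j *: (1 : smooth M)).
have lk : eta * eta * f = f p *: (eta * eta : smooth M) + \sum_j l j * k j.
  apply: smooth_eq => q.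
  have -> : (f p *: (eta * eta) + \sum_j l j * k j) q =
      f p * (eta q * eta q) + \sum_j (eta q * (X j q - x0 0 j)) * (eta q * h j (c q)).
    have <- : (\sum_j l j * k j) q =
        \sum_j (eta q * (X j q - x0 0 j)) * (eta q * h j (c q)).
      elim/big_rec2: _ => // j y1 y2 _ <-; congr (_ + _).
      change (eta q * (X j q - x0 0 j * 1) * (eta q * h j (c q)) =
        eta q * (X j q - x0 0 j) * (eta q * h j (c q))).
      by rewrite mulr1.
    by [].
  change (eta q * eta q * f q = f p * (eta q * eta q) +
    \sum_j eta q * (X j q - x0 0 j) * (eta q * h j (c q))).
  have [Sq|nSq] := pselect (S q); last first.
    by rewrite eta0 // !mul0r mulr0 add0r big1 // => j _; rewrite !mul0r.
  have [Wq [cq Bq]] := SV _ Sq.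
  have := fE _ Bq; rewrite /= chart_mapK // /x0 chart_mapK // => ->.
  rewrite mulrDr mulrC; congr (_ + _); rewrite mulr_sumr; apply: eq_bigr => j _.
  by rewrite XE // -/x0; ring.
have eta1p : eta p = 1 by exact: eta1.
have := congr1 v lk; rewrite tangentM tangentD tangentZ tangent_sum.
have -> : (eta * eta) p = 1 by change (eta p * eta p = 1); rewrite eta1p mulr1.
rewrite mul1r addrC => /addrI ->; apply: eq_bigr => j _.
rewrite tangentM.
have -> : l j p = 0.
  change (eta p * (X j p - x0 0 j * 1) = 0).
  by rewrite XE // mulr1 subrr mulr0.
have -> : k j p = partial_fun j p f.
  by change (eta p * h j x0 = partial_fun j p f); rewrite eta1p mul1r h0.
rewrite mul0r add0r mulrC -[RHS]/(v (X j) * partial j p f).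
rewrite partialE //; congr (_ * _).
rewrite tangentM tangentB tangentZ tangent1 mulr0 subr0 eta1p mul1r.
have -> : (X j - x0 0 j *: (1 : smooth M)) p = 0.
  by change (X j p - x0 0 j * 1 = 0); rewrite XE // mulr1 subrr.
by rewrite mul0r addr0.
Qed.

Lemma partial_coord (W : set M) (X : 'I_n -> smooth M) (p : M) (i j : 'I_n) :
  open W -> W `<=` chart_dom c -> (forall q j, W q -> X j q = c q 0 j) ->
  W p -> partial i p (X j) = (i == j)%:R.
Proof.
move=> oW Wc XE Wp; have cp := Wc _ Wp; rewrite partialE // -(derive_coord i j (c p)).
have Wcp : (chart_cod c `&` chart_inv c @^-1` W) (c p).
  by split; [exact: chart_mapP|rewrite /= chart_mapK].
apply: near_eq_derive.
apply: filterS (open_nbhs_nbhs (conj (chart_open oW) Wcp)) => v [cv Wv] /=.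
by rewrite XE // chart_invK.
Qed.

End Coordinates.

(** The coordinates are cut off to global functions [X j], so that a tangent vector can be evaluated
    on them; the values v (X j) are its components in the frame [d]. *)
Lemma tangent_frame (R : realType) (M : manifold R) (p0 : M) :
  exists (W : set M) (X : 'I_(mdim M) -> smooth M)
         (d : 'I_(mdim M) -> forall p : M, tangent p),
  [/\ open W /\ W p0, forall i, smooth_field_on W (d i),
      forall p, W p -> forall i j, d i p (X j) = (i == j)%:R &
      forall p (v : tangent p), W p -> v = \sum_j v (X j) *: d j p].
Proof.
have [c Mc cp] := atlas_cover p0.
have [chi [W [S [[oW Wp] chi1 [cS Sc] chi0]]]] := manifold_bump (chart_dom_open c) cp.
have sX j : smooth_on setT (fun q => chi q * c q 0 j).
  apply: (smooth_cutoff (chart_dom_open c) cS Sc chi0).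
  have := smooth_pullback Mc openT (fun k => Ck_coord k setT j).
  by apply: smooth_on_sub => q cq; split.
pose X j := Smooth (asboolT (sX j)).
have oW' : open (W `&` chart_dom c) by apply: openI => //; exact: chart_dom_open.
have XE q j : (W `&` chart_dom c) q -> X j q = c q 0 j.
  by move=> [Wq _] /=; rewrite chi1 // mul1r.
exists (W `&` chart_dom c), X, (partial Mc); split=> //.
- by move=> i f; apply: smooth_on_sub (partial_smooth Mc i f) => q [].
- by move=> p Wp' i j; apply: (partial_coord Mc i j oW' _ XE) => // q [].
- by move=> p v Wp'; apply: (tangent_partials Mc v oW' _ XE) => // q [].
Qed.

(** * Vector bundles from sheaves of local sections *)

Lemma section_glue (R : realType) (M : manifold R) (E : vbundle M) (U : set M)
    (s : forall p, E p) : open U ->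
  (forall p, U p -> exists (V : set M) (s' : forall p, E p),
    [/\ open V, V p, smooth_section_on V s' & forall q, V q -> U q -> s q = s' q]) ->
  smooth_section_on U s.
Proof.
move=> oU H t Et j; apply: smooth_on_glue.
  by apply: openI => //; exact: triv_open.
move=> p [tp Up]; have [V [s' [oV Vp ss' ss]]] := H p Up.
exists (triv_dom t `&` V), (fun q => t q (s' q) 0 j); split.
- by apply: openI => //; exact: triv_open.
- by split.
- exact: ss'.
- by move=> q [tq Vq] [_ Uq]; rewrite ss.
Qed.

Lemma section_sub (R : realType) (M : manifold R) (E : vbundle M) (U V : set M)
    (s : forall p, E p) : U `<=` V -> smooth_section_on V s -> smooth_section_on U s.
Proof.
move=> UV ss t Et j; apply: smooth_on_sub (ss t Et j).
by move=> p [tp /UV].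
Qed.

Lemma section_comb (R : realType) (M : manifold R) (E : vbundle M) (U : set M)
    (c : M -> R) (s s' : forall p, E p) :
  open U -> smooth_on U c -> smooth_section_on U s -> smooth_section_on U s' ->
  smooth_section_on U (fun p => c p *: s p + s' p).
Proof.
move=> oU sc ss ss' t Et j.
have oT : open (triv_dom t `&` U) by apply: openI => //; exact: triv_open.
have sc' : smooth_on (triv_dom t `&` U) c by apply: smooth_on_sub sc => p [].
have := smooth_onD oT (smooth_onM oT sc' (ss t Et j)) (ss' t Et j).
by congr smooth_on; apply/funext => p; rewrite linearP !mxE.
Qed.

Lemma section_zero (R : realType) (M : manifold R) (E : vbundle M) (U : set M) :
  smooth_section_on U (fun p => 0 : E p).
Proof. by apply: section_sub (@section0_smooth R M E) => p. Qed.

(** A sheaf of modules, presented as a predicate on set-theoretic sections of given fibres.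
    Restriction to smaller open sets and dependence on the values in [U] alone both follow from
    [regular_glue]. Vector bundles such as TM + k and ker l are built from their regular sections,
    without writing down an atlas. *)
Record sheaf (R : realType) (M : manifold R) (F : M -> lmodType R) := Sheaf {
  regular :> set M -> (forall p, F p) -> Prop;
  regular_glue : forall (U : set M) (s : forall p, F p), open U ->
    (forall p, U p -> exists (V : set M) (s' : forall p, F p),
      [/\ open V, V p, regular V s' & forall q, V q -> U q -> s q = s' q]) ->
    regular U s;
  regular_comb : forall (U : set M) (c : M -> R) (s s' : forall p, F p),
    open U -> smooth_on U c -> regular U s -> regular U s' ->
    regular U (fun p => c p *: s p + s' p);
  regular0 : forall U : set M, regular U (fun p => 0);
}.

Lemma regular_sub (R : realType) (M : manifold R) (F : M -> lmodType R)
    (S : sheaf F) (U V : set M) (s : forall p, F p) :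
  open U -> open V -> U `<=` V -> S V s -> S U s.
Proof.
by move=> oU oV UV Ss; apply: regular_glue => // p Up; exists V, s; split=> //; exact: UV.
Qed.

Lemma regular_ext (R : realType) (M : manifold R) (F : M -> lmodType R)
    (S : sheaf F) (U : set M) (s s' : forall p, F p) :
  open U -> (forall p, U p -> s p = s' p) -> S U s -> S U s'.
Proof.
by move=> oU ss Ss; apply: regular_glue => // p Up; exists U, s; split=> // q _ /ss.
Qed.

Lemma regular_sum (R : realType) (M : manifold R) (F : M -> lmodType R)
    (S : sheaf F) (U : set M) (m : nat) (c : 'I_m -> M -> R)
    (s : 'I_m -> forall p, F p) : open U ->
  (forall i, smooth_on U (c i)) -> (forall i, S U (s i)) ->
  S U (fun p => \sum_i c i p *: s i p).
Proof.
move=> oU; elim: m c s => [|m IH] c s sc ss.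
  by apply: regular_ext (regular0 S U) => // p _; rewrite big_ord0.
have H := IH _ _ (fun i => sc (lift ord0 i)) (fun i => ss (lift ord0 i)).
apply: regular_ext (regular_comb oU (sc ord0) (ss ord0) H) => // p _.
by rewrite big_ord_recl.
Qed.

(** A local frame [f] with dual coordinates [mu]. That [mu] sends regular sections to smooth
    functions makes the sheaf locally free; that it has no kernel makes the frame span. *)
Definition frame_near (R : realType) (M : manifold R) (F : M -> lmodType R)
    (S : sheaf F) (r : nat) (p0 : M) : Prop :=
  exists (V : set M) (f : 'I_r -> forall p, F p)
         (mu : forall p, {linear F p -> 'rV[R]_r}),
  [/\ open V /\ V p0, forall i, S V (f i),
      forall (U : set M) s, open U -> U `<=` V -> S U s ->
        forall j, smooth_on U (fun p => mu p (s p) 0 j),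
      forall p, V p -> forall i, mu p (f i p) = delta_mx 0 i &
      forall p, V p -> forall a, mu p a = 0 -> a = 0].

Definition adapted (R : realType) (M : manifold R) (F : M -> lmodType R)
    (S : sheaf F) (r : nat) : set (local_triv F r) :=
  [set t | forall (U : set M) s, open U -> U `<=` triv_dom t ->
    S U s <-> forall j, smooth_on U (fun p => t p (s p) 0 j)].

Lemma frame_expand (R : realType) (F : lmodType R) (r : nat) (f : 'I_r -> F)
    (mu : {linear F -> 'rV[R]_r}) :
  (forall i, mu (f i) = delta_mx 0 i) -> (forall a, mu a = 0 -> a = 0) ->
  forall a, a = \sum_i mu a 0 i *: f i.
Proof.
move=> muf mu0 a; apply/eqP; rewrite -subr_eq0; apply/eqP/mu0.
rewrite linearB linear_sum /= {1}[mu a]row_sum_delta; apply/eqP.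
by rewrite subr_eq0; apply/eqP/eq_bigr => i _; rewrite linearZ /= muf.
Qed.

Lemma adapted_cover (R : realType) (M : manifold R) (F : M -> lmodType R)
    (S : sheaf F) (r : nat) : (forall p0, frame_near S r p0) ->
  forall p : M, exists2 t : local_triv F r, adapted S t & triv_dom t p.
Proof.
move=> H p0; have [V [f [mu [[oV Vp0] Sf Smu muf mu0]]]] := H p0.
have bij p : V p -> bijective (mu p).
  move=> Vp; exists (fun v : 'rV[R]_r => \sum_i v 0 i *: f i p) => [a|v].
    by rewrite -(frame_expand (muf _ Vp) (mu0 _ Vp)).
  rewrite linear_sum /= [RHS]row_sum_delta; apply: eq_bigr => i _.
  by rewrite linearZ /= muf.
exists (LocalTriv oV bij) => //= U s oU UV; split=> [Ss j|smu].
  exact: Smu.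
have := regular_sum oU smu (fun i => regular_sub oU oV UV (Sf i)).
apply: regular_ext => // p /UV Vp.
by rewrite -(frame_expand (muf _ Vp) (mu0 _ Vp)).
Qed.

Definition triv_inv (R : realType) (M : manifold R) (F : M -> lmodType R)
    (r : nat) (t : local_triv F r) (v : 'rV[R]_r) (p : M) : F p :=
  xget 0 [set a | t p a = v].

Lemma triv_invK (R : realType) (M : manifold R) (F : M -> lmodType R)
    (r : nat) (t : local_triv F r) (v : 'rV[R]_r) (p : M) :
  triv_dom t p -> t p (triv_inv t v p) = v.
Proof.
move=> tp; have [g gK Kg] := triv_bij tp; rewrite /triv_inv.
by case: xgetP => [a _ //|/(_ (g v))]; rewrite /= Kg.
Qed.

Lemma triv_inj (R : realType) (M : manifold R) (F : M -> lmodType R)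
    (r : nat) (t : local_triv F r) (p : M) (a b : F p) :
  triv_dom t p -> t p a = t p b -> a = b.
Proof. by move=> tp; exact: (bij_inj (triv_bij tp)). Qed.

Lemma triv_expand (R : realType) (M : manifold R) (F : M -> lmodType R)
    (r : nat) (t : local_triv F r) (p : M) (a : F p) : triv_dom t p ->
  a = \sum_i t p a 0 i *: triv_inv t (delta_mx 0 i) p.
Proof.
move=> tp; apply: (triv_inj tp); rewrite linear_sum {1}[t p a]row_sum_delta.
by apply: eq_bigr => i _; rewrite linearZ /= triv_invK.
Qed.

(** The rows of the transition matrix are the coordinates under [u] of the frame of [t]; that frame
    is regular because its coordinates under [t] are constant. *)
Lemma adapted_compat (R : realType) (M : manifold R) (F : M -> lmodType R)
    (S : sheaf F) (r : nat) (t u : local_triv F r) :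
  adapted S t -> adapted S u ->
  exists2 G : M -> 'M[R]_r,
    (forall p a, triv_dom t p -> triv_dom u p -> u p a = t p a *m G p) &
    (forall i j, smooth_on (triv_dom t `&` triv_dom u) (fun p => G p i j)).
Proof.
move=> St Su.
exists (fun p => \matrix_(i < r) u p (triv_inv t (delta_mx 0 i) p)).
  move=> p a tp up; rewrite {1}(triv_expand a tp) linear_sum.
  rewrite mulmx_sum_row; apply: eq_bigr => i _.
  by rewrite linearZ /= rowK.
have oI : open (triv_dom t `&` triv_dom u) by apply: openI; exact: triv_open.
move=> i j.
have Se : S (triv_dom t `&` triv_dom u) (triv_inv t (delta_mx 0 i)).
  apply/(St _ _ oI (@subIsetl _ _ _)) => k.
  apply: smooth_on_ext (smooth_on_cst _ ((delta_mx 0 i : 'rV[R]_r) 0 k)) => // p [tp _].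
  by rewrite /= triv_invK.
have /Su := Se; move=> /(_ oI (@subIsetr _ _ _))/(_ j).
by apply: smooth_on_ext => // p _; rewrite mxE.
Qed.

Definition sheaf_bundle (R : realType) (M : manifold R) (F : M -> lmodType R)
    (S : sheaf F) (r : nat) (H : forall p0, frame_near S r p0) : vbundle M :=
  VBundle (adapted_cover H) (@adapted_compat R M F S r).

Lemma sheaf_bundleP (R : realType) (M : manifold R) (F : M -> lmodType R)
    (S : sheaf F) (r : nat) (H : forall p0, frame_near S r p0) (U : set M)
    (s : forall p, F p) : open U ->
  smooth_section_on (E := sheaf_bundle H) U s <-> S U s.
Proof.
move=> oU; split=> [ss|Ss t St j].
  apply: regular_glue => // p Up; have [t St tp] := adapted_cover H p.
  have oI : open (triv_dom t `&` U) by apply: openI => //; exact: triv_open.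
  exists (triv_dom t `&` U), s; split=> //.
  by apply/(St _ _ oI (@subIsetl _ _ _)) => j; exact: (ss t St j).
have oI : open (triv_dom t `&` U) by apply: openI => //; exact: triv_open.
by move: j; apply/(St _ _ oI (@subIsetl _ _ _)); apply: regular_sub Ss => // q [].
Qed.

Definition bundle_sheaf (R : realType) (M : manifold R) (E : vbundle M) :
    sheaf (fibre E) :=
  Sheaf (@section_glue R M E) (@section_comb R M E) (@section_zero R M E).

Lemma triv_inv_smooth (R : realType) (M : manifold R) (E : vbundle M)
    (t : local_triv E (vb_rank E)) (v : 'rV[R]_(vb_rank E)) :
  trivs t -> smooth_section_on (triv_dom t) (triv_inv t v).
Proof.
move=> Et u Eu j; have [G uG sG] := trivs_compat Et Eu.
have oI : open (triv_dom t `&` triv_dom u) by apply: openI; exact: triv_open.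
rewrite setIC.
have : smooth_on (triv_dom t `&` triv_dom u) (fun p => \sum_i v 0 i * G p i j).
  apply: smooth_on_sum => // i _; apply: smooth_onM => //.
  exact: (smooth_on_cst _ (v 0 i)).
apply: smooth_on_ext => // p [tp up].
by rewrite uG // triv_invK // mxE.
Qed.

Lemma section_cutoff (R : realType) (M : manifold R) (E : vbundle M)
    (V S : set M) (chi : smooth M) (s : forall p, E p) :
  open V -> closed S -> S `<=` V -> (forall q, ~ S q -> chi q = 0) ->
  smooth_section_on V s -> smooth_section_on setT (fun q => chi q *: s q).
Proof.
move=> oV cS SV chi0 ss; apply: section_glue; first exact: openT.
move=> q _; have [Vq|nVq] := pselect (V q).
  exists V, (fun q => chi q *: s q + 0); split=> // [|q' _ _]; last by rewrite addr0.
  by apply: section_comb => //; [exact: smooth_onT|exact: section_zero].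
exists (~` S), (fun p => 0); split=> //.
- exact: closed_openC.
- by move=> /SV.
- exact: section_zero.
- by move=> q' Sq' _; rewrite chi0 // scale0r.
Qed.

(** Brackets take global sections as arguments, so near [p] a local section is replaced by a global
    one with the same values. *)
Lemma section_extend (R : realType) (M : manifold R) (E : vbundle M)
    (V : set M) (s : forall p, E p) (p : M) :
  open V -> V p -> smooth_section_on V s ->
  exists (s' : section E) (chi : smooth M) (W : set M),
  [/\ open W /\ W p, W `<=` V, forall q, W q -> chi q = 1 /\ s' q = s q,
      exists2 S : set M, closed S /\ S `<=` V & forall q, ~ S q -> chi q = 0 &
      forall q, s' q = chi q *: s q].
Proof.
move=> oV Vp ss.
have [chi [W [S [[oW Wp] chi1 [cS SV] chi0]]]] := manifold_bump oV Vp.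
exists (MkSection (section_cutoff oV cS SV chi0 ss)), chi, (W `&` V); split=> //.
- by split=> //; exact: openI.
- by move=> q [Wq _] /=; rewrite chi1 // scale1r.
- by exists S.
Qed.

Lemma section_through (R : realType) (M : manifold R) (E : vbundle M) (p : M)
    (a : E p) : exists s : section E, s p = a.
Proof.
have [t Et tp] := @trivs_cover _ _ E p.
have [s [chi [W [[_ Wp] _ sE _ _]]]] :=
  section_extend (@triv_open _ _ _ _ t) tp (triv_inv_smooth (t p a) Et).
exists s; rewrite (sE _ Wp).2; apply: (triv_inj tp).
by rewrite triv_invK.
Qed.

Lemma section_addE (R : realType) (M : manifold R) (E : vbundle M)
    (s t : section E) (p : M) : (s + t) p = s p + t p.
Proof. by []. Qed.

Lemma section_scaleE (R : realType) (M : manifold R) (E : vbundle M)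
    (f : smooth M) (s : section E) (p : M) : (f *: s) p = f p *: s p.
Proof. by []. Qed.

Lemma section_realE (R : realType) (M : manifold R) (E : vbundle M)
    (c : R) (s : section E) (p : M) :
  ((c *: (1 : smooth M)) *: s) p = c *: s p.
Proof. by change ((c * 1) *: s p = c *: s p); rewrite mulr1. Qed.

Lemma section_oppE (R : realType) (M : manifold R) (E : vbundle M)
    (s : section E) (p : M) : (- s) p = - s p.
Proof. by change ((-1) *: s p = - s p); rewrite scaleN1r. Qed.

Lemma section_zeroE (R : realType) (M : manifold R) (E : vbundle M) (p : M) :
  (0 : section E) p = 0.
Proof. by []. Qed.

(** If u vanishes at [p], a bump [chi] and a local frame give chi^2 u as a sum of c_i e_i with
    global sections e_i and global functions c_i vanishing at [p]; and [Phi] does not distinguish u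
    from chi^2 u, because chi = 1 at [p]. *)
Lemma tensorial (R : realType) (M : manifold R) (E : vbundle M) (W : lmodType R)
    (p : M) (Phi : section E -> W) :
  (forall s t, Phi (s + t) = Phi s + Phi t) ->
  (forall f s, Phi (f *: s) = f p *: Phi s) ->
  forall s t : section E, s p = t p -> Phi s = Phi t.
Proof.
move=> PhiD PhiZ s t st; apply/eqP; rewrite -subr_eq0.
have PhiN u : Phi (- u) = - Phi u.
  rewrite -[- u]scaleN1r PhiZ.
  have [_ _ -> _ ->] := smoothE (1 : smooth M) 0 0 p; exact: scaleN1r.
rewrite -PhiN -PhiD; set u := s - t.
have u0 : u p = 0.
  by rewrite section_addE section_oppE st subrr.
have [tr Et tp] := @trivs_cover _ _ E p.
have [chi [W' [S [[_ W'p] chi1 [cS SV] chi0]]]] := manifold_bump (@triv_open _ _ _ _ tr) tp.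
have sc i : smooth_on setT (fun q => chi q * tr q (u q) 0 i).
  apply: (smooth_cutoff (@triv_open _ _ _ _ tr) cS SV chi0).
  by have := section_smooth u Et i; rewrite setIT.
pose c i := Smooth (asboolT (sc i)).
pose e i := MkSection (section_cutoff (@triv_open _ _ _ _ tr) cS SV chi0
  (triv_inv_smooth (delta_mx 0 i) Et)).
have Phi0 : Phi 0 = 0.
  rewrite -[0](scale0r (0 : section E)) PhiZ.
  change ((0 : R) *: Phi 0 = 0); exact: scale0r.
have PhiS (r : seq 'I_(vb_rank E)) (g : 'I_(vb_rank E) -> section E) :
    Phi (\sum_(i <- r) g i) = \sum_(i <- r) Phi (g i).
  by elim/big_rec2: _ => // i y1 y2 _ <-.
have -> : Phi u = Phi ((chi * chi) *: u).
  rewrite PhiZ; change (Phi u = (chi p * chi p) *: Phi u).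
  by rewrite chi1 // mulr1 scale1r.
have -> : (chi * chi) *: u = \sum_i c i *: e i.
  apply: section_ext => q.
  have -> : (\sum_i c i *: e i) q = \sum_i (c i q) *: e i q.
    by elim/big_rec2: _ => // i y1 y2 _ <-.
  change ((chi q * chi q) *: u q = \sum_i (chi q * tr q (u q) 0 i) *:
    (chi q *: triv_inv tr (delta_mx 0 i) q)).
  have [Sq|nSq] := pselect (S q); last first.
    by rewrite chi0 // mul0r scale0r big1 // => i _; rewrite mul0r scale0r.
  rewrite {1}(triv_expand (u q) (SV _ Sq)) scaler_sumr; apply: eq_bigr => i _.
  by rewrite !scalerA; congr (_ *: _); ring.
rewrite PhiS big1 // => i _; rewrite PhiZ.
change ((chi p * tr p (u p) 0 i) *: Phi (e i) = 0).
by rewrite u0 linear0 mxE mulr0 scale0r.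
Qed.

(** * Smooth families of matrices and dual coordinates *)

Lemma smooth_on_det (R : realType) (M : manifold R) (U : set M) (n : nat)
    (A : M -> 'M[R]_n) : open U ->
  (forall i j, smooth_on U (fun p => A p i j)) -> smooth_on U (fun p => \det (A p)).
Proof.
move=> oU sA; rewrite /determinant; apply: smooth_on_sum => // s _.
apply: smooth_onM => //; first exact: smooth_on_cst.
by apply: smooth_on_prod.
Qed.

Lemma smooth_on_mul (R : realType) (M : manifold R) (U : set M) (m n q : nat)
    (A : M -> 'M[R]_(m, n)) (B : M -> 'M[R]_(n, q)) : open U ->
  (forall i j, smooth_on U (fun p => A p i j)) ->
  (forall i j, smooth_on U (fun p => B p i j)) ->
  forall i j, smooth_on U (fun p => (A p *m B p) i j).
Proof.
move=> oU sA sB i j.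
have : smooth_on U (fun p => \sum_k A p i k * B p k j).
  by apply: smooth_on_sum => // k _; apply: smooth_onM.
by apply: smooth_on_ext => // p _; rewrite mxE.
Qed.

Lemma smooth_on_invmx (R : realType) (M : manifold R) (U : set M) (n : nat)
    (A : M -> 'M[R]_n) : open U ->
  (forall i j, smooth_on U (fun p => A p i j)) ->
  (forall p, U p -> \det (A p) != 0) ->
  forall i j, smooth_on U (fun p => invmx (A p) i j).
Proof.
move=> oU sA dA i j.
have : smooth_on U (fun p => (\det (A p))^-1 * ((-1) ^+ (j + i) *
    \det (row' j (col' i (A p))))).
  apply: smooth_onM => //; first by apply: smooth_onV => //; exact: smooth_on_det.
  apply: smooth_onM => //; first exact: smooth_on_cst.
  apply: smooth_on_det => // a b.
  by apply: smooth_on_ext (sA (lift j a) (lift i b)) => // p _; rewrite !mxE.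
apply: smooth_on_ext => // p Up.
by rewrite /invmx unitmxE unitfE dA // !mxE.
Qed.

(** In a trivialization the [e i] form a matrix N(p) of full row rank at [p0]. With C a right
    inverse of N(p0), the product D = N C is the identity at [p0], hence invertible nearby, and the
    matrix C D^-1 is a smooth right inverse of N. *)
Lemma dual_coordinates (R : realType) (M : manifold R) (E : vbundle M)
    (q : nat) (U : set M) (e : 'I_q -> forall p, E p) (p0 : M) :
  open U -> U p0 -> (forall i, smooth_section_on U (e i)) ->
  (forall c : 'rV[R]_q, \sum_i c 0 i *: e i p0 = 0 -> c = 0) ->
  exists (V : set M) (mu : forall p, {linear E p -> 'rV[R]_q}),
  [/\ open V /\ V p0, V `<=` U,
      forall (U' : set M) s, open U' -> U' `<=` V -> smooth_section_on U' s ->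
        forall j, smooth_on U' (fun p => mu p (s p) 0 j) &
      forall p, V p -> forall i, mu p (e i p) = delta_mx 0 i].
Proof.
move=> oU Up0 se indep; have [t Et tp0] := @trivs_cover _ _ E p0.
pose N p : 'M[R]_(q, vb_rank E) := \matrix_(i < q) t p (e i p).
have /row_freeP[C NC] : row_free (N p0).
  apply: inj_row_free => v vN; apply: indep; apply: (triv_inj tp0).
  rewrite linear_sum linear0 -[RHS]vN mulmx_sum_row; apply: eq_bigr => i _.
  by rewrite linearZ /= rowK.
pose D p := N p *m C; pose B p := C *m invmx (D p).
pose W := triv_dom t `&` U.
have oW : open W by apply: openI => //; exact: triv_open.
have sD i j : smooth_on W (fun p => D p i j).
  move: i j; apply: smooth_on_mul => // i j; last exact: smooth_on_cst.
  by apply: smooth_on_ext (se i t Et j) => // p _; rewrite mxE.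
have sdet : smooth_on W (fun p => \det (D p)) by exact: smooth_on_det.
pose V := W `&` [set p | \det (D p) != 0].
have oV : open V.
  rewrite openE => p [Wp dp]; apply: filterI; first exact: open_nbhs_nbhs.
  have cd := smooth_onT_continuous oW sdet Wp.
  by apply: (cd [set y | y != 0]); apply: open_nbhs_nbhs; split.
have sB i j : smooth_on V (fun p => B p i j).
  move: i j; apply: smooth_on_mul => // i j; first exact: smooth_on_cst.
  move: i j; apply: smooth_on_invmx => // [i j|p []//].
  by apply: smooth_on_sub (sD i j) => p [].
exists V, (fun p => mulmxr (B p) \o t p : {linear E p -> 'rV[R]_q}); split.
- by split=> //; split=> //=; rewrite /D NC det1 oner_neq0.
- by move=> p [[]].
- move=> U' s oU' U'V ss j.
  have : smooth_on U' (fun p => (t p (s p) *m B p) 0 j).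
    move: (0) j; apply: smooth_on_mul => // [i j|i j].
      rewrite ord1; apply: smooth_on_sub (ss t Et j) => p U'p; split=> //.
      by have [[]] := U'V _ U'p.
    exact: smooth_on_sub (sB i j).
  by [].
- move=> p [Wp dp] i /=.
  have -> : t p (e i p) = row i (N p) by rewrite rowK.
  rewrite -row_mul mulmxA -/(D p) mulmxV ?unitmxE ?unitfE //.
  exact: row1.
Qed.

(** * Linear subspaces as modules, and the sheaves of subspaces, products and vector fields *)

Definition submodule (R : realType) (W : lmodType R) (S : set W) : Prop :=
  S 0 /\ forall (a : R) x y, S x -> S y -> S (a *: x + y).

(** The proof [HS] is an argument so that closure under linear combinations can be recovered from
    the predicate when the module structure of [subsp] is declared. *)
Definition sub_pred (R : realType) (W : lmodType R) (S : set W)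
    (HS : submodule S) : {pred W} := fun x => `[< S x >].

Record subsp (R : realType) (W : lmodType R) (S : set W) (HS : submodule S) :=
  Subsp { subsp_val :> W; subsp_mem : subsp_val \in sub_pred HS }.

HB.instance Definition _ (R : realType) (W : lmodType R) (S : set W)
    (HS : submodule S) := [isSub for (@subsp_val R W S HS)].
HB.instance Definition _ (R : realType) (W : lmodType R) (S : set W)
    (HS : submodule S) := [Choice of subsp HS by <:].

Lemma sub_pred_submod (R : realType) (W : lmodType R) (S : set W)
    (HS : submodule S) : submod_closed (sub_pred HS).
Proof.
have [S0 SD] := HS; split; first exact/asboolP.
by move=> a x y /asboolP Sx /asboolP Sy; exact/asboolP/SD.
Qed.

HB.instance Definition _ (R : realType) (W : lmodType R) (S : set W)
    (HS : submodule S) :=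
  GRing.isSubmodClosed.Build R W (sub_pred HS) (sub_pred_submod HS).
HB.instance Definition _ (R : realType) (W : lmodType R) (S : set W)
    (HS : submodule S) := [SubChoice_isSubLmodule of subsp HS by <:].

Lemma subspP (R : realType) (W : lmodType R) (S : set W) (HS : submodule S)
    (x : subsp HS) : S (subsp_val x).
Proof. by have /asboolP := subsp_mem x. Qed.

Lemma subsp_eq (R : realType) (W : lmodType R) (S : set W) (HS : submodule S)
    (x y : subsp HS) : subsp_val x = subsp_val y -> x = y.
Proof. exact: val_inj. Qed.

Lemma subsp_linear (R : realType) (W : lmodType R) (S : set W)
    (HS : submodule S) (a : R) (x y : subsp HS) :
  subsp_val (a *: x + y) = a *: subsp_val x + subsp_val y.
Proof. by []. Qed.

Section SubSheaf.
Context (R : realType) (M : manifold R) (F : M -> lmodType R) (S : sheaf F).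
Context (K : forall p, set (F p)) (HK : forall p, submodule (K p)).

Let regK (U : set M) (s : forall p, subsp (HK p)) : Prop :=
  S U (fun p => subsp_val (s p)).

Lemma sub_sheaf_glue (U : set M) (s : forall p, subsp (HK p)) : open U ->
  (forall p, U p -> exists (V : set M) (s' : forall p, subsp (HK p)),
    [/\ open V, V p, regK V s' & forall q, V q -> U q -> s q = s' q]) -> regK U s.
Proof.
move=> oU H; apply: regular_glue => // p /H[V [s' [oV Vp ss' E]]].
by exists V, (fun p => subsp_val (s' p)); split=> // q Vq Uq; rewrite E.
Qed.

Lemma sub_sheaf_comb (U : set M) (c : M -> R) (s s' : forall p, subsp (HK p)) :
  open U -> smooth_on U c -> regK U s -> regK U s' ->
  regK U (fun p => c p *: s p + s' p).
Proof. exact: regular_comb. Qed.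

Lemma sub_sheaf0 (U : set M) : regK U (fun p => 0).
Proof. exact: regular0. Qed.

Definition sub_sheaf : sheaf (fun p => subsp (HK p) : lmodType R) :=
  Sheaf sub_sheaf_glue sub_sheaf_comb sub_sheaf0.
End SubSheaf.

Section ProdSheaf.
Context (R : realType) (M : manifold R) (F G : M -> lmodType R).
Context (S : sheaf F) (T : sheaf G).

Let reg (U : set M) (s : forall p, F p * G p) : Prop :=
  S U (fun p => (s p).1) /\ T U (fun p => (s p).2).

Lemma prod_sheaf_glue (U : set M) (s : forall p, F p * G p) : open U ->
  (forall p, U p -> exists (V : set M) (s' : forall p, F p * G p),
    [/\ open V, V p, reg V s' & forall q, V q -> U q -> s q = s' q]) -> reg U s.
Proof.
move=> oU H; split; apply: regular_glue => // p /H[V [s' [oV Vp [s1 s2] E]]].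
  by exists V, (fun p => (s' p).1); split=> // q Vq Uq; rewrite E.
by exists V, (fun p => (s' p).2); split=> // q Vq Uq; rewrite E.
Qed.

Lemma prod_sheaf_comb (U : set M) (c : M -> R) (s s' : forall p, F p * G p) :
  open U -> smooth_on U c -> reg U s -> reg U s' ->
  reg U (fun p => c p *: s p + s' p).
Proof. by move=> oU sc [s1 s2] [s1' s2']; split; exact: regular_comb. Qed.

Lemma prod_sheaf0 (U : set M) : reg U (fun p => 0).
Proof. by split; exact: regular0. Qed.

Definition prod_sheaf : sheaf (fun p => (F p * G p)%type : lmodType R) :=
  Sheaf prod_sheaf_glue prod_sheaf_comb prod_sheaf0.
End ProdSheaf.

Section TangentSheaf.
Context (R : realType) (M : manifold R).

Lemma field_glue (U : set M) (X : forall p : M, tangent p) : open U ->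
  (forall p, U p -> exists (V : set M) (X' : forall p : M, tangent p),
    [/\ open V, V p, smooth_field_on V X' & forall q, V q -> U q -> X q = X' q]) ->
  smooth_field_on U X.
Proof.
move=> oU H f; apply: smooth_on_glue => // p /H[V [X' [oV Vp sX' E]]].
by exists V, (fun p => X' p f); split=> // q Vq Uq; rewrite E.
Qed.

Lemma field_comb (U : set M) (c : M -> R) (X X' : forall p : M, tangent p) :
  open U -> smooth_on U c -> smooth_field_on U X -> smooth_field_on U X' ->
  smooth_field_on U (fun p => c p *: X p + X' p).
Proof.
move=> oU sc sX sX' f; exact: (smooth_onD oU (smooth_onM oU sc (sX f)) (sX' f)).
Qed.

Lemma field_zero (U : set M) : smooth_field_on U (fun p => 0 : tangent p).
Proof. by move=> f; exact: (smooth_on_cst _ 0). Qed.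

Definition tangent_sheaf : sheaf (fun p : M => tangent p : lmodType R) :=
  Sheaf field_glue field_comb field_zero.
End TangentSheaf.

(** * Lie algebra cohomology and Lie algebra bundles *)

Definition pack_linear (R : realType) (U V : lmodType R) (f : U -> V)
    (fL : linear f) : {linear U -> V} :=
  HB.pack_for {linear U -> V} f (GRing.isLinear.Build R U V *:%R f fL).

Lemma vect_coordinates (R : realType) (V : vectType R) :
  exists (q : nat) (v : {linear V -> 'rV[R]_q}) (w : {linear 'rV[R]_q -> V}),
    cancel v w /\ cancel w v.
Proof.
pose b := vbasis (fullv : {vspace V}).
pose v (x : V) : 'rV[R]_(\dim (fullv : {vspace V})) := \row_i coord b i x.
pose w (c : 'rV[R]_(\dim (fullv : {vspace V}))) : V := \sum_i c 0 i *: b`_i.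
have v_lin : linear v by move=> a x y; apply/rowP => i; rewrite !mxE linearP.
have w_lin : linear w.
  move=> a x y; rewrite /w scaler_sumr -big_split; apply: eq_bigr => i _.
  by rewrite !mxE scalerDl scalerA.
exists _, (pack_linear v_lin), (pack_linear w_lin); split=> [x|c] /=.
  rewrite /w [RHS](coord_vbasis (memvf x)); apply: eq_bigr => i _.
  by rewrite mxE.
apply/rowP => i; rewrite mxE /w coord_sum_free //.
exact/basis_free/vbasisP.
Qed.

(** A 0-cochain is an element u, and its differential is x -> [x, u]; thus H^0(g, g) is the centre
    of [g]. *)
Lemma lie_centerless (R : realType) (g : lie_algebra R) (u : g) :
  adjoint_cohomology_zero g 0 -> (forall x, lie x u = 0) -> u = 0.
Proof.
move=> H u0; apply: (H (fun _ => u) _ (fun _ => 0)); split.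
  by split=> [x []|x []].
move=> x; rewrite /ce_diff big_ord_recl big_ord0 addr0 u0 scaler0 add0r.
by rewrite big1 // => j _; rewrite big_ord0.
Qed.

(** The 1-cocycles with adjoint coefficients are the derivations of [g], and the 1-coboundaries are
    the inner ones. *)
Lemma lie_derivation_inner (R : realType) (g : lie_algebra R) (d : g -> g) :
  adjoint_cohomology_zero g 1 ->
  (forall (a : R) x y, d (a *: x + y) = a *: d x + d y) ->
  (forall x y, d (lie x y) = lie (d x) y + lie x (d y)) ->
  exists z, forall x, d x = lie z x.
Proof.
move=> H dL dM.
have [|z _ dz] := H (fun w : 'I_1 -> g => d (w ord0)).
  split.
    split=> [x i c u v|x i j]; last by rewrite !ord1 eqxx.
    by rewrite (ord1 i) /replace_arg eqxx dL.
  move=> x; rewrite /ce_diff !big_ord_recl !big_ord0 !addr0.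
  rewrite big_pred0 // big_mkcond big_ord_recl big_ord0 /= addr0 add0r.
  rewrite /bump /= expr0 expr1 scale1r !scaleN1r /replace_arg eqxx.
  have e1 : lift ord0 (ord0 : 'I_1) = lift ord0 ord0 :> 'I_2 by [].
  have -> : lift (lift ord0 ord0) (ord0 : 'I_1) = ord0 :> 'I_2 by exact: val_inj.
  set x0 := x ord0; set x1 := x (lift ord0 ord0).
  rewrite dM (lie_anti (d x0) x1) opprD opprK.
  by rewrite addrA subrK subrr.
(* The 0-cochain [z] is evaluated at the empty tuple. Its differential is x -> [x, z], while an
   inner derivation has its element on the left; hence the sign. *)
exists (- z (fun _ => 0)) => x.
rewrite lie_anti.
have lieN u v : lie u (- v) = - lie u v.
  have lie0 : lie u 0 = 0.
    have := lie_linear 1 u 0 0; rewrite !scale1r addr0 => /eqP.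
    by rewrite -subr_eq0 opprD addNKr oppr_eq0 => /eqP.
  by have := lie_linear (-1) u v 0; rewrite addr0 !scaleN1r lie0 addr0.
rewrite lieN opprK (dz (fun _ => x)) /ce_diff !big_ord_recl !big_ord0 !addr0.
rewrite expr0 scale1r; congr (lie _ (z _)).
by apply/funext => -[].
Qed.

(** * Bilinearity and Leibniz rules of an algebroid bracket *)

Section Algebroid.
Context (R : realType) (M : manifold R) (A : lie_algebroid M).
Implicit Types s t u : section A.

Lemma br_add s t u : br s (t + u) = br s t + br s u.
Proof.
by have := br_linear 1 s t u; rewrite !scale1r.
Qed.

Lemma br_addl s t u : br (s + t) u = br s u + br t u.
Proof. by rewrite br_anti br_add opprD -!br_anti. Qed.

Lemma br_oppr s t : br s (- t) = - br s t.
Proof.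
have br0 : br s 0 = 0 by apply: (addrI (br s 0)); rewrite -br_add !addr0.
by apply: (addrI (br s t)); rewrite -br_add !subrr.
Qed.

Lemma br_oppl s t : br (- s) t = - br s t.
Proof. by rewrite br_anti br_oppr opprK -br_anti. Qed.

Lemma br_real (c : R) s t :
  br s ((c *: (1 : smooth M)) *: t) = (c *: (1 : smooth M)) *: br s t.
Proof.
have := br_linear c s t 0; rewrite !addr0 => ->.
by have -> : br s 0 = 0 by [apply: (addrI (br s 0)); rewrite -br_add !addr0]; rewrite addr0.
Qed.

Lemma rhoE s p : rho s p = anchor A p (s p).
Proof. by []. Qed.

Lemma br_leibnizlE (f : smooth M) s t p :
  br (f *: s) t p = f p *: br s t p - rho t p f *: s p.
Proof.
rewrite br_anti br_leibniz section_oppE section_addE !section_scaleE opprD.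
by rewrite [in br t s](br_anti t s) section_oppE scalerN opprK.
Qed.

End Algebroid.

(** * The bundle of ideals: fibre bracket and Lie algebra charts *)

Section LieBundle.
Context (R : realType) (M : manifold R) (A : lie_algebroid M)
  (k : forall p : M, set (A p)) (g : lie_algebra R).
Arguments k : clear implicits.
Hypotheses (hk : bundle_of_ideals k) (hL : lie_algebra_bundle k g).
Context (q : nat) (crd : {linear g -> 'rV[R]_q}) (vec : {linear 'rV[R]_q -> g}).
Hypotheses (crdK : cancel crd vec) (vecK : cancel vec crd).

Local Notation fb := (fibre_bracket k).

Lemma ideal_submodule p : submodule (k p).
Proof.
have [U [h [oU Up _ /(_ p Up)[_ kh] _]]] := hL p; split.
  by apply/kh; exists 0 => //; rewrite linear0.
move=> a x y /kh[u _ <-] /kh[v _ <-]; apply/kh; exists (a *: u + v) => //.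
by rewrite linearP.
Qed.

Lemma ideal0 p : k p 0. Proof. by have [] := ideal_submodule p. Qed.

Lemma ideal_comb p (a : R) x y : k p x -> k p y -> k p (a *: x + y).
Proof. by have [_] := ideal_submodule p; exact. Qed.

Lemma idealD p x y : k p x -> k p y -> k p (x + y).
Proof. by move=> kx ky; rewrite -[x]scale1r; exact: ideal_comb. Qed.

Lemma idealZ p (a : R) x : k p x -> k p (a *: x).
Proof. by move=> kx; rewrite -[_ *: _]addr0; apply: ideal_comb => //; exact: ideal0. Qed.

Lemma idealN p x : k p x -> k p (- x).
Proof. by move=> kx; rewrite -scaleN1r; exact: idealZ. Qed.

Lemma ideal_anchor p a : k p a -> anchor A p a = 0.
Proof. by have [_ + _] := hk; exact. Qed.

Lemma ideal_br s t : section_in k t -> section_in k (br s t).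
Proof. by have [_ _] := hk; exact. Qed.

Lemma ideal_brl s t : section_in k s -> section_in k (br s t).
Proof.
by move=> ks p; rewrite br_anti section_oppE; apply/idealN/ideal_br.
Qed.

(** The bracket with a section of [k] is tensorial in the other argument: the derivative in its
    Leibniz rule is along the anchor of [s], which is 0. *)
Lemma act_tensor (s t t' : section A) p : section_in k s -> t p = t' p ->
  br t s p = br t' s p.
Proof.
move=> ks; apply: (@tensorial R M A (A p) p (fun t => br t s p)).
  by move=> u v; rewrite br_addl.
move=> f u; rewrite br_leibnizlE rhoE ideal_anchor //.
by rewrite -[X in - (X *: _)]/(0 : R) scale0r subr0.
Qed.

(** By [act_tensor] in one argument and, through antisymmetry, in the other, the value does not
    depend on the extensions picked by [xget]. *)
Lemma fbE (s t : section A) p : section_in k s -> section_in k t ->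
  fb (s p) (t p) = br s t p.
Proof.
move=> ks kt; rewrite /fibre_bracket.
case: xgetP => [c _ [s' [t' [ks' kt' ss tt ->]]]|/(_ (br s t p))].
  rewrite (act_tensor kt' ss) br_anti section_oppE (act_tensor ks tt).
  by rewrite -section_oppE -br_anti.
by case; exists s, t.
Qed.

(* A local Lie algebra trivialization h : g -> k with its coordinates mu, and
   a cut-off chi, equal to 1 on W, through which h extends to global sections. *)
Record lie_chart := LieChart {
  lc_V : set M; lc_W : set M; lc_chi : smooth M;
  lc_h : forall p, {linear g -> A p};
  lc_mu : forall p, {linear A p -> 'rV[R]_q};
  lc_s : g -> section A;
  lc_Vo : open lc_V; lc_Wo : open lc_W; lc_WV : lc_W `<=` lc_V;
  lc_chi1 : forall p, lc_W p -> lc_chi p = 1;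
  lc_supp : exists2 S : set M, closed S /\ S `<=` lc_V &
              forall p, ~ S p -> lc_chi p = 0;
  lc_hs : forall x, smooth_section_on lc_V (fun p => lc_h p x);
  lc_hk : forall p x, lc_V p -> k p (lc_h p x);
  lc_hmu : forall p a, lc_V p -> k p a -> lc_h p (vec (lc_mu p a)) = a;
  lc_muh : forall p x, lc_V p -> lc_mu p (lc_h p x) = crd x;
  lc_mus : forall (U : set M) s, open U -> U `<=` lc_V -> smooth_section_on U s ->
    forall j, smooth_on U (fun p => lc_mu p (s p) 0 j);
  lc_br : forall p x y, lc_V p -> lc_h p (lie x y) = fb (lc_h p x) (lc_h p y);
  lc_sE : forall x p, lc_s x p = lc_chi p *: lc_h p x;
  lc_sk : forall x, section_in k (lc_s x);
}.

Lemma lie_chart_exists p0 : exists c : lie_chart, lc_W c p0.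
Proof.
have [U [h [oU Up0 hs hin hbr]]] := hL p0.
have hvec p (c : 'rV[R]_q) : \sum_i c 0 i *: h p (vec (delta_mx 0 i)) = h p (vec c).
  rewrite {2}[c]row_sum_delta !linear_sum; apply: eq_bigr => i _.
  by rewrite !linearZ.
have hsU x : smooth_section_on U (fun p => h p x).
  by apply: section_sub (hs x).
have [||V [mu [[oV Vp0] VU mus mue]]] :=
    dual_coordinates (e := fun i p => h p (vec (delta_mx 0 i))) oU Up0.
- by move=> i; exact: hs.
- move=> c; rewrite hvec => hc; have [hinj _] := hin _ Up0.
  by rewrite -[c]vecK -[RHS]vecK; congr (crd _); apply: hinj; rewrite hc !linear0.
have muh p x : V p -> mu p (h p x) = crd x.
  move=> Vp; rewrite -{1}[x]crdK -hvec linear_sum [RHS]row_sum_delta.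
  by apply: eq_bigr => i _; rewrite linearZ /= mue.
have [chi [W [S [[oW Wp0] chi1 [cS SV] chi0]]]] := manifold_bump oV Vp0.
have hsV x : smooth_section_on V (fun p => h p x) by apply: section_sub (hsU x).
have hk' p x : V p -> k p (h p x).
  by move=> /VU/hin[_ kh]; apply/kh; exists x.
pose sx x := MkSection (section_cutoff oV cS SV chi0 (hsV x)).
have Wo : open (W `&` V) by exact: openI.
have WV : W `&` V `<=` V by move=> p [].
have chi1' p : (W `&` V) p -> chi p = 1 by move=> [/chi1].
have supp : exists2 S : set M, closed S /\ S `<=` V & forall p, ~ S p -> chi p = 0.
  by exists S.
have hmu p a : V p -> k p a -> h p (vec (mu p a)) = a.
  by move=> Vp /(hin _ (VU _ Vp)).2[x _ <-]; rewrite muh // crdK.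
have hbr' p x y : V p -> h p (lie x y) = fb (h p x) (h p y).
  by move=> /VU Up; exact: hbr.
have sxE x p : sx x p = chi p *: h p x by [].
have sxk x : section_in k (sx x).
  move=> p; rewrite sxE; have [Sp|nSp] := pselect (S p).
    by apply/idealZ/hk'/SV.
  by rewrite chi0 // scale0r; exact: ideal0.
by exists (LieChart oV Wo WV chi1' supp hsV hk' hmu muh mus hbr' sxE sxk).
Qed.

(** Here and in [fb_linear], [fb_anti] and [fb_jacobi], a chart at [p] turns the claim into one
    about [g]. The arguments must lie in [k p], where [lc_h] inverts the coordinates. *)
Lemma fb_in p a b : k p a -> k p b -> k p (fb a b).
Proof.
have [c /(@lc_WV c) Vp] := lie_chart_exists p => ka kb.
rewrite -(lc_hmu Vp ka) -(lc_hmu Vp kb) -lc_br //; exact: lc_hk.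
Qed.

Lemma fb_linear p (r : R) a b b' : k p a -> k p b -> k p b' ->
  fb a (r *: b + b') = r *: fb a b + fb a b'.
Proof.
have [c /(@lc_WV c) Vp] := lie_chart_exists p => ka kb kb'.
rewrite -(lc_hmu Vp ka) -(lc_hmu Vp kb) -(lc_hmu Vp kb') -linearP -!lc_br //.
by rewrite lie_linear linearP.
Qed.

Lemma fb_anti p a b : k p a -> k p b -> fb a b = - fb b a.
Proof.
have [c /(@lc_WV c) Vp] := lie_chart_exists p => ka kb.
by rewrite -(lc_hmu Vp ka) -(lc_hmu Vp kb) -!lc_br // lie_anti linearN.
Qed.

Lemma fb_jacobi p a b d : k p a -> k p b -> k p d ->
  fb a (fb b d) = fb (fb a b) d + fb b (fb a d).
Proof.
have [c /(@lc_WV c) Vp] := lie_chart_exists p => ka kb kd.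
rewrite -(lc_hmu Vp ka) -(lc_hmu Vp kb) -(lc_hmu Vp kd) -!lc_br //.
by rewrite lie_jacobi linearD.
Qed.

Lemma fbD p a b b' : k p a -> k p b -> k p b' -> fb a (b + b') = fb a b + fb a b'.
Proof. by move=> ka kb kb'; rewrite -{1}[b]scale1r fb_linear // scale1r. Qed.

Lemma fb0 p a : k p a -> fb a 0 = 0.
Proof.
move=> ka; have := fbD ka (ideal0 p) (ideal0 p); rewrite addr0 => /eqP.
by rewrite -subr_eq0 opprD addNKr oppr_eq0 => /eqP.
Qed.

Lemma fbZ p (r : R) a b : k p a -> k p b -> fb a (r *: b) = r *: fb a b.
Proof.
move=> ka kb; rewrite -[r *: b]addr0 fb_linear ?fb0 ?addr0 //; exact: ideal0.
Qed.

Lemma fb_linearl p (r : R) a a' b : k p a -> k p a' -> k p b ->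
  fb (r *: a + a') b = r *: fb a b + fb a' b.
Proof.
move=> ka ka' kb; rewrite fb_anti ?fb_linear //; last exact: ideal_comb.
by rewrite opprD -scalerN -!fb_anti.
Qed.

Lemma fbDl p a a' b : k p a -> k p a' -> k p b -> fb (a + a') b = fb a b + fb a' b.
Proof. by move=> ka ka' kb; rewrite -{1}[a]scale1r fb_linearl // scale1r. Qed.

Lemma fb0l p a : k p a -> fb 0 a = 0.
Proof. by move=> ka; rewrite fb_anti ?fb0 ?oppr0 //; exact: ideal0. Qed.

Lemma fbZl p (r : R) a b : k p a -> k p b -> fb (r *: a) b = r *: fb a b.
Proof.
move=> ka kb; rewrite -[r *: a]addr0 fb_linearl ?fb0l ?addr0 //; exact: ideal0.
Qed.

Lemma fbN p a b : k p a -> k p b -> fb a (- b) = - fb a b.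
Proof. by move=> ka kb; rewrite -scaleN1r fbZ // scaleN1r. Qed.

Lemma fbNl p a b : k p a -> k p b -> fb (- a) b = - fb a b.
Proof. by move=> ka kb; rewrite -scaleN1r fbZl // scaleN1r. Qed.

Lemma ideal_through p a : k p a -> exists2 s : section A, section_in k s & s p = a.
Proof.
move=> ka; have [c Wp] := lie_chart_exists p.
exists (lc_s c (vec (lc_mu c p a))); first exact: lc_sk.
by rewrite lc_sE lc_chi1 // scale1r lc_hmu //; exact: lc_WV.
Qed.

Lemma lc_section (c : lie_chart) (U : set M) (x : M -> 'rV[R]_q) :
  open U -> U `<=` lc_V c -> (forall j, smooth_on U (fun p => x p 0 j)) ->
  smooth_section_on U (fun p => lc_h c p (vec (x p))).
Proof.
move=> oU UV sx.
have H := @regular_sum R M _ (bundle_sheaf A) U q (fun j p => x p 0 j)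
  (fun j p => lc_h c p (vec (delta_mx 0 j))) oU sx.
apply: (@regular_ext R M _ (bundle_sheaf A) U _ _ oU _ (H _)) => [p Up|j].
  rewrite [in RHS](row_sum_delta (x p)) !linear_sum; apply: eq_bigr => j _.
  by rewrite !linearZ.
by apply: section_sub UV _; exact: lc_hs.
Qed.

Lemma lc_coord (c : lie_chart) (s : section A) (j : 'I_q) :
  smooth_on setT (fun p => lc_chi c p * lc_mu c p (s p) 0 j).
Proof.
have [S [cS SV] chi0] := lc_supp c.
apply: (smooth_cutoff (@lc_Vo c) cS SV chi0).
by apply: (lc_mus (@lc_Vo c)) => //; apply: section_sub (section_smooth s).
Qed.

(** The coordinates of [s] in the chart, cut off to global functions so that tangent vectors can
    differentiate them; on [lc_W] they are the true coordinates. *)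
Definition lc_D (c : lie_chart) (s : section A) (j : 'I_q) : smooth M :=
  Smooth (asboolT (lc_coord c s j)).

Lemma lc_DE (c : lie_chart) s j p : lc_W c p -> lc_D c s j p = lc_mu c p (s p) 0 j.
Proof. by move=> Wp /=; rewrite lc_chi1 // mul1r. Qed.

Definition struct_const (i j l : 'I_q) : R :=
  crd (lie (vec (delta_mx 0 i)) (vec (delta_mx 0 j))) 0 l.

Lemma lie_sumr (x : g) (m : nat) (a : 'I_m -> R) (y : 'I_m -> g) :
  lie x (\sum_i a i *: y i) = \sum_i a i *: lie x (y i).
Proof.
elim: m a y => [|m IH] a y.
  rewrite !big_ord0; have := lie_linear (-1) x 0 0.
  by rewrite !scaleN1r !oppr0 !addr0 addNr.
by rewrite !big_ord_recl lie_linear IH.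
Qed.

Lemma lie_suml (x : g) (m : nat) (a : 'I_m -> R) (y : 'I_m -> g) :
  lie (\sum_i a i *: y i) x = \sum_i a i *: lie (y i) x.
Proof.
rewrite lie_anti lie_sumr -sumrN; apply: eq_bigr => i _.
by rewrite -scalerN -lie_anti.
Qed.

Lemma vec_sum (x : 'rV[R]_q) : vec x = \sum_i x 0 i *: vec (delta_mx 0 i).
Proof.
rewrite {1}[x]row_sum_delta linear_sum; apply: eq_bigr => i _.
by rewrite linearZ.
Qed.

Lemma lie_coord (x y : 'rV[R]_q) (l : 'I_q) :
  crd (lie (vec x) (vec y)) 0 l =
  \sum_i \sum_j x 0 i * y 0 j * struct_const i j l.
Proof.
rewrite (vec_sum x) lie_suml linear_sum summxE; apply: eq_bigr => i _.
rewrite (vec_sum y) lie_sumr scaler_sumr linear_sum summxE; apply: eq_bigr => j _.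
by rewrite scalerA linearZ mxE.
Qed.

Lemma lc_mu_br (c : lie_chart) (s t : section A) p : lc_V c p ->
  section_in k s -> section_in k t ->
  lc_mu c p (br s t p) =
  crd (lie (vec (lc_mu c p (s p))) (vec (lc_mu c p (t p)))).
Proof.
move=> Vp ks kt; rewrite -fbE //.
by rewrite -[in LHS](lc_hmu Vp (ks p)) -[in LHS](lc_hmu Vp (kt p)) -lc_br // lc_muh.
Qed.


(** * Lie connections and derivations *)

(* A connection on k of weight psi: the Leibniz rule carries the factor psi, so
   that weighted connections form a sheaf of modules; weight 1 is a Lie
   connection. *)
Record weighted_connection (psi : M -> R)
    (N : forall p : M, tangent p -> section A -> A p) : Prop := WConn {
  wc_in : forall p v s, section_in k s -> k p (N p v s);
  wc_linear : forall p (a : R) (v w : tangent p) s,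
    N p (a *: v + w) s = a *: N p v s + N p w s;
  wc_add : forall p (v : tangent p) s t, N p v (s + t) = N p v s + N p v t;
  wc_leibniz : forall p (v : tangent p) (f : smooth M) s, section_in k s ->
    N p v (f *: s) = f p *: N p v s + (psi p * v f) *: s p;
  wc_der : forall p (v : tangent p) s t, section_in k s -> section_in k t ->
    N p v (br s t) = fb (N p v s) (t p) + fb (s p) (N p v t);
  wc_smooth : forall (U : set M) (X : forall p : M, tangent p) s, open U ->
    smooth_field_on U X -> smooth_section_on U (fun p => N p (X p) s);
}.

Lemma wc0 : weighted_connection (fun _ => 0) (fun p _ _ => 0).
Proof.
split=> [p v s ks|p a v w s|p v s t|p v f s _|p v s t ks kt|U X s oU sX].
- exact: ideal0.
- by rewrite scaler0 addr0.
- by rewrite addr0.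
- by rewrite mul0r scale0r scaler0 addr0.
- by rewrite (fb0 (ks p)) (fb0l (kt p)) addr0.
- exact: section_zero.
Qed.

Lemma wc_comb (c psi psi' : M -> R) N N' : smooth_on setT c ->
  weighted_connection psi N -> weighted_connection psi' N' ->
  weighted_connection (fun p => c p * psi p + psi' p)
    (fun p v s => c p *: N p v s + N' p v s).
Proof.
move=> sc [N1 N2 N3 N4 N5 N6] [N1' N2' N3' N4' N5' N6'].
split=> [p v s ks|p a v w s|p v s t|p v f s ks|p v s t ks kt|U X s oU sX].
- by apply: ideal_comb; [exact: N1|exact: N1'].
- rewrite N2 N2' !scalerDr !scalerA [c p * a]mulrC -!addrA; congr (_ + _).
  by rewrite addrCA.
- by rewrite N3 N3' scalerDr addrACA.
- rewrite N4 // N4' // mulrDl scalerDl !scalerDr !scalerA -mulrA.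
  by rewrite [c p * f p]mulrC addrACA.
- rewrite N5 // N5' // scalerDr addrACA.
  rewrite fb_linearl ?fb_linear //; by [exact: N1|exact: N1'|exact: ks|exact: kt].
- apply: section_comb => //; [|exact: N6|exact: N6'].
  exact: smooth_on_sub sc.
Qed.

(** The flat connection of a Lie algebra trivialization, which differentiates coordinates, is
    multiplied by a bump [psi]. The support of [psi] lies where the cut-off of the chart is 1, so
    that the cut-off coordinates are the true ones wherever the piece is nonzero. *)
Lemma wc_piece (p0 : M) : exists (W : set M) (psi : smooth M) N,
  [/\ open W, W p0, forall q, W q -> psi q = 1 & weighted_connection psi N].
Proof.
have [c Wp0] := lie_chart_exists p0.
have [psi [W [S [[oW Wp] psi1 [cS SW] psi0]]]] := manifold_bump (@lc_Wo c) Wp0.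
pose N (p : M) (v : tangent p) (s : section A) : A p :=
  psi p *: lc_h c p (vec (\row_j v (lc_D c s j))).
exists W, psi, N; split=> //.
have N0 p v s : ~ S p -> N p v s = 0 by move=> /psi0; rewrite /N => ->; rewrite scale0r.
have DZ f s j : lc_D c (f *: s) j = f * lc_D c s j.
  apply: smooth_eq => p; change (lc_chi c p * lc_mu c p (f p *: s p) 0 j =
    f p * (lc_chi c p * lc_mu c p (s p) 0 j)).
  by rewrite linearZ mxE mulrCA.
split=> [p v s ks|p a v w s|p v s t|p v f s ks|p v s t ks kt|U X s oU sX].
- have [/SW Wp'|nS] := pselect (S p); last by rewrite N0 //; exact: ideal0.
  by apply/idealZ/lc_hk; exact: lc_WV.
- rewrite /N; have -> : \row_j (a *: v + w) (lc_D c s j) =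
      a *: (\row_j v (lc_D c s j)) + \row_j w (lc_D c s j).
    by apply/rowP => j; rewrite !mxE.
  by rewrite [vec _]linearP [lc_h c p _]linearP scalerDr !scalerA [psi p * a]mulrC.
- rewrite /N; have -> : \row_j v (lc_D c (s + t) j) =
      \row_j v (lc_D c s j) + \row_j v (lc_D c t j).
    apply/rowP => j; rewrite !mxE -tangentD; congr (v _).
    apply: smooth_eq => r.
    change (lc_chi c r * lc_mu c r (s r + t r) 0 j = lc_chi c r * lc_mu c r (s r) 0 j +
      lc_chi c r * lc_mu c r (t r) 0 j).
    by rewrite linearD mxE mulrDr.
  by rewrite [vec _]linearD [lc_h c p _]linearD scalerDr.
- have [/SW Wp'|nS] := pselect (S p); last first.
    by rewrite !N0 // psi0 // mul0r scale0r scaler0 addr0.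
  rewrite /N; have -> : \row_j v (lc_D c (f *: s) j) =
      f p *: (\row_j v (lc_D c s j)) + v f *: lc_mu c p (s p).
    apply/rowP => j; rewrite !mxE DZ tangentM lc_DE //.
    by rewrite [v f * _]mulrC.
  rewrite [vec _]linearD [lc_h c p _]linearD scalerDr !linearZ /= (lc_hmu (lc_WV Wp') (ks p)) !scalerA.
  by rewrite [f p * _]mulrC [v f * _]mulrC.
- have [/SW Wp'|nS] := pselect (S p); last first.
    by rewrite !N0 // (fb0 (ks p)) (fb0l (kt p)) addr0.
  have Vp := lc_WV Wp'.
  rewrite /N fbZl ?fbZ //; try exact: lc_hk; try exact: ks; try exact: kt.
  rewrite -scalerDr; congr (_ *: _).
  rewrite -[in RHS](lc_hmu Vp (ks p)) -[in RHS](lc_hmu Vp (kt p)) -!lc_br //.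
  rewrite -linearD; congr (lc_h c p _).
  rewrite -[RHS]crdK; congr (vec _); apply/rowP => l.
  rewrite linearD !mxE !lie_coord -big_split /=.
  (* Near [p] the coordinates of the bracket are a bilinear expression in those of [s] and [t] with
     constant coefficients, so differentiating it produces only the two terms of the product
     rule. *)
  have -> : v (lc_D c (br s t) l) = v (\sum_i \sum_j
      struct_const i j l *: (lc_D c s i * lc_D c t j)).
    apply: (tangent_local v (@lc_Wo c) Wp') => r Wr.
    rewrite lc_DE // lc_mu_br ?lie_coord //; last exact: lc_WV.
    have sumE m (F : 'I_m -> smooth M) : (\sum_i F i) r = \sum_i F i r.
      by elim/big_rec2: _ => // i y1 y2 _ <-.
    rewrite sumE; apply: eq_bigr => i _; rewrite sumE; apply: eq_bigr => j _.
    change (lc_mu c r (s r) 0 i * lc_mu c r (t r) 0 j * struct_const i j l =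
      struct_const i j l * (lc_D c s i r * lc_D c t j r)).
    by rewrite !lc_DE // mulrC.
  rewrite tangent_sum; apply: eq_bigr => i _.
  rewrite tangent_sum -big_split /=; apply: eq_bigr => j _.
  by rewrite tangentZ tangentM !lc_DE // !mxE; ring.
- apply: section_glue => // p Up.
  have [Sp|nS] := pselect (S p).
    have oI : open (U `&` lc_V c) by apply: openI => //; exact: lc_Vo.
    exists (U `&` lc_V c), (fun p => psi p *: lc_h c p (vec (\row_j X p (lc_D c s j))) + 0).
    split=> //; [by split=> //; exact/lc_WV/SW| |by move=> q' _ _; rewrite addr0].
    apply: section_comb => //; [exact: smooth_onT| |exact: section_zero].
    apply: (lc_section oI (@subIsetr _ _ _)) => j.
    have : smooth_on (U `&` lc_V c) (fun p => X p (lc_D c s j)).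
      by apply: smooth_on_sub (sX _) => q' [].
    by apply: smooth_on_ext => // q' _; rewrite mxE.
  exists (~` S), (fun=> 0); split=> //.
  + exact: closed_openC.
  + exact: section_zero.
  + by move=> q' Sq' _; exact: N0.
Qed.

(** Second countability enters here: each point lies in a basic open set on which some piece has
    weight 1, and the injective code of the countable basis turns these basic sets into a
    sequence. *)
Lemma wc_sequence : exists (W : nat -> set M) (psi : nat -> smooth M)
    (N : nat -> forall p : M, tangent p -> section A -> A p),
  [/\ forall n, open (W n), forall n q, W n q -> psi n q = 1,
      forall n, weighted_connection (psi n) (N n) & forall p, exists n, W n p].
Proof.
have [B /countable_injP[code codeI] [Bo Bx]] := manifold_countable M.
pose good (b : set M) (z : smooth M * (forall p : M, tangent p -> section A -> A p)) :=
  (forall q, b q -> z.1 q = 1) /\ weighted_connection z.1 z.2.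
pose at_ n (y : set M * (smooth M * (forall p : M, tangent p -> section A -> A p))) :=
  [/\ B y.1, code y.1 = n & good y.1 y.2].
have wc0' : weighted_connection (0 : smooth M) (fun p _ _ => 0).
  by have := wc0; congr weighted_connection.
(* An index that is not the code of a suitable basic set is filled with the empty set and the zero
   connection of weight 0. *)
pose z n := if pselect (exists y, at_ n y) is left e then sval (cid e)
  else (set0, (0 : smooth M, fun p _ _ => 0)).
exists (fun n => (z n).1), (fun n => (z n).2.1), (fun n => (z n).2.2).
have zP n : [/\ open (z n).1, forall q, (z n).1 q -> (z n).2.1 q = 1 &
    weighted_connection (z n).2.1 (z n).2.2].
  rewrite /z; case: pselect => [e|_ /=]; last by split=> //; exact: open0.
  by case: (cid e) => y [/Bo By _ [y1 y2]] /=; split.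
split=> [n|n|n|p]; [by have []:= zP n|by have [] := zP n|by have [] := zP n|].
have [W [psi [N [oW Wp psi1 wN]]]] := wc_piece p.
have [b [Bb bp] bW] := Bx p W (open_nbhs_nbhs (conj oW Wp)).
exists (code b); rewrite /z; case: pselect => [e|ne].
  case: (cid e) => y [By cy _] /=; suff -> : y.1 = b by [].
  by apply: codeI => //; rewrite inE.
case: ne; exists (b, (psi, N)); split=> //; split=> //= q' /bW; exact: psi1.
Qed.

(** With w_n the weight of the n-th stage, 1 - w_(n+1) = (1 - w_n)(1 - psi_n), so on [W i] every
    stage after i has weight 1. From then on the coefficient 1 - w_n of each new piece is 0, and the
    sequence of connections is stationary on [W i]. *)
Lemma connection_exists : exists N, weighted_connection (fun _ => 1) N.
Proof.
have [W [psi [N [oW psi1 wN cov]]]] := wc_sequence.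
pose step n (z : smooth M * (forall p : M, tangent p -> section A -> A p)) :=
  (((1 : smooth M) - z.1) * psi n + z.1 : smooth M,
   fun (p : M) (v : tangent p) s => (1 - z.1 p) *: N n p v s + z.2 p v s).
pose S := fix S n := if n is m.+1 then step m (S m)
  else (0 : smooth M, fun (p : M) _ _ => 0 : A p).
have wS n : weighted_connection (S n).1 (S n).2.
  elim: n => [|n IH]; first by have := wc0; congr weighted_connection.
  have sc : smooth_on setT (fun p => 1 - (S n).1 p).
    exact: (smooth_onT ((1 : smooth M) - (S n).1)).
  by have := wc_comb sc (wN n) IH; congr weighted_connection.
have S1E n p : (S n.+1).1 p = (1 - (S n).1 p) * psi n p + (S n).1 p by [].
have S2E n p v s : (S n.+1).2 p v s = (1 - (S n).1 p) *: N n p v s + (S n).2 p v s by [].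
have S1 i m p : W i p -> (i < m)%N -> (S m).1 p = 1.
  move=> Wp; elim: m => // m IH; rewrite ltnS leq_eqVlt => /predU1P[<-|im].
    by rewrite S1E psi1 // mulr1 subrK.
  by rewrite S1E IH // subrr mul0r add0r.
have S2 i m p v s : W i p -> (i < m)%N -> (S m).2 p v s = (S i.+1).2 p v s.
  move=> Wp; elim: m => // m IH; rewrite ltnS leq_eqVlt => /predU1P[<- //|im].
  by rewrite S2E (S1 i) // subrr scale0r add0r IH.
(* All indices whose set contains p give the same stationary value, so the choice is harmless, and
   on [W (ix p)] the index may be frozen when smoothness is checked. *)
pose ix p := sval (cid (cov p)).
have Wix p : W (ix p) p by rewrite /ix; case: cid.
have E i p v s : W i p -> (S (ix p).+1).2 p v s = (S i.+1).2 p v s.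
  move=> Wp; case: (leqP i (ix p)) => h.
    by rewrite (S2 i).
  by rewrite (S2 (ix p) i.+1) // ltnS ltnW.
exists (fun p => (S (ix p).+1).2 p).
split=> [p v s ks|p a v w s|p v s t|p v f s ks|p v s t ks kt|U X s oU sX].
- exact: (wc_in (wS _)).
- exact: (wc_linear (wS _)).
- exact: (wc_add (wS _)).
- by rewrite (wc_leibniz (wS _)) // (S1 (ix p)).
- exact: (wc_der (wS _)).
- apply: section_glue => // p Up.
  have oI : open (U `&` W (ix p)) by exact: openI.
  exists (U `&` W (ix p)), (fun q' => (S (ix p).+1).2 q' (X q') s); split=> //.
    apply: (wc_smooth (wS _)) => // f; by apply: smooth_on_sub (sX f) => q' [].
  by move=> q' [_ Wq'] _; rewrite (E (ix p)).
Qed.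

Lemma lc_local (c : lie_chart) (U : set M) (z : forall p, A p) (p0 : M) :
  open U -> U p0 -> lc_V c p0 -> (forall p, U p -> lc_V c p -> k p (z p)) ->
  (forall j, smooth_on (U `&` lc_V c) (fun p => lc_mu c p (z p) 0 j)) ->
  exists (V : set M) (s' : forall p, A p),
    [/\ open V, V p0, smooth_section_on V s' & forall q, V q -> U q -> z q = s' q].
Proof.
move=> oU Up Vp kz sz.
have oI : open (U `&` lc_V c) by apply: openI => //; exact: lc_Vo.
exists (U `&` lc_V c), (fun p => lc_h c p (vec (lc_mu c p (z p)))); split=> //.
  exact: lc_section oI (@subIsetr _ _ _) sz.
by move=> r [Ur Vr] _; rewrite lc_hmu //; exact: kz.
Qed.

Lemma fb_smooth (U : set M) (z w : forall p, A p) : open U ->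
  (forall p, U p -> k p (z p)) -> (forall p, U p -> k p (w p)) ->
  smooth_section_on U z -> smooth_section_on U w ->
  smooth_section_on U (fun p => fb (z p) (w p)).
Proof.
move=> oU kz kw sz sw; apply: section_glue => // p Up.
have [c /(@lc_WV c) Vp] := lie_chart_exists p.
have oI : open (U `&` lc_V c) by apply: openI => //; exact: lc_Vo.
apply: (lc_local (c := c)) => // [r Ur _|l].
  by apply: fb_in; [exact: kz|exact: kw].
have zI : smooth_section_on (U `&` lc_V c) z by apply: section_sub sz => r [].
have wI : smooth_section_on (U `&` lc_V c) w by apply: section_sub sw => r [].
have : smooth_on (U `&` lc_V c) (fun p => \sum_i \sum_j
    lc_mu c p (z p) 0 i * lc_mu c p (w p) 0 j * struct_const i j l).
  apply: smooth_on_sum => // i _; apply: smooth_on_sum => // j _.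
  apply: (smooth_onM (f := fun p => lc_mu c p (z p) 0 i * lc_mu c p (w p) 0 j)
    (g := cst (struct_const i j l)) oI); last exact: smooth_on_cst.
  apply: (smooth_onM (f := fun p => lc_mu c p (z p) 0 i)
    (g := fun p => lc_mu c p (w p) 0 j) oI).
    exact: lc_mus oI (@subIsetr _ _ _) zI _.
  exact: lc_mus oI (@subIsetr _ _ _) wI _.
apply: smooth_on_ext => // r [Ur Vr]; rewrite -lie_coord.
rewrite -[in RHS](lc_hmu Vr (kz _ Ur)) -[in RHS](lc_hmu Vr (kw _ Ur)).
by rewrite -lc_br // lc_muh.
Qed.

Lemma lc_proj_smooth (c : lie_chart) (s : section A) : smooth_section_on setT
  (fun p => lc_chi c p *: lc_h c p (vec (lc_mu c p (s p)))).
Proof.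
have [S [cS SV] chi0] := lc_supp c.
apply: (section_cutoff (@lc_Vo c) cS SV chi0).
apply: (lc_section (@lc_Vo c)) => // j.
by apply: (lc_mus (@lc_Vo c)) => //; apply: section_sub (section_smooth s).
Qed.

(** [Phi] is controlled only on sections of [k]. It is precomposed with P, which reads the
    coordinates of any section of [A] in a chart, rebuilds a section of [k] from them and cuts it
    off; P is linear over the functions and multiplies sections of [k] by the cut-off. *)
Lemma tensorial_ideal (p : M) (W : lmodType R) (Phi : section A -> W) :
  (forall s t, section_in k s -> section_in k t -> Phi (s + t) = Phi s + Phi t) ->
  (forall f s, section_in k s -> Phi (f *: s) = f p *: Phi s) ->
  forall s t : section A, section_in k s -> section_in k t ->
  s p = t p -> Phi s = Phi t.
Proof.
move=> PhiD PhiZ s t ks kt st; have [c Wp] := lie_chart_exists p.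
pose P s := MkSection (lc_proj_smooth c s).
have [S [cS SV] chi0] := lc_supp c.
have kP u : section_in k (P u).
  move=> r /=; have [Sr|nS] := pselect (S r); last first.
    by rewrite chi0 // scale0r; exact: ideal0.
  by apply/idealZ/lc_hk/SV.
have PE u : section_in k u -> P u = lc_chi c *: u.
  move=> ku; apply: section_ext => r; rewrite section_scaleE /=.
  have [Sr|nS] := pselect (S r); last by rewrite chi0 // !scale0r.
  by rewrite lc_hmu //; exact: SV.
have PhiP u : section_in k u -> Phi u = Phi (P u).
  by move=> ku; rewrite PE // PhiZ // lc_chi1 // scale1r.
rewrite (PhiP s) // (PhiP t) //.
apply: (@tensorial R M A W p (fun s => Phi (P s))) => // [u v|f u].
  rewrite -PhiD //; congr Phi; apply: section_ext => r.
  by rewrite section_addE /= -scalerDr -!linearD.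
rewrite -PhiZ //; congr Phi; apply: section_ext => r.
by rewrite !section_scaleE /= !linearZ /= !scalerA mulrC.
Qed.

(** * Derivations of the bundle of ideals over a tangent vector *)

Record derivation_over (p : M) (X : tangent p) (D : section A -> A p) : Prop :=
  DerivationOver {
  do_in : forall s, section_in k s -> k p (D s);
  do_add : forall s t, section_in k s -> section_in k t -> D (s + t) = D s + D t;
  do_leibniz : forall (f : smooth M) s, section_in k s ->
    D (f *: s) = f p *: D s + X f *: s p;
  do_der : forall s t, section_in k s -> section_in k t ->
    D (br s t) = fb (D s) (t p) + fb (s p) (D t);
}.

Hypotheses (H0 : adjoint_cohomology_zero g 0) (H1 : adjoint_cohomology_zero g 1).

(** In a chart z - z' becomes a central element of [g], and the centre is 0. *)
Lemma ad_injective p z z' : k p z -> k p z' ->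
  (forall s, section_in k s -> fb z (s p) = fb z' (s p)) -> z = z'.
Proof.
have [c Wp] := lie_chart_exists p; have Vp := lc_WV Wp.
move=> kz kz' zz'; apply/eqP; rewrite -subr_eq0.
have kd : k p (z - z') by apply: idealD => //; exact: idealN.
rewrite -(lc_hmu Vp kd).
suff -> : vec (lc_mu c p (z - z')) = 0 by rewrite linear0.
apply: lie_centerless => // x; rewrite lie_anti.
suff -> : lie (vec (lc_mu c p (z - z'))) x = 0 by rewrite oppr0.
have hinj u : lc_h c p u = 0 -> u = 0.
  by move=> hu; rewrite -[u]crdK -(lc_muh u Vp) hu !linear0.
apply: hinj; rewrite lc_br // lc_hmu //.
have := zz' _ (lc_sk c x); rewrite lc_sE lc_chi1 // scale1r => E.
rewrite fbDl //; [|exact: idealN|exact: lc_hk].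
by rewrite -scaleN1r fbZl // ?scaleN1r ?E ?subrr //; exact: lc_hk.
Qed.

Context (nab : forall p : M, tangent p -> section A -> A p).
Hypothesis nabP : weighted_connection (fun _ => 1) nab.
Arguments nab : clear implicits.

Lemma nab_leibniz p (v : tangent p) (f : smooth M) s : section_in k s ->
  nab p v (f *: s) = f p *: nab p v s + v f *: s p.
Proof. by move=> ks; rewrite (wc_leibniz nabP) // mul1r. Qed.

Definition Theta (p : M) (X : tangent p) (z : A p) (s : section A) : A p :=
  nab p X s + fb z (s p).

Lemma Theta_derivation p (X : tangent p) z : k p z -> derivation_over X (Theta X z).
Proof.
move=> kz; split=> [s ks|s t ks kt|f s ks|s t ks kt]; rewrite /Theta.
- by apply: idealD; [exact: (wc_in nabP)|apply: fb_in => //; exact: ks].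
- by rewrite (wc_add nabP) section_addE fbD // addrACA.
- rewrite nab_leibniz // section_scaleE fbZ //.
  by rewrite scalerDr addrAC.
- have kN1 := wc_in nabP X ks; have kN2 := wc_in nabP X kt.
  have kz1 := fb_in kz (ks p); have kz2 := fb_in kz (kt p).
  rewrite (wc_der nabP) // -fbE // (fb_jacobi kz (ks p) (kt p)).
  by rewrite (fbDl kN1 kz1 (kt p)) (fbD (ks p) kN2 kz2) addrACA.
Qed.

(** In the difference delta of [D] and [nab] the terms in X f cancel, so delta depends only on the
    value at [p] and induces a derivation d of [g] through a chart. Being inner, d supplies z. *)
Lemma derivation_Theta p (X : tangent p) D : derivation_over X D ->
  exists z, k p z /\ forall s, section_in k s -> D s = Theta X z s.
Proof.
move=> [D1 D2 D3 D4]; have [c Wp] := lie_chart_exists p; have Vp := lc_WV Wp.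
pose delta s := D s - nab p X s.
have delta_in s : section_in k s -> k p (delta s).
  by move=> ks; apply: idealD; [exact: D1|apply/idealN/(wc_in nabP)].
have delta_add s t : section_in k s -> section_in k t ->
    delta (s + t) = delta s + delta t.
  by move=> ks kt; rewrite /delta D2 // (wc_add nabP) opprD addrACA.
have delta_lin f s : section_in k s -> delta (f *: s) = f p *: delta s.
  move=> ks; rewrite /delta D3 // nab_leibniz // opprD addrACA subrr addr0.
  by rewrite scalerBr.
have delta_eq := @tensorial_ideal p (A p) delta delta_add delta_lin.
pose d x := vec (lc_mu c p (delta (lc_s c x))).
have sxE x : lc_s c x p = lc_h c p x by rewrite lc_sE lc_chi1 // scale1r.
have sxk := lc_sk c.
have hd x : lc_h c p (d x) = delta (lc_s c x) by rewrite lc_hmu //; exact: delta_in.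
have hinj : injective (lc_h c p).
  by move=> u v huv; rewrite -[u]crdK -[v]crdK -(lc_muh u Vp) -(lc_muh v Vp) huv.
have d_lin (a : R) x y : d (a *: x + y) = a *: d x + d y.
  apply: hinj; rewrite linearP !hd.
  have -> : lc_s c (a *: x + y) = (a *: (1 : smooth M)) *: lc_s c x + lc_s c y.
    apply: section_ext => r; rewrite section_addE section_realE !lc_sE linearP.
    by rewrite scalerDr !scalerA mulrC.
  rewrite delta_add //.
    rewrite delta_lin //; congr (_ + _); congr (_ *: _).
    by change (a * 1 = a); rewrite mulr1.
  by move=> r; rewrite section_realE; apply/idealZ/sxk.
have d_der x y : d (lie x y) = lie (d x) y + lie x (d y).
  apply: hinj; rewrite linearD !lc_br // !hd.
  have -> : delta (lc_s c (lie x y)) = delta (br (lc_s c x) (lc_s c y)).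
    apply: delta_eq => //; first exact: ideal_br.
    by rewrite -fbE // !sxE lc_br.
  rewrite /delta D4 // (wc_der nabP) // -!sxE.
  have kD1 := D1 _ (sxk x); have kD2 := D1 _ (sxk y).
  have kN1 := wc_in nabP X (sxk x); have kN2 := wc_in nabP X (sxk y).
  rewrite fbDl //; [|exact: idealN|exact: sxk].
  rewrite fbD //; [|exact: sxk|exact: idealN].
  rewrite fbNl //; last exact: sxk.
  rewrite fbN //; last exact: sxk.
  by rewrite opprD addrACA.
have [z0 dz0] := lie_derivation_inner H1 d_lin d_der.
exists (lc_h c p z0); split; first exact: lc_hk.
move=> s ks; apply/eqP; rewrite /Theta addrC -subr_eq -/(delta s); apply/eqP.
have -> : delta s = delta (lc_s c (vec (lc_mu c p (s p)))).
  by apply: delta_eq => //; rewrite sxE lc_hmu.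
by rewrite -hd dz0 lc_br // lc_hmu.
Qed.

Lemma Theta_injective p (X : tangent p) z z' : k p z -> k p z' ->
  (forall s, section_in k s -> Theta X z s = Theta X z' s) -> z = z'.
Proof.
move=> kz kz' H; apply: ad_injective => // s ks.
by have /addrI := H s ks.
Qed.

Lemma Theta_smooth (U : set M) (X : forall p : M, tangent p) (z : forall p, A p) s :
  open U -> smooth_field_on U X -> smooth_section_on U z ->
  (forall p, U p -> k p (z p)) -> section_in k s ->
  smooth_section_on U (fun p => Theta (X p) (z p) s).
Proof.
move=> oU sX sz kz ks.
have sN := wc_smooth nabP s oU sX.
have sF : smooth_section_on U (fun p => fb (z p) (s p)).
  by apply: fb_smooth => //; apply: section_sub (section_smooth s).
have := section_comb oU (smooth_on_cst U 1) sN sF.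
by apply: (@regular_ext R M _ (bundle_sheaf A) U _ _ oU) => p _; rewrite scale1r.
Qed.

(** In a chart, the coordinates of z are multiplied by the constant matrix [Ad] of ad : g -> End(g)
    to give the matrix of D - nab, which is smooth. A constant right inverse of [Ad] recovers the
    coordinates of z smoothly. *)
Lemma Theta_smooth_inv (U : set M) (X : forall p : M, tangent p)
    (z : forall p, A p) (D : forall p, section A -> A p) : open U ->
  smooth_field_on U X -> (forall p, U p -> k p (z p)) ->
  (forall p s, U p -> section_in k s -> D p s = Theta (X p) (z p) s) ->
  (forall s, section_in k s -> smooth_section_on U (fun p => D p s)) ->
  smooth_section_on U z.
Proof.
move=> oU sX kz DE sD; apply: section_glue => // p0 Up0.
have [c Wp0] := lie_chart_exists p0.
pose B i : 'M[R]_q := \matrix_(j, l) struct_const i j l.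
pose Ad : 'M[R]_(q, q * q) := \matrix_(i < q) mxvec (B i).
have AdE (x : 'rV[R]_q) : x *m Ad =
    mxvec (\matrix_(j, l) crd (lie (vec x) (vec (delta_mx 0 j))) 0 l).
  have -> : \matrix_(j, l) crd (lie (vec x) (vec (delta_mx 0 j))) 0 l =
      \sum_i x 0 i *: B i.
    apply/matrixP => j l; rewrite mxE (vec_sum x) lie_suml linear_sum !summxE.
    by apply: eq_bigr => i _; rewrite linearZ !mxE.
  rewrite linear_sum mulmx_sum_row; apply: eq_bigr => i _.
  by rewrite linearZ rowK.
(* A row vector in the kernel of [Ad] represents a central element of [g]. *)
have /row_freeP[L AdL] : row_free Ad.
  apply: inj_row_free => x; rewrite AdE => /(congr1 vec_mx); rewrite mxvecK linear0.
  move=> xE; have lx0 j : lie (vec x) (vec (delta_mx 0 j)) = 0.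
    rewrite -[lie _ _]crdK; suff -> : crd (lie (vec x) (vec (delta_mx 0 j))) = 0.
      by rewrite linear0.
    by apply/rowP => l; have /matrixP/(_ j l) := xE; rewrite !mxE.
  rewrite -[x]vecK; suff -> : vec x = 0 by rewrite linear0.
  apply: lie_centerless => // y; rewrite lie_anti -[y]crdK (vec_sum (crd y)) lie_sumr.
  by rewrite big1 ?oppr0 // => j _; rewrite lx0 scaler0.
have oI : open (U `&` lc_W c) by apply: openI => //; exact: lc_Wo.
pose e j := lc_s c (vec (delta_mx 0 j)).
have ek j : section_in k (e j) by exact: lc_sk.
pose d j p := D p (e j) - nab p (X p) (e j).
have sd j : smooth_section_on (U `&` lc_W c) (d j).
  have s1 : smooth_section_on (U `&` lc_W c) (fun p => D p (e j)).
    by apply: section_sub (sD _ (ek j)) => r [].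
  have sX' : smooth_field_on (U `&` lc_W c) X.
    by move=> f; apply: smooth_on_sub (sX f) => r [].
  have := section_comb oI (smooth_on_cst _ (-1)) (wc_smooth nabP (e j) oI sX') s1.
  apply: (@regular_ext R M _ (bundle_sheaf A) _ _ _ oI) => p _.
  by rewrite /= scaleN1r addrC.
have zE p : (U `&` lc_W c) p ->
    lc_mu c p (z p) = mxvec (\matrix_j lc_mu c p (d j p)) *m L.
  move=> [Up Wp]; have Vp := lc_WV Wp.
  rewrite -[LHS]mulmx1 -AdL mulmxA; congr (_ *m _).
  rewrite AdE; congr mxvec; apply/matrixP => j l; rewrite !mxE.
  rewrite /d DE // /Theta addrC addKr /e lc_sE lc_chi1 // scale1r.
  by rewrite -[in RHS](lc_hmu Vp (kz _ Up)) -lc_br // lc_muh.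
exists (U `&` lc_W c), (fun p => lc_h c p (vec (lc_mu c p (z p)))); split=> //.
  apply: lc_section => // [r [_ /(@lc_WV c)//]|l].
  have : smooth_on (U `&` lc_W c)
      (fun p => (mxvec (\matrix_j lc_mu c p (d j p)) *m L) 0 l).
    apply: (@smooth_on_mul R M _ 1 _ q (fun p => mxvec (\matrix_j lc_mu c p (d j p)))
      (fun _ => L)) => // [i m|i m]; last exact: smooth_on_cst.
    case/mxvec_indexP: m => j l'.
    have : smooth_on (U `&` lc_W c) (fun p => lc_mu c p (d j p) 0 l').
      by apply: lc_mus (sd j) _ => // r [_ /(@lc_WV c)].
    apply: smooth_on_ext => // p _; by rewrite ord1 mxvecE mxE.
  by apply: smooth_on_ext => // p Ip; rewrite zE.
move=> r [Ur /(@lc_WV c) Vr] _; rewrite lc_hmu //; exact: kz.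
Qed.

(** * The transitive algebroid of derivations *)

Record section_derivation (X : vfield M) (D : section A -> section A) : Prop :=
  SectionDerivation {
  sd_in : forall s, section_in k s -> section_in k (D s);
  sd_add : forall s t, section_in k s -> section_in k t -> D (s + t) = D s + D t;
  sd_leibniz : forall (f : smooth M) s, section_in k s ->
    D (f *: s) = f *: D s + vfield_app X f *: s;
  sd_der : forall s t, section_in k s -> section_in k t ->
    D (br s t) = br (D s) t + br s (D t);
}.

Lemma ideal_sectionD s t : section_in k s -> section_in k t -> section_in k (s + t).
Proof. by move=> ks kt p; rewrite section_addE; exact: idealD. Qed.

Lemma ideal_sectionN s : section_in k s -> section_in k (- s).
Proof. by move=> ks p; rewrite section_oppE; exact: idealN. Qed.

Lemma ideal_sectionZ (f : smooth M) s : section_in k s -> section_in k (f *: s).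
Proof. by move=> ks p; rewrite section_scaleE; exact: idealZ. Qed.

Lemma derivation_at_point X D p : section_derivation X D ->
  derivation_over (X p) (fun s => D s p).
Proof.
move=> [D1 D2 D3 D4]; split=> [s ks|s t ks kt|f s ks|s t ks kt].
- exact: D1.
- by rewrite D2.
- by rewrite D3.
- by rewrite D4 // section_addE !fbE //; exact: D1.
Qed.

(** The terms b and c are the mixed ones in a commutator of two derivations: each occurs in both
    orders of composition. *)
Lemma commutator_cancel (V : zmodType) (a b c d e f : V) :
  a + b + (c + d) - (e + c + (b + f)) = a - e + (d - f).
Proof.
rewrite (AC (2*2) ((1*4)*(2*3))) [e + c + _](AC (2*2) ((1*4)*(3*2))).
by rewrite opprD addrACA subrr addr0 opprD addrACA.
Qed.

Lemma derivation_comm X Y D E : section_derivation X D -> section_derivation Y E ->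
  section_derivation (vbracket X Y) (fun s => D (E s) - E (D s)).
Proof.
move=> [D1 D2 D3 D4] [E1 E2 E3 E4].
have kZ := ideal_sectionZ; have kD := ideal_sectionD.
split=> [s ks|s t ks kt|f s ks|s t ks kt].
- by apply: kD; [exact/D1/E1|exact/ideal_sectionN/E1/D1].
- rewrite E2 // D2 //; [|exact: E1|exact: E1].
  rewrite D2 // E2 //; [|exact: D1|exact: D1].
  by rewrite opprD addrACA.
- rewrite E3 // D2; [|exact/kZ/E1|exact: kZ].
  rewrite !D3 //; last exact: E1.
  rewrite E2; [|exact/kZ/D1|exact: kZ].
  rewrite !E3 //; last exact: D1.
  apply: section_ext => p.
  rewrite !(section_addE, section_oppE, section_scaleE) scalerBr.
  set a := D (E s) p; set b := E s p; set c := D s p; set d := E (D s) p.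
  change (f p *: a + X p f *: b + (Y p f *: c + X p (vfield_app Y f) *: s p) -
    (f p *: d + Y p f *: c + (X p f *: b + Y p (vfield_app X f) *: s p)) =
    f p *: a - f p *: d + (X p (vfield_app Y f) - Y p (vfield_app X f)) *: s p).
  by rewrite scalerBl commutator_cancel.
- rewrite E4 // D2; [|exact/ideal_br|exact/ideal_br/E1].
  rewrite !D4 //; try exact: E1.
  rewrite E2; [|exact/ideal_br|exact/ideal_br/D1].
  rewrite !E4 //; try exact: D1.
  by rewrite br_addl br_add br_oppl br_oppr commutator_cancel.
Qed.

Lemma br_derivation (a : section A) : section_derivation (rho a) (br a).
Proof.
split=> [s ks|s t ks kt|f s ks|s t ks kt].
- exact: ideal_br.
- exact: br_add.
- exact: br_leibniz.
- by rewrite br_jacobi.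
Qed.

(** The projection l. Bracketing with a section through [a] is a derivation of [k] over the anchor
    of [a], and l(a) is what remains of it after subtracting the connection, read as an element of
    [k]. *)
Definition ideal_proj (p : M) (a : A p) : A p :=
  xget 0 [set z | k p z /\ forall b : section A, b p = a ->
    forall s, section_in k s -> br b s p = Theta (anchor A p a) z s].

Lemma ideal_projP (b : section A) p : k p (ideal_proj (b p)) /\
  forall s, section_in k s ->
    br b s p = Theta (anchor A p (b p)) (ideal_proj (b p)) s.
Proof.
rewrite /ideal_proj; case: xgetP => [z _ [kz zP]|].
  by split=> // s ks; exact: zP.
have [z [kz zP]] := derivation_Theta (derivation_at_point p (br_derivation b)).
move=> /(_ z) []; split=> // b' b'E s ks.
by rewrite (act_tensor ks b'E); exact: zP.
Qed.

Lemma ideal_proj_in p (a : A p) : k p (ideal_proj a).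
Proof. by have [b <-] := section_through a; have [] := ideal_projP b p. Qed.

Lemma Theta_linear p (c : R) (X Y : tangent p) z w s : k p z -> k p w ->
  section_in k s ->
  Theta (c *: X + Y) (c *: z + w) s = c *: Theta X z s + Theta Y w s.
Proof.
move=> kz kw ks; rewrite /Theta (wc_linear nabP) fb_linearl //.
by rewrite scalerDr addrACA.
Qed.

(** Both sides are compared through the derivations they define, by [Theta_injective]; the same
    device yields [ideal_proj_id], where the derivation is ad a. *)
Lemma ideal_proj_linear p : linear (@ideal_proj p).
Proof.
move=> c x y; have [a ax] := section_through x; have [b byE] := section_through y.
apply: (@Theta_injective p (anchor A p (c *: x + y))).
- exact: ideal_proj_in.
- by apply: ideal_comb; exact: ideal_proj_in.
move=> s ks; rewrite [in RHS]linearP Theta_linear //; try exact: ideal_proj_in.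
have [_ aP] := ideal_projP a p; have [_ bP] := ideal_projP b p.
rewrite -ax -byE -aP // -bP //.
have E : ((c *: (1 : smooth M)) *: a + b) p = c *: a p + b p.
  by rewrite section_addE section_realE.
have [_] := ideal_projP ((c *: (1 : smooth M)) *: a + b) p; rewrite E => <- //.
rewrite br_addl section_addE; congr (_ + _).
rewrite br_anti br_real section_oppE section_realE -scalerN.
by rewrite -section_oppE -br_anti.
Qed.

Lemma nab0 p s : nab p 0 s = 0.
Proof.
have := wc_linear nabP (-1) (0 : tangent p) 0 s.
by rewrite scaleN1r oppr0 addr0 scaleN1r addNr.
Qed.

Lemma ideal_proj_id p (a : A p) : k p a -> ideal_proj a = a.
Proof.
move=> ka; have [b kb ba] := ideal_through ka.
apply: (@Theta_injective p 0) => //; first exact: ideal_proj_in.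
move=> s ks; have [_] := ideal_projP b p; rewrite ba (ideal_anchor ka) => <- //.
by rewrite /Theta nab0 add0r -ba fbE.
Qed.

(** By [Theta_smooth_inv] it suffices that the derivations defined by the values of [s] are smooth;
    near each point they are the bracket with a global extension of [s]. *)
Lemma ideal_proj_smooth (U : set M) (s : forall p, A p) : open U ->
  smooth_section_on U s -> smooth_section_on U (fun p => ideal_proj (s p)).
Proof.
move=> oU ss.
apply: (@Theta_smooth_inv U (fun p => anchor A p (s p)) (fun p => ideal_proj (s p))
  (fun p => Theta (anchor A p (s p)) (ideal_proj (s p)))) => //.
- exact: anchor_smooth.
- by move=> p _; exact: ideal_proj_in.
move=> s' ks'; apply: section_glue => // p Up.
have [b [chi [W [[oW Wp] WU bE _ _]]]] := section_extend oU Up ss.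
exists W, (br b s'); split=> //.
  by apply: section_sub (section_smooth (br b s')).
move=> r Wr _; have [_ ->] := ideal_projP b r => //.
by rewrite (bE _ Wr).2.
Qed.

Definition ideal_proj_map : bundle_map A A :=
  @BundleMap R M A A (fun p => pack_linear (@ideal_proj_linear p)) ideal_proj_smooth.

Lemma ideal_proj_mapE p a : ideal_proj_map p a = ideal_proj a.
Proof. by []. Qed.

Lemma smooth_field_ext (X Y : vfield M) : (forall p, X p = Y p) -> X = Y.
Proof.
case: X Y => [X Xs] [Y Ys] /= XY.
have e : X = Y by exact: functional_extensionality_dep.
by rewrite e in Xs *; congr VField; exact: Prop_irrelevance.
Qed.

Lemma splitting_submodule p :
  submodule [set x : (tangent p * A p)%type | k p x.2].
Proof.
split; first exact: ideal0.
by move=> c x y kx ky; exact: ideal_comb.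
Qed.

(* The fibre of A' = TM + k. *)
Definition atiyah_fibre (p : M) : lmodType R := subsp (splitting_submodule p).

Definition atiyah_sheaf : sheaf atiyah_fibre :=
  sub_sheaf (prod_sheaf (tangent_sheaf M) (bundle_sheaf A)) splitting_submodule.

Definition atiyah_mk (p : M) (X : tangent p) (z : A p) : atiyah_fibre p :=
  if pselect (k p z) is left kz
  then Subsp (HS := splitting_submodule p) (subsp_val := (X, z)) (asboolT kz)
  else 0.

Lemma atiyah_mkE p (X : tangent p) z : k p z -> subsp_val (atiyah_mk X z) = (X, z).
Proof. by rewrite /atiyah_mk; case: pselect. Qed.

Lemma atiyah_in p (x : atiyah_fibre p) : k p (subsp_val x).2.
Proof. exact: (subspP x). Qed.

Lemma atiyah_eq p (x y : atiyah_fibre p) :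
  (subsp_val x).1 = (subsp_val y).1 -> (subsp_val x).2 = (subsp_val y).2 -> x = y.
Proof.
move=> e1 e2; apply: subsp_eq.
by rewrite [subsp_val x]surjective_pairing e1 e2 -surjective_pairing.
Qed.

Lemma atiyah_linear p (c : R) (x y : atiyah_fibre p) :
  (subsp_val (c *: x + y)).1 = c *: (subsp_val x).1 + (subsp_val y).1 /\
  (subsp_val (c *: x + y)).2 = c *: (subsp_val x).2 + (subsp_val y).2.
Proof. by []. Qed.

Lemma tangent_combE (p : M) (c : R) (v w : tangent p) (f : smooth M) :
  (c *: v + w) f = c * v f + w f.
Proof. by []. Qed.

(** The frame joins the coordinate vector fields with the frame of [k] coming from a Lie algebra
    chart, whence the rank dim M + dim g. *)
Lemma atiyah_frame p0 : frame_near atiyah_sheaf (mdim M + q) p0.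
Proof.
have [W [X [d [[oW Wp] ds dX Xd]]]] := tangent_frame p0.
have [c cp] := lie_chart_exists p0.
have oI : open (W `&` lc_V c) by apply: openI => //; exact: lc_Vo.
pose f (i : 'I_(mdim M + q)) p : atiyah_fibre p := match fintype.split i with
  | inl a => atiyah_mk (d a p) 0
  | inr b => atiyah_mk 0 (lc_h c p (vec (delta_mx 0 b))) end.
pose mu p (x : atiyah_fibre p) : 'rV[R]_(mdim M + q) :=
  row_mx (\row_a (subsp_val x).1 (X a)) (lc_mu c p (subsp_val x).2).
have mu_lin p : linear (@mu p).
  move=> e x y; rewrite /mu scale_row_mx add_row_mx.
  have [-> ->] := atiyah_linear e x y; rewrite linearP; congr row_mx.
  apply/rowP => a; rewrite mxE tangent_combE.
  by rewrite [RHS]mxE [in RHS]mxE; congr (_ + _); rewrite !mxE.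
exists (W `&` lc_V c), f, (fun p => pack_linear (mu_lin p)); split.
- by split=> //; split=> //; exact: lc_WV.
- move=> i; rewrite /f; case: (fintype.split i) => j.
    split.
      apply: (@regular_ext R M _ (tangent_sheaf M) _ (d j) _ oI).
        by move=> p _; rewrite atiyah_mkE //; exact: ideal0.
      by move=> F; apply: smooth_on_sub (ds j F) => r [].
    apply: (@regular_ext R M _ (bundle_sheaf A) _ (fun=> 0) _ oI).
      by move=> p _; rewrite atiyah_mkE //; exact: ideal0.
    exact: section_zero.
  split.
    apply: (@regular_ext R M _ (tangent_sheaf M) _ (fun=> 0) _ oI).
      by move=> p [_ Vp]; rewrite atiyah_mkE //; exact: lc_hk.
    exact: field_zero.
  apply: (@regular_ext R M _ (bundle_sheaf A) _
      (fun p => lc_h c p (vec (delta_mx 0 j))) _ oI).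
    by move=> p [_ Vp]; rewrite atiyah_mkE //; exact: lc_hk.
  rewrite /=; apply: (@section_sub R M A _ (lc_V c)) (@subIsetr _ _ _) _.
  exact: lc_hs.
- move=> U s oU UV [s1 s2] j /=; rewrite /mu.
  have sU : forall b, smooth_on U (fun p => lc_mu c p (subsp_val (s p)).2 0 b).
    by apply: lc_mus => // r /UV[].
  rewrite -(splitK j); case: (fintype.split j) => b /=.
    apply: smooth_on_ext (s1 (X b)) => // p _; by rewrite row_mxEl mxE.
  by apply: smooth_on_ext (sU b) => // p _; rewrite row_mxEr.
- move=> p [Wp' Vp] i /=; rewrite /mu /f; case: (fintype.split_ordP i) => j ->.
    rewrite atiyah_mkE /=; last exact: ideal0.
    rewrite delta_mx_lshift linear0; congr row_mx.
    by apply/rowP => a; rewrite !mxE dX // eqxx eq_sym.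
  rewrite atiyah_mkE /=; last exact: lc_hk.
  rewrite delta_mx_rshift lc_muh // vecK; congr row_mx.
  by apply/rowP => a; rewrite !mxE.
- move=> p [Wp' Vp] x /=; rewrite /mu => /eqP; rewrite row_mx_eq0 => /andP[/eqP x1 /eqP x2].
  apply: atiyah_eq => /=.
    rewrite (Xd p (subsp_val x).1 Wp') big1 // => a _.
    by have /rowP/(_ a) := x1; rewrite !mxE => ->; rewrite scale0r.
  by rewrite -(lc_hmu Vp (atiyah_in x)) x2 !linear0.
Qed.

Definition atiyah_bundle : vbundle M := sheaf_bundle atiyah_frame.

Lemma zmod_leibniz (V : zmodType) (x y z w u : V) :
  x + y + z - (w + u) = x - w + (y + (z - u)).
Proof. by rewrite opprD addrACA [x + y - w]addrAC -addrA. Qed.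

Lemma zmod_jacobi (V : zmodType) (x1 x2 x3 x4 x5 x6 : V) :
  x1 - x2 - (x3 - x4) = x1 - x5 - (x6 - x4) + (x5 - x3 - (x2 - x6)).
Proof.
rewrite !opprB [RHS]addrACA !subrKA [LHS]addrACA [RHS]addrACA.
by rewrite [- x2 - x3]addrC.
Qed.

Lemma atiyah_anchor_linear p : linear (fun x : atiyah_bundle p => (subsp_val x).1).
Proof. by move=> c x y; have [] := atiyah_linear c x y. Qed.

Definition atiyah_anchor p : {linear atiyah_bundle p -> tangent p} :=
  pack_linear (@atiyah_anchor_linear p).

Lemma atiyah_anchor_smooth (U : set M) (s : forall p, atiyah_bundle p) : open U ->
  smooth_section_on U s -> smooth_field_on U (fun p => atiyah_anchor p (s p)).
Proof. by move=> oU /(sheaf_bundleP atiyah_frame s oU)[]. Qed.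

Lemma atiyah_ideal_smooth (U : set M) (s : forall p, atiyah_bundle p) : open U ->
  smooth_section_on U s -> smooth_section_on U (fun p => (subsp_val (s p)).2).
Proof. by move=> oU /(sheaf_bundleP atiyah_frame s oU)[]. Qed.

Definition atiyah_field (a : section atiyah_bundle) : vfield M :=
  VField (atiyah_anchor_smooth openT (section_smooth a)).

Definition atiyah_ideal (a : section atiyah_bundle) : section A :=
  MkSection (atiyah_ideal_smooth openT (section_smooth a)).

Lemma atiyah_ideal_in a : section_in k (atiyah_ideal a).
Proof. by move=> p; exact: atiyah_in. Qed.

Lemma atiyah_pair_smooth (U : set M) (X : forall p : M, tangent p)
    (z : forall p, A p) : open U -> smooth_field_on U X ->
  smooth_section_on U z -> (forall p, U p -> k p (z p)) ->
  smooth_section_on (E := atiyah_bundle) U (fun p => atiyah_mk (X p) (z p)).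
Proof.
move=> oU sX sz kz.
apply/(sheaf_bundleP atiyah_frame (fun p => atiyah_mk (X p) (z p)) oU); split.
  apply: (@regular_ext R M _ (tangent_sheaf M) U X _ oU) sX => p Up.
  by rewrite atiyah_mkE //; exact: kz.
apply: (@regular_ext R M _ (bundle_sheaf A) U z _ oU) sz => p Up.
by rewrite atiyah_mkE //; exact: kz.
Qed.

Lemma atiyah_section (X : vfield M) (z : section A) : section_in k z ->
  exists a, atiyah_field a = X /\ atiyah_ideal a = z.
Proof.
move=> kz; exists (MkSection (atiyah_pair_smooth openT (vfield_smooth X)
  (section_smooth z) (fun p _ => kz p))); split.
  by apply: smooth_field_ext => p; rewrite /= atiyah_mkE.
by apply: section_ext => p; rewrite /= atiyah_mkE.
Qed.

Lemma atiyah_section_eq a b : (forall p, atiyah_field a p = atiyah_field b p) ->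
  (forall p, atiyah_ideal a p = atiyah_ideal b p) -> a = b.
Proof. by move=> e1 e2; apply: section_ext => p; exact: (atiyah_eq (e1 p) (e2 p)). Qed.

(** The derivation of [k] represented by a section of A'. Off the sections of [k] it is 0 by
    convention, so that it is a total map. *)
Definition atiyah_op (a : section atiyah_bundle) (s : section A) : section A :=
  if pselect (section_in k s) is left ks then
    MkSection (Theta_smooth openT (vfield_smooth (atiyah_field a))
      (section_smooth (atiyah_ideal a)) (fun p _ => atiyah_ideal_in a p) ks)
  else 0.

Lemma atiyah_opE a s p : section_in k s ->
  atiyah_op a s p = Theta (atiyah_field a p) (atiyah_ideal a p) s.
Proof. by rewrite /atiyah_op; case: pselect. Qed.

Lemma atiyah_op_derivation a : section_derivation (atiyah_field a) (atiyah_op a).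
Proof.
have D p := Theta_derivation (atiyah_field a p) (atiyah_ideal_in a p).
have kT s : section_in k s -> section_in k (atiyah_op a s).
  by move=> ks p; rewrite atiyah_opE //; exact: (do_in (D p)).
split=> // [s t ks kt|f s ks|s t ks kt]; apply: section_ext => p.
- rewrite section_addE !atiyah_opE //; last exact: ideal_sectionD.
  exact: (do_add (D p)).
- rewrite section_addE !section_scaleE !atiyah_opE //; last exact: ideal_sectionZ.
  exact: (do_leibniz (D p)).
- rewrite section_addE -!fbE //; try exact: kT.
  by rewrite !atiyah_opE ?(do_der (D p)) //; exact: ideal_br.
Qed.

(** Pointwise existence gives z at every point, and [Theta_smooth_inv] makes the resulting family
    smooth, because D sends smooth sections to smooth sections. *)
Lemma atiyah_op_exists X D : section_derivation X D ->
  exists a, atiyah_field a = X /\ forall s, section_in k s -> atiyah_op a s = D s.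
Proof.
move=> HD.
pose z p := xget 0 [set z | k p z /\ forall s, section_in k s -> D s p = Theta (X p) z s].
have zP p : k p (z p) /\ forall s, section_in k s -> D s p = Theta (X p) (z p) s.
  rewrite /z; case: xgetP => [x _ //|].
  by have [x xP] := derivation_Theta (derivation_at_point p HD); move=> /(_ x)[].
have sz : smooth_section_on setT z.
  apply: (@Theta_smooth_inv setT X z (fun p s => D s p)) => //.
  - exact: openT.
  - exact: vfield_smooth.
  - by move=> p _; have [] := zP p.
  - by move=> p s _ ks; have [_ ->] := zP p.
  - by move=> s ks; exact: section_smooth.
have kz : section_in k (MkSection sz) by move=> p; have [] := zP p.
have [a [aX az]] := atiyah_section X kz.
exists a; split=> // s ks; apply: section_ext => p.
by rewrite atiyah_opE // aX az; have [_ ->] := zP p.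
Qed.

(** The antisymmetry, Leibniz and Jacobi identities of the bracket of A' are proved through this
    lemma: one compares the anchors and then the operators on sections of [k], where the bracket is
    a commutator. *)
Lemma atiyah_op_injective a b :
  (forall p, atiyah_field a p = atiyah_field b p) ->
  (forall s, section_in k s -> atiyah_op a s = atiyah_op b s) -> a = b.
Proof.
move=> ab H; apply: atiyah_section_eq => // p.
apply: (@Theta_injective p (atiyah_field a p)); [exact: atiyah_ideal_in..|].
by move=> s ks; rewrite -atiyah_opE // H // atiyah_opE // ab.
Qed.

Lemma atiyah_br_exists (a b : section atiyah_bundle) : exists c,
  atiyah_field c = vbracket (atiyah_field a) (atiyah_field b) /\
  forall s, section_in k s ->
    atiyah_op c s = atiyah_op a (atiyah_op b s) - atiyah_op b (atiyah_op a s).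
Proof.
exact: atiyah_op_exists (derivation_comm (atiyah_op_derivation a) (atiyah_op_derivation b)).
Qed.

Definition atiyah_br (a b : section atiyah_bundle) : section atiyah_bundle :=
  sval (cid (atiyah_br_exists a b)).

Lemma atiyah_br_field a b :
  atiyah_field (atiyah_br a b) = vbracket (atiyah_field a) (atiyah_field b).
Proof. by rewrite /atiyah_br; case: cid => c []. Qed.

Lemma atiyah_br_op a b s : section_in k s ->
  atiyah_op (atiyah_br a b) s =
  atiyah_op a (atiyah_op b s) - atiyah_op b (atiyah_op a s).
Proof. by move=> ks; rewrite /atiyah_br; case: cid => c [_ ->]. Qed.

Lemma vfield_appE (X : vfield M) (f : smooth M) p : vfield_app X f p = X p f.
Proof. by []. Qed.

Lemma vbracketE (X Y : vfield M) p (f : smooth M) :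
  vbracket X Y p f = X p (vfield_app Y f) - Y p (vfield_app X f).
Proof. by []. Qed.

Lemma atiyah_field_comb (f : smooth M) a b p :
  atiyah_field (f *: a + b) p = f p *: atiyah_field a p + atiyah_field b p.
Proof. by []. Qed.

Lemma atiyah_ideal_comb (f : smooth M) a b p :
  atiyah_ideal (f *: a + b) p = f p *: atiyah_ideal a p + atiyah_ideal b p.
Proof. by []. Qed.

Lemma atiyah_op_comb (f : smooth M) a b s : section_in k s ->
  atiyah_op (f *: a + b) s = f *: atiyah_op a s + atiyah_op b s.
Proof.
move=> ks; apply: section_ext => p; rewrite section_addE section_scaleE.
rewrite !atiyah_opE // atiyah_field_comb atiyah_ideal_comb.
by apply: Theta_linear => //; exact: atiyah_ideal_in.
Qed.

Lemma atiyah_field_app_comb (f : smooth M) a b F :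
  vfield_app (atiyah_field (f *: a + b)) F =
  f * vfield_app (atiyah_field a) F + vfield_app (atiyah_field b) F.
Proof.
apply: smooth_eq => p.
by rewrite vfield_appE atiyah_field_comb tangent_combE.
Qed.

Lemma atiyah_br_comb a (f : smooth M) b c :
  atiyah_br a (f *: b + c) =
  f *: atiyah_br a b + (vfield_app (atiyah_field a) f *: b + atiyah_br a c).
Proof.
have [D1 D2 D3 D4] := atiyah_op_derivation a.
have op_in x := sd_in (atiyah_op_derivation x).
apply: atiyah_op_injective => [p|s ks].
  rewrite !atiyah_field_comb !atiyah_br_field; apply: tangent_eq => F.
  rewrite vbracketE atiyah_field_app_comb tangentD tangentM atiyah_field_comb.
  rewrite !tangent_combE !vbracketE !vfield_appE.
  by ring.
rewrite !atiyah_op_comb // !atiyah_br_op // atiyah_op_comb //.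
rewrite atiyah_op_comb; last exact: op_in.
rewrite D2; [|exact/ideal_sectionZ/op_in|exact: op_in].
rewrite D3; last exact: op_in.
apply: section_ext => p.
rewrite !(section_addE, section_oppE, section_scaleE) scalerBr.
exact: zmod_leibniz.
Qed.

Lemma atiyah_br_anti a b : atiyah_br a b = - atiyah_br b a.
Proof.
rewrite -scaleN1r -[RHS]addr0.
apply: atiyah_op_injective => [p|s ks].
  rewrite atiyah_field_comb !atiyah_br_field; apply: tangent_eq => F.
  rewrite tangent_combE !vbracketE.
  change (atiyah_field a p (vfield_app (atiyah_field b) F) -
    atiyah_field b p (vfield_app (atiyah_field a) F) =
    -1 * (atiyah_field b p (vfield_app (atiyah_field a) F) -
     atiyah_field a p (vfield_app (atiyah_field b) F)) + 0).
  by ring.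
rewrite atiyah_op_comb // !atiyah_br_op //.
have -> : atiyah_op 0 s = 0.
  have := atiyah_op_comb (-1) 0 0 ks; rewrite scaleN1r oppr0 addr0 => ->.
  by rewrite scaleN1r addNr.
by rewrite addr0 scaleN1r opprB.
Qed.

Lemma vbracket_app (X Y : vfield M) (f : smooth M) :
  vfield_app (vbracket X Y) f =
  vfield_app X (vfield_app Y f) - vfield_app Y (vfield_app X f).
Proof. by apply: smooth_eq. Qed.

Lemma atiyah_br_add a b c : atiyah_br a (b + c) = atiyah_br a b + atiyah_br a c.
Proof.
have := atiyah_br_comb a 1 b c; rewrite !scale1r => ->; congr (_ + _).
have -> : vfield_app (atiyah_field a) 1 = 0.
  by apply: smooth_eq => p; rewrite vfield_appE tangent1.
by rewrite scale0r add0r.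
Qed.

Lemma atiyah_op_add a b s : section_in k s ->
  atiyah_op (a + b) s = atiyah_op a s + atiyah_op b s.
Proof. by move=> ks; have := atiyah_op_comb 1 a b ks; rewrite !scale1r. Qed.

Lemma atiyah_field_add a b p :
  atiyah_field (a + b) p = atiyah_field a p + atiyah_field b p.
Proof. by []. Qed.

Lemma atiyah_opB a s t : section_in k s -> section_in k t ->
  atiyah_op a (s - t) = atiyah_op a s - atiyah_op a t.
Proof.
move=> ks kt; have [D1 D2 D3 D4] := atiyah_op_derivation a.
rewrite D2 //; last exact: ideal_sectionN.
rewrite -[- t]scaleN1r D3 // scaleN1r; congr (_ + _).
have -> : vfield_app (atiyah_field a) (-1) = 0.
  apply: smooth_eq => p; rewrite vfield_appE -scaleN1r.
  by rewrite tangentZ tangent1 mulr0.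
by rewrite scale0r addr0.
Qed.

Lemma atiyah_br_jacobi a b c :
  atiyah_br a (atiyah_br b c) =
  atiyah_br (atiyah_br a b) c + atiyah_br b (atiyah_br a c).
Proof.
have op_in x := sd_in (atiyah_op_derivation x).
apply: atiyah_op_injective => [p|s ks].
  rewrite atiyah_field_add !atiyah_br_field; apply: tangent_eq => F.
  have [-> _ _ _] := tangentE (vbracket (vbracket (atiyah_field a) (atiyah_field b))
    (atiyah_field c) p) (vbracket (atiyah_field b)
    (vbracket (atiyah_field a) (atiyah_field c)) p) 0 F.
  rewrite !vbracketE !vbracket_app !tangentB.
  by ring.
rewrite atiyah_op_add // !atiyah_br_op //; try exact: op_in.
have op2_in x y := op_in x _ (op_in y _ ks).
by rewrite !atiyah_opB //; exact: zmod_jacobi.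
Qed.

Lemma atiyah_br_real a (c : R) b d :
  atiyah_br a ((c *: (1 : smooth M)) *: b + d) =
  (c *: (1 : smooth M)) *: atiyah_br a b + atiyah_br a d.
Proof.
rewrite atiyah_br_comb; congr (_ + _).
have -> : vfield_app (atiyah_field a) (c *: (1 : smooth M)) = 0.
  by apply: smooth_eq => p; rewrite vfield_appE tangentZ tangent1 mulr0.
by rewrite scale0r add0r.
Qed.

Lemma atiyah_br_leibniz a (f : smooth M) b :
  atiyah_br a (f *: b) = f *: atiyah_br a b + vfield_app (atiyah_field a) f *: b.
Proof.
have a0 : atiyah_br a 0 = 0.
  by apply: (addrI (atiyah_br a 0)); rewrite -atiyah_br_add !addr0.
by rewrite -[f *: b]addr0 atiyah_br_comb a0 addr0.
Qed.

Definition atiyah_algebroid : lie_algebroid M :=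
  @LieAlgebroid R M atiyah_bundle atiyah_anchor atiyah_anchor_smooth atiyah_br
    (fun c s t u => atiyah_br_real s c t u) atiyah_br_anti atiyah_br_jacobi
    atiyah_br_leibniz (fun s t p => congr1 (fun X : vfield M => X p) (atiyah_br_field s t)).

Lemma atiyah_transitive : la_transitive atiyah_algebroid.
Proof.
by move=> p v; exists (atiyah_mk v 0); rewrite /= atiyah_mkE //; exact: ideal0.
Qed.

(** * The fibre product *)

Lemma complement_submodule p : submodule [set a : A p | ideal_proj a = 0].
Proof.
split; first by rewrite /= ideal_proj_id //; exact: ideal0.
by move=> c x y /= x0 y0; rewrite ideal_proj_linear x0 y0 scaler0 addr0.
Qed.

(* The fibre of B = ker l, identified with A / k. *)
Definition complement_fibre (p : M) : lmodType R := subsp (complement_submodule p).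

Lemma complement_proj_mem p (a : A p) :
  ideal_proj (a - ideal_proj a) = 0.
Proof.
rewrite -ideal_proj_mapE linearB /= [ideal_proj (ideal_proj a)]ideal_proj_id ?subrr //.
exact: ideal_proj_in.
Qed.

Definition complement_proj p (a : A p) : complement_fibre p :=
  Subsp (HS := complement_submodule p) (asboolT (complement_proj_mem a)).

Lemma complement_projE p (a : A p) :
  subsp_val (complement_proj a) = a - ideal_proj a.
Proof. by []. Qed.

Lemma complement_mem p (x : complement_fibre p) : ideal_proj (subsp_val x) = 0.
Proof. exact: (subspP x). Qed.

Lemma complement_proj_id p (x : complement_fibre p) :
  complement_proj (subsp_val x) = x.
Proof. by apply: subsp_eq; rewrite complement_projE complement_mem subr0. Qed.

Definition complement_sheaf : sheaf complement_fibre :=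
  sub_sheaf (bundle_sheaf A) complement_submodule.

(** A right inverse forces the rank to be n; as the rank is at most m and m <= n, it equals m and
    the kernel is 0. *)
Lemma surjective_injective (m n : nat) (f : {linear 'rV[R]_m -> 'rV[R]_n})
    (h : 'rV[R]_n -> 'rV[R]_m) : cancel h f -> (m <= n)%N ->
  forall u, f u = 0 -> u = 0.
Proof.
move=> hK mn u fu; pose F := lin1_mx f.
have FE v : v *m F = f v by rewrite mul_rV_lin1.
have full : row_full F.
  apply/row_fullP; exists (\matrix_i h (delta_mx 0 i)); apply/row_matrixP => i.
  by rewrite row_mul rowK FE hK row1.
have free : row_free F.
  by rewrite /row_free eqn_leq rank_leq_row (eqP full).
by apply: (row_free_inj free); rewrite FE fu mul0mx.
Qed.

Lemma complement_smooth (U : set M) (s : forall p, A p) : open U ->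
  smooth_section_on U s -> smooth_section_on U (fun p => s p - ideal_proj (s p)).
Proof.
move=> oU ss.
have := section_comb oU (smooth_on_cst _ (-1)) (ideal_proj_smooth oU ss) ss.
apply: (@regular_ext R M _ (bundle_sheaf A) _ _ _ oU) => p _.
by rewrite /= scaleN1r addrC.
Qed.

(** The rows of [K] are a basis of ker l at [p0] in a trivialization of [A]. They are extended with
    constant coordinates and projected by 1 - l, which changes nothing at [p0], so they stay
    independent nearby. *)
Lemma complement_frame p0 : frame_near complement_sheaf (vb_rank A - q) p0.
Proof.
have [t Et tp0] := @trivs_cover _ _ A p0.
have [c /(@lc_WV c) cp0] := lie_chart_exists p0.
pose Q0 : 'M[R]_(vb_rank A, q) :=
  \matrix_i lc_mu c p0 (ideal_proj (triv_inv t (delta_mx 0 i) p0)).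
have Q0E a : t p0 a *m Q0 = lc_mu c p0 (ideal_proj a).
  rewrite [in RHS](triv_expand a tp0) -ideal_proj_mapE !linear_sum mulmx_sum_row.
  by apply: eq_bigr => i _; rewrite !linearZ rowK.
have full : row_full Q0.
  apply/row_fullP; exists (\matrix_j t p0 (lc_h c p0 (vec (delta_mx 0 j)))).
  apply/row_matrixP => j; rewrite row_mul rowK Q0E ideal_proj_id; last exact: lc_hk.
  by rewrite lc_muh // vecK row1.
have q_le : (q <= vb_rank A)%N by rewrite -(eqP full) rank_leq_row.
have [K freeK KQ] : exists2 K : 'M[R]_(vb_rank A - q, vb_rank A),
    row_free K & K *m Q0 = 0.
  have <- : \rank (kermx Q0) = (vb_rank A - q)%N by rewrite mxrank_ker (eqP full).
  exists (row_base (kermx Q0)); first exact: row_base_free.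
  by apply/sub_kermxP; rewrite eq_row_base.
pose f j p : A p := triv_inv t (row j K) p - ideal_proj (triv_inv t (row j K) p).
have fs j : smooth_section_on (triv_dom t) (f j).
  by apply: complement_smooth; [exact: triv_open|exact: triv_inv_smooth].
have fp0 j : f j p0 = triv_inv t (row j K) p0.
  rewrite /f; suff -> : ideal_proj (triv_inv t (row j K) p0) = 0 by rewrite subr0.
  rewrite -(lc_hmu cp0 (ideal_proj_in _)) -Q0E triv_invK // -row_mul KQ row0.
  by rewrite !linear0.
have [|V [mu [[oV Vp0] VU mus mue]]] := dual_coordinates (e := f)
    (@triv_open _ _ _ _ t) tp0 fs.
  move=> x /(congr1 (t p0)); rewrite linear0 linear_sum => E.
  apply: (row_free_inj freeK); rewrite mul0mx -E mulmx_sum_row.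
  by apply: eq_bigr => j _; rewrite fp0 linearZ /= triv_invK.
have oI : open (V `&` lc_V c) by apply: openI => //; exact: lc_Vo.
pose m p (x : complement_fibre p) := mu p (subsp_val x).
have m_lin p : linear (@m p) by move=> a x y; rewrite /m subsp_linear linearP.
exists (V `&` lc_V c), (fun j p => complement_proj (triv_inv t (row j K) p)),
  (fun p => pack_linear (m_lin p)); split=> //=.
- move=> j; apply: (@section_sub R M A _ (triv_dom t)); last exact: fs.
  by move=> p [/VU].
- by move=> U s oU UV ss j; apply: mus => // p /UV[].
- by move=> p [Vp _] j; rewrite /m complement_projE; exact: mue.
move=> p [Vp cp] x; rewrite /m => mx0; have tp := VU _ Vp.
(* To see that the frame spans ker l at p, coordinates of l(a) and of a - l(a) are put side by side.
   The map so obtained is onto, and its source and target have the same dimension, so an element of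
   ker l with zero coordinates is 0. *)
pose Psi (u : 'rV[R]_(vb_rank A)) : 'rV[R]_(q + (vb_rank A - q)) :=
  let a := triv_inv t u p in
  row_mx (lc_mu c p (ideal_proj a)) (mu p (a - ideal_proj a)).
have inv_lin (a : R) u v : triv_inv t (a *: u + v) p =
    a *: triv_inv t u p + triv_inv t v p.
  by apply: (triv_inj tp); rewrite linearP !triv_invK.
have Psi_lin : linear Psi.
  move=> a u v; rewrite /Psi /= inv_lin scale_row_mx add_row_mx.
  rewrite ideal_proj_linear -!linearP; congr row_mx; congr (mu p _).
  by rewrite scalerBr opprD addrACA.
pose h (w : 'rV[R]_(q + (vb_rank A - q))) : 'rV[R]_(vb_rank A) :=
  t p (lc_h c p (vec (lsubmx w)) + \sum_j rsubmx w 0 j *: f j p).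
have invt a : triv_inv t (t p a) p = a by apply: (triv_inj tp); rewrite triv_invK.
have hK : cancel h (pack_linear Psi_lin).
  move=> w /=; rewrite /Psi /h invt.
  have kh : k p (lc_h c p (vec (lsubmx w))) by exact: lc_hk.
  have -> : ideal_proj (lc_h c p (vec (lsubmx w)) + \sum_j rsubmx w 0 j *: f j p) =
      lc_h c p (vec (lsubmx w)).
    rewrite -ideal_proj_mapE linearD linear_sum /= ideal_proj_id // big1 ?addr0 // => j _.
    by rewrite -ideal_proj_mapE linearZ /= [ideal_proj _]complement_proj_mem scaler0.
  rewrite addrAC subrr add0r lc_muh // vecK -[RHS]hsubmxK; congr row_mx.
  rewrite linear_sum [RHS]row_sum_delta; apply: eq_bigr => j _.
  by rewrite linearZ /= mue.
have xP : pack_linear Psi_lin (t p (subsp_val x)) = 0.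
  by rewrite /= /Psi invt complement_mem subr0 linear0 mx0 row_mx0.
apply: subsp_eq; apply: (triv_inj tp); rewrite linear0.
by apply: (surjective_injective hK _ xP); rewrite subnKC.
Qed.

Definition complement_bundle : vbundle M := sheaf_bundle complement_frame.

Lemma complement_proj_linear p : linear (@complement_proj p : A p -> complement_bundle p).
Proof.
move=> c x y; apply: subsp_eq; rewrite [RHS]subsp_linear !complement_projE.
by rewrite ideal_proj_linear scalerBr opprD addrACA.
Qed.

Lemma complement_proj_smooth (U : set M) (s : forall p, A p) : open U ->
  smooth_section_on U s ->
  smooth_section_on (E := complement_bundle) U (fun p => complement_proj (s p)).
Proof.
move=> oU ss; apply/(sheaf_bundleP complement_frame) => //.
exact: complement_smooth.
Qed.

Definition complement_map : bundle_map A complement_bundle :=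
  @BundleMap R M A complement_bundle (fun p => pack_linear (@complement_proj_linear p))
    complement_proj_smooth.

Lemma complement_val_smooth (U : set M) (s : forall p, complement_bundle p) :
  open U -> smooth_section_on U s ->
  smooth_section_on (E := A) U (fun p => subsp_val (s p)).
Proof. by move=> oU /(sheaf_bundleP complement_frame s oU). Qed.

Definition complement_val (s : section complement_bundle) : section A :=
  MkSection (complement_val_smooth openT (section_smooth s)).

Local Notation pr2 := (bmap_app complement_map).
Local Notation lA := (bmap_app ideal_proj_map).

Lemma complement_valK s : pr2 (complement_val s) = s.
Proof. by apply: section_ext => p; exact: complement_proj_id. Qed.

Lemma complement_valE a : complement_val (pr2 a) = a - lA a.
Proof. by apply: section_ext => p; rewrite section_addE section_oppE. Qed.

Lemma ideal_proj_section_in a : section_in k (lA a).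
Proof. by move=> p; exact: ideal_proj_in. Qed.

Lemma complement_map_ideal a : section_in k a -> pr2 a = 0.
Proof.
move=> ka; apply: section_ext => p; apply: subsp_eq.
by rewrite /= ideal_proj_id // subrr.
Qed.

Lemma complement_map_comb (f : smooth M) a b : pr2 (f *: a + b) = f *: pr2 a + pr2 b.
Proof. by apply: section_ext => p; exact: complement_proj_linear. Qed.

Lemma complement_map0 : pr2 0 = 0.
Proof. by apply: complement_map_ideal => p; exact: ideal0. Qed.

Lemma complement_mapZ (f : smooth M) a : pr2 (f *: a) = f *: pr2 a.
Proof. by rewrite -[f *: a]addr0 complement_map_comb complement_map0 addr0. Qed.

Lemma anchor_ideal_proj p (a : A p) : anchor A p (ideal_proj a) = 0.
Proof. by apply: ideal_anchor; exact: ideal_proj_in. Qed.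

Lemma complement_map_add a b : pr2 (a + b) = pr2 a + pr2 b.
Proof. by have := complement_map_comb 1 a b; rewrite !scale1r. Qed.

Definition complement_br (s t : section complement_bundle) : section complement_bundle :=
  pr2 (br (complement_val s) (complement_val t)).

(** As [k] is an ideal, the brackets with l(a) or l(b) lie in [k] and are killed by the projection.
    Arbitrary lifts to [A] may thus be used, and the axioms of B are inherited from [A]. *)
Lemma complement_brE a b : complement_br (pr2 a) (pr2 b) = pr2 (br a b).
Proof.
rewrite /complement_br !complement_valE br_addl !br_add !complement_map_add.
rewrite (complement_map_ideal (a := br a (- lA b))); last first.
  exact/ideal_br/ideal_sectionN/ideal_proj_section_in.
rewrite addr0 (complement_map_ideal (a := br (- lA a) b)); last first.
  exact/ideal_brl/ideal_sectionN/ideal_proj_section_in.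
rewrite (complement_map_ideal (a := br (- lA a) (- lA b))); last first.
  exact/ideal_brl/ideal_sectionN/ideal_proj_section_in.
by rewrite !addr0.
Qed.

Definition complement_anchor p : {linear complement_bundle p -> tangent p} :=
  pack_linear (fun c x y => linearP (anchor A p) c (subsp_val x) (subsp_val y)).

Lemma complement_anchor_smooth (U : set M) (s : forall p, complement_bundle p) :
  open U -> smooth_section_on U s ->
  smooth_field_on U (fun p => complement_anchor p (s p)).
Proof. by move=> oU ss; exact: (anchor_smooth oU (complement_val_smooth oU ss)). Qed.

Lemma complement_br_real (c : R) s t u :
  complement_br s ((c *: (1 : smooth M)) *: t + u) =
  (c *: (1 : smooth M)) *: complement_br s t + complement_br s u.
Proof.
rewrite -(complement_valK s) -(complement_valK t) -(complement_valK u).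
by rewrite -complement_map_comb !complement_brE br_linear complement_map_comb.
Qed.

Lemma complement_br_anti s t : complement_br s t = - complement_br t s.
Proof.
rewrite -(complement_valK s) -(complement_valK t) !complement_brE br_anti.
by rewrite -scaleN1r complement_mapZ scaleN1r.
Qed.

Lemma complement_br_jacobi s t u : complement_br s (complement_br t u) =
  complement_br (complement_br s t) u + complement_br t (complement_br s u).
Proof.
rewrite -(complement_valK s) -(complement_valK t) -(complement_valK u).
by rewrite !complement_brE br_jacobi complement_map_add.
Qed.

Lemma complement_br_leibniz s (f : smooth M) t :
  complement_br s (f *: t) = f *: complement_br s t +
    vfield_app (VField (complement_anchor_smooth openT (section_smooth s))) f *: t.
Proof.
have -> : VField (complement_anchor_smooth openT (section_smooth s)) =
    rho (complement_val s) by exact: smooth_field_ext.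
rewrite -{1 2}(complement_valK s) -(complement_valK t).
by rewrite -complement_mapZ !complement_brE br_leibniz complement_map_comb complement_mapZ.
Qed.

Lemma complement_rho_br s t p :
  VField (complement_anchor_smooth openT (section_smooth (complement_br s t))) p =
  vbracket (VField (complement_anchor_smooth openT (section_smooth s)))
    (VField (complement_anchor_smooth openT (section_smooth t))) p.
Proof.
have E u : VField (complement_anchor_smooth openT (section_smooth u)) =
    rho (complement_val u) by exact: smooth_field_ext.
rewrite !E -rho_br /complement_br complement_valE !rhoE section_addE linearD.
by rewrite section_oppE linearN [X in _ - X]anchor_ideal_proj subr0.
Qed.

Definition complement_algebroid : lie_algebroid M :=
  @LieAlgebroid R M complement_bundle complement_anchor complement_anchor_smooth
    complement_br complement_br_real complement_br_anti complement_br_jacobi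
    complement_br_leibniz complement_rho_br.

Lemma complement_morphism : @la_morphism R M A complement_algebroid complement_map.
Proof.
split=> [p a|s t]; last by rewrite -complement_brE.
by rewrite /= linearB [X in _ - X]anchor_ideal_proj subr0.
Qed.

(* The morphism (rho, l) : A -> A'. *)
Lemma split_map_linear p :
  linear (fun a : A p => atiyah_mk (anchor A p a) (ideal_proj a) : atiyah_bundle p).
Proof.
move=> c x y; have [e1 e2] := atiyah_linear c
  (atiyah_mk (anchor A p x) (ideal_proj x)) (atiyah_mk (anchor A p y) (ideal_proj y)).
have m (a : A p) : subsp_val (atiyah_mk (anchor A p a) (ideal_proj a)) =
    (anchor A p a, ideal_proj a) by apply: atiyah_mkE; exact: ideal_proj_in.
apply: atiyah_eq.
  by apply: etrans (esym e1); rewrite !m /= linearP.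
by apply: etrans (esym e2); rewrite !m /= ideal_proj_linear.
Qed.

Lemma split_map_smooth (U : set M) (s : forall p, A p) : open U ->
  smooth_section_on U s -> smooth_section_on (E := atiyah_bundle) U
    (fun p => atiyah_mk (anchor A p (s p)) (ideal_proj (s p))).
Proof.
move=> oU ss; apply: (atiyah_pair_smooth oU).
- exact: anchor_smooth.
- exact: ideal_proj_smooth.
- by move=> p _; exact: ideal_proj_in.
Qed.

Definition split_map : bundle_map A atiyah_bundle :=
  @BundleMap R M A atiyah_bundle (fun p => pack_linear (@split_map_linear p))
    split_map_smooth.

Local Notation pr1 := (bmap_app split_map).

Lemma split_map_val p (a : A p) :
  subsp_val (split_map p a) = (anchor A p a, ideal_proj a).
Proof. by rewrite /= atiyah_mkE //; exact: ideal_proj_in. Qed.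

Lemma split_map_field a : atiyah_field (pr1 a) = rho a.
Proof. by apply: smooth_field_ext => p /=; rewrite split_map_val. Qed.

Lemma split_map_ideal a : atiyah_ideal (pr1 a) = lA a.
Proof. by apply: section_ext => p /=; rewrite split_map_val. Qed.

Lemma split_map_op a s : section_in k s -> atiyah_op (pr1 a) s = br a s.
Proof.
move=> ks; apply: section_ext => p; rewrite atiyah_opE //.
rewrite split_map_field split_map_ideal; have [_ ->] := ideal_projP a p => //.
Qed.

(** The image of a section of [A] acts on [k] as its bracket, so equality of the operators is the
    Jacobi identity of [A]. *)
Lemma split_map_br a b : pr1 (br a b) = atiyah_br (pr1 a) (pr1 b).
Proof.
apply: atiyah_op_injective => [p|s ks].
  by rewrite atiyah_br_field !split_map_field rho_br.
rewrite atiyah_br_op // !split_map_op //; try exact: ideal_br.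
by rewrite br_jacobi addrK.
Qed.

Lemma split_morphism : @la_morphism R M A atiyah_algebroid split_map.
Proof.
by split=> [p a|s t]; [rewrite /= split_map_val|exact: split_map_br].
Qed.

(** The pair of x in A' and b in B comes from b plus the k-component of x. Adding an element of [k]
    does not alter the anchor, so the first projection is right precisely by the equality of
    anchors. *)
Lemma split_fibre_product :
  @fibre_product R M atiyah_algebroid complement_algebroid A split_map complement_map.
Proof.
split; [exact: split_morphism|exact: complement_morphism|].
move=> p x b xb; exists (subsp_val b + (subsp_val x).2); split.
  have px : ideal_proj (subsp_val b + (subsp_val x).2) = (subsp_val x).2.
    rewrite -ideal_proj_mapE linearD /= complement_mem add0r ideal_proj_id //.
    exact: (atiyah_in x).
  split.
    apply: atiyah_eq; rewrite split_map_val //= linearD.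
    by rewrite [anchor A p _.2]ideal_anchor ?addr0 ?xb //; exact: (atiyah_in x).
  by apply: subsp_eq; rewrite /= px addrK.
move=> a [ax ab]; rewrite -ab -ax split_map_val /=.
by rewrite subrK.
Qed.

Lemma id_map_smooth (U : set M) (s : forall p, A p) : open U ->
  smooth_section_on U s -> smooth_section_on U (fun p => idfun (s p)).
Proof. by []. Qed.

Lemma ideal_principal_type : principal_type k.
Proof.
pose i : bundle_map A A := @BundleMap R M A A (fun p => idfun : {linear A p -> A p})
  id_map_smooth.
have mi : la_morphism i.
  by split=> // s t; apply: section_ext => p /=; congr (br _ _ p); exact: section_ext.
(* The fibre product is realized by [A] itself, with the identity as isomorphism. *)
exists atiyah_algebroid, complement_algebroid, A, split_map, complement_map, i; split.
- exact: atiyah_transitive.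
- exact: split_fibre_product.
- by split=> //; exists i; split.
- move=> p a; split=> [ka|/(congr1 (@subsp_val _ _ _ _)) /=].
    by apply: subsp_eq; rewrite /= ideal_proj_id // subrr.
  by move=> /eqP; rewrite subr_eq0 => /eqP ->; exact: ideal_proj_in.
Qed.

(** * The partial splitting *)

Definition atiyah_of (X : vfield M) (z : section A) (kz : section_in k z) :
    section atiyah_bundle :=
  MkSection (atiyah_pair_smooth openT (vfield_smooth X) (section_smooth z)
    (fun p _ => kz p)).

Lemma atiyah_ofE X z (kz : section_in k z) :
  atiyah_field (atiyah_of X kz) = X /\ atiyah_ideal (atiyah_of X kz) = z.
Proof.
split; first by apply: smooth_field_ext => p; rewrite /= atiyah_mkE.
by apply: section_ext => p; rewrite /= atiyah_mkE.
Qed.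

Lemma ideal_section0 : section_in k (0 : section A).
Proof. by move=> p; exact: ideal0. Qed.

Definition horizontal (X : vfield M) : section atiyah_bundle :=
  atiyah_of X ideal_section0.

Definition field0 : vfield M := VField (@field_zero R M setT).

Definition vertical (z : section A) (kz : section_in k z) : section atiyah_bundle :=
  atiyah_of field0 kz.

Lemma atiyah_split a : a = horizontal (atiyah_field a) + vertical (atiyah_ideal_in a).
Proof.
have [h1 h2] := atiyah_ofE (atiyah_field a) ideal_section0.
have [v1 v2] := atiyah_ofE field0 (atiyah_ideal_in a).
apply: atiyah_section_eq => p.
  by rewrite atiyah_field_add h1 v1 /= addr0.
have := atiyah_ideal_comb 1 (horizontal (atiyah_field a)) (vertical (atiyah_ideal_in a)) p.
rewrite scale1r => ->; rewrite h2 v2.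
by rewrite section_zeroE scaler0 add0r.
Qed.

Lemma vertical_eq z z' (kz : section_in k z) (kz' : section_in k z') : z = z' ->
  vertical kz = vertical kz'.
Proof. by move=> zz'; case: _ / zz' in kz' *; congr vertical; exact: Prop_irrelevance. Qed.

Lemma vertical_op z (kz : section_in k z) s : section_in k s ->
  atiyah_op (vertical kz) s = br z s.
Proof.
move=> ks; apply: section_ext => p; rewrite atiyah_opE //.
have [-> ->] := atiyah_ofE field0 kz.
by rewrite /Theta nab0 add0r fbE.
Qed.

(** The section (0, z) acts on [k] as the bracket with [z], so this too is the Jacobi identity of
    [A], read on operators. *)
Lemma split_map_vertical a z (kz : section_in k z) :
  atiyah_br (pr1 a) (vertical kz) = vertical (ideal_br a kz).
Proof.
have [v1 v2] := atiyah_ofE field0 kz.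
have [w1 w2] := atiyah_ofE field0 (ideal_br a kz).
apply: atiyah_op_injective => [p|s ks].
  rewrite atiyah_br_field v1 w1; apply: tangent_eq => f; rewrite vbracketE.
  have -> : vfield_app field0 f = 0 by apply: smooth_eq.
  by rewrite tangent0 sub0r; change (- (0 : R) = 0); rewrite oppr0.
rewrite atiyah_br_op // !vertical_op // !split_map_op //; try exact: ideal_br.
by rewrite br_jacobi addrK.
Qed.

(* This is L(a)(X). *)
Definition split_form (a : section A) (X : vfield M) : section A :=
  atiyah_ideal (atiyah_br (horizontal X) (pr1 a)).

Lemma split_form_in a X : section_in k (split_form a X).
Proof. exact: atiyah_ideal_in. Qed.

Lemma split_form_comb (f : smooth M) a b X p :
  split_form (f *: a + b) X p =
  f p *: split_form a X p + (X p f *: ideal_proj (a p) + split_form b X p).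
Proof.
rewrite /split_form; have -> : pr1 (f *: a + b) = f *: pr1 a + pr1 b.
  by apply: section_ext => r; exact: split_map_linear.
rewrite atiyah_br_comb !atiyah_ideal_comb split_map_ideal.
by have [-> _] := atiyah_ofE X ideal_section0.
Qed.

Lemma horizontal_comb (f : smooth M) Y Z :
  horizontal (atiyah_field (f *: Y + Z)) =
  f *: horizontal (atiyah_field Y) + horizontal (atiyah_field Z).
Proof.
have [u1 u2] := atiyah_ofE (atiyah_field (f *: Y + Z)) ideal_section0.
have [v1 v2] := atiyah_ofE (atiyah_field Y) ideal_section0.
have [w1 w2] := atiyah_ofE (atiyah_field Z) ideal_section0.
apply: atiyah_section_eq => p.
  by rewrite u1 !atiyah_field_comb v1 w1.
by rewrite u2 atiyah_ideal_comb v2 w2 section_zeroE scaler0 addr0.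
Qed.

Lemma atiyah_br_combl (f : smooth M) a b c p :
  atiyah_ideal (atiyah_br (f *: a + b) c) p =
  f p *: atiyah_ideal (atiyah_br a c) p - atiyah_field c p f *: atiyah_ideal a p +
  atiyah_ideal (atiyah_br b c) p.
Proof.
have iN d : atiyah_ideal (- d) p = - atiyah_ideal d p.
  have := atiyah_ideal_comb (-1) d 0 p; rewrite addr0 scaleN1r => ->.
  by change ((-1) *: atiyah_ideal d p + 0 = - atiyah_ideal d p); rewrite addr0 scaleN1r.
rewrite atiyah_br_anti iN atiyah_br_comb !atiyah_ideal_comb.
rewrite (atiyah_br_anti c a) (atiyah_br_anti c b) !iN !opprD scalerN !opprK.
by rewrite addrA.
Qed.

(** The section (X, 0) has zero component in [k], so the derivative term of [atiyah_br_combl]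
    disappears and linearity in X over the functions remains. Vector fields are written as anchors
    of sections of A', to which [tensorial] applies. *)
Lemma split_form_field (f : smooth M) a Y Z p :
  split_form a (atiyah_field (f *: Y + Z)) p =
  f p *: split_form a (atiyah_field Y) p + split_form a (atiyah_field Z) p.
Proof.
rewrite /split_form horizontal_comb atiyah_br_combl.
have [_ ->] := atiyah_ofE (atiyah_field Y) ideal_section0.
by rewrite section_zeroE scaler0 subr0.
Qed.

Lemma split_form_tensor a (Y Z : section atiyah_bundle) p :
  atiyah_field Y p = atiyah_field Z p ->
  split_form a (atiyah_field Y) p = split_form a (atiyah_field Z) p.
Proof.
move=> YZ.
have hE (T : section atiyah_bundle) :
    split_form a (atiyah_field T) = split_form a (atiyah_field (horizontal (atiyah_field T))).
  by have [-> _] := atiyah_ofE (atiyah_field T) ideal_section0.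
(* [Y] and [Z] may have different k-components at p; their horizontal parts agree there. *)
rewrite (hE Y) (hE Z).
apply: (@tensorial R M atiyah_bundle (A p) p (fun T => split_form a (atiyah_field T) p)).
- by move=> s t; have := split_form_field 1 a s t p; rewrite !scale1r => ->.
- move=> f s; have := split_form_field f a s 0 p; rewrite addr0 => ->.
  have -> : split_form a (atiyah_field 0) p = 0.
    have := split_form_field (-1) a 0 0 p; rewrite scaler0 addr0 => ->.
    change ((-1) *: split_form a (atiyah_field 0) p +
      split_form a (atiyah_field 0) p = 0).
    by rewrite scaleN1r addNr.
  by rewrite addr0.
- change (atiyah_mk (atiyah_field Y p) 0 = atiyah_mk (atiyah_field Z p) 0).
  by rewrite YZ.
Qed.

Lemma split_form_local a (X Y : vfield M) p : X p = Y p ->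
  split_form a X p = split_form a Y p.
Proof.
have [<- _] := atiyah_ofE X ideal_section0; have [<- _] := atiyah_ofE Y ideal_section0.
exact: split_form_tensor.
Qed.

Definition split_at (a : section A) (p : M) (v : tangent p) : A p :=
  xget 0 [set z | exists X : vfield M, X p = v /\ z = split_form a X p].

Lemma split_atE a (X : vfield M) p : split_at a (X p) = split_form a X p.
Proof.
rewrite /split_at; case: xgetP => [z _ [Y [YX ->]]|/(_ (split_form a X p))].
  exact: split_form_local.
by case; exists X.
Qed.

Lemma tangent_through p (v : tangent p) : exists Y : section atiyah_bundle,
  atiyah_field Y p = v.
Proof.
have [Y YE] := @section_through R M atiyah_bundle p (atiyah_mk v 0).
by exists Y; rewrite /= YE atiyah_mkE //; exact: ideal0.
Qed.

Lemma split_at_linear a p : linear (@split_at a p).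
Proof.
move=> c v w; have [Y <-] := tangent_through v; have [Z <-] := tangent_through w.
have E : atiyah_field ((c *: (1 : smooth M)) *: Y + Z) p =
    c *: atiyah_field Y p + atiyah_field Z p.
  by rewrite atiyah_field_comb smooth_realE.
by rewrite -E !split_atE split_form_field smooth_realE.
Qed.

Lemma split_at_in a p (v : tangent p) : k p (split_at a v).
Proof.
by have [Y <-] := tangent_through v; rewrite split_atE; exact: split_form_in.
Qed.

Lemma split_at_smooth a (U : set M) (X : forall p : M, tangent p) : open U ->
  smooth_field_on U X -> smooth_section_on U (fun p => split_at a (X p)).
Proof.
move=> oU sX; apply: section_glue => // p Up.
have sY : smooth_section_on (E := atiyah_bundle) U (fun p => atiyah_mk (X p) 0).
  apply: (atiyah_pair_smooth oU) => //; first exact: section_zero.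
  by move=> r _; exact: ideal0.
have [Y [chi [W [[oW Wp] _ YE _ _]]]] := section_extend oU Up sY.
exists W, (split_form a (atiyah_field Y)); split=> //.
  by apply: section_sub (section_smooth (split_form a (atiyah_field Y))).
move=> r Wr _; rewrite -split_atE; congr (split_at a _).
by rewrite /= (YE _ Wr).2 atiyah_mkE //; exact: ideal0.
Qed.

Definition split_form1 (a : section A) : form1 k :=
  @Form1 R M A k (fun p => pack_linear (@split_at_linear a p)) (@split_at_in a)
    (@split_at_smooth a).

Lemma split_form1_at a (X : vfield M) p : split_form1 a p (X p) = split_form a X p.
Proof. exact: split_atE. Qed.

Lemma split_form1E a X : form_app (split_form1 a) X = split_form a X.
Proof. by apply: section_ext => p; exact: split_atE. Qed.

Lemma horizontal_split_map X a :
  atiyah_br (horizontal X) (pr1 a) =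
  horizontal (vbracket X (rho a)) + vertical (split_form_in a X).
Proof.
rewrite [LHS]atiyah_split.
have -> : atiyah_field (atiyah_br (horizontal X) (pr1 a)) = vbracket X (rho a).
  rewrite atiyah_br_field split_map_field.
  by have [-> _] := atiyah_ofE X ideal_section0.
by congr (_ + _); exact: vertical_eq.
Qed.

Lemma atiyah_ideal_add a b : atiyah_ideal (a + b) = atiyah_ideal a + atiyah_ideal b.
Proof.
apply: section_ext => p; have := atiyah_ideal_comb 1 a b p.
rewrite scale1r => ->.
change (1 *: atiyah_ideal a p + atiyah_ideal b p =
  atiyah_ideal a p + atiyah_ideal b p).
by rewrite scale1r.
Qed.

Lemma split_map_horizontal a X :
  atiyah_ideal (atiyah_br (pr1 a) (horizontal X)) = - split_form a X.
Proof.
apply: (addIr (split_form a X)); rewrite -atiyah_ideal_add addNr.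
rewrite (atiyah_br_anti (pr1 a)) addNr.
by apply: section_ext.
Qed.

Lemma split_map_bracket a b X :
  atiyah_ideal (atiyah_br (pr1 a) (atiyah_br (horizontal X) (pr1 b))) =
  br a (split_form b X) - split_form a (vbracket X (rho b)).
Proof.
rewrite horizontal_split_map atiyah_br_add atiyah_ideal_add split_map_horizontal.
rewrite split_map_vertical addrC; congr (_ - _).
by have [_ ->] := atiyah_ofE field0 (ideal_br a (split_form_in b X)).
Qed.

(** The Jacobi identity in A' for (X, 0), [pr1 a] and [pr1 b], followed by taking k-components. *)
Lemma split_form_br a b X :
  split_form (br a b) X =
  (br a (split_form b X) - split_form a (vbracket X (rho b))) -
  (br b (split_form a X) - split_form b (vbracket X (rho a))).
Proof.
rewrite -!split_map_bracket /split_form split_map_br atiyah_br_jacobi.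
rewrite atiyah_ideal_add addrC; congr (_ + _).
apply: (addIr (atiyah_ideal (atiyah_br (pr1 b) (atiyah_br (horizontal X) (pr1 a))))).
rewrite addNr -atiyah_ideal_add atiyah_br_anti addNr.
by apply: section_ext.
Qed.

Lemma split_form_swap a X Y : split_form a (vbracket X Y) = - split_form a (vbracket Y X).
Proof.
apply: section_ext => p; rewrite section_oppE -!split_atE.
have -> : vbracket X Y p = - vbracket Y X p.
  apply: tangent_eq => f; have [_ _ -> _] := tangentE (vbracket Y X p) 0 0 f.
  by rewrite !vbracketE opprB.
exact: (linearN (form_at (split_form1 a) p) _).
Qed.

Lemma ideal_partially_split : partially_split k.
Proof.
exists split_form1, ideal_proj_map; split.
- by move=> p a; exact: ideal_proj_in.
- by move=> p a; exact: ideal_proj_id.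
- move=> c s t p v; have [Y <-] := tangent_through v; rewrite !split_form1_at.
  rewrite split_form_comb tangentZ tangent1 mulr0 scale0r add0r.
  by rewrite smooth_realE.
- move=> f s p v; have [Y <-] := tangent_through v; rewrite !split_form1_at ideal_proj_mapE.
  rewrite -[f *: s]addr0 split_form_comb; congr (_ + _).
  have -> : split_form 0 (atiyah_field Y) p = 0; last by rewrite addr0.
  have := split_form_comb (-1) 0 0 (atiyah_field Y) p.
  rewrite scaler0 addr0 ideal_proj_id; last exact: ideal0.
  rewrite scaler0 add0r => ->.
  change ((-1) *: split_form 0 (atiyah_field Y) p +
    split_form 0 (atiyah_field Y) p = 0).
  by rewrite scaleN1r addNr.
move=> s t; split=> [X|].
  rewrite /lie_deriv !split_form1E split_form_br.
  rewrite (split_form_swap t (rho s)) (split_form_swap s (rho t)) !opprK.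
  by rewrite !opprD !opprK addrACA [RHS]addrACA [- _ + split_form t _]addrC.
rewrite split_form1E -split_map_ideal split_map_br.
(* Bracketing this decomposition with [pr1 s] gives -L(s)(rho t) from the horizontal part and
   [s, l(t)] from the vertical one. *)
have E : pr1 t = horizontal (rho t) + vertical (ideal_proj_section_in t).
  rewrite [LHS]atiyah_split split_map_field; congr (_ + _).
  by apply: vertical_eq; rewrite split_map_ideal.
rewrite E atiyah_br_add atiyah_ideal_add split_map_horizontal split_map_vertical.
rewrite addrC; congr (_ - _).
by have [_ ->] := atiyah_ofE field0 (ideal_br s (ideal_proj_section_in t)).
Qed.

End LieBundle.

Theorem proposition6p5 (R : realType) (M : manifold R) (A : lie_algebroid M)
    (k : forall p : M, set (A p)) (g : lie_algebra R) :
  bundle_of_ideals k ->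
  lie_algebra_bundle k g ->
  adjoint_cohomology_zero g 0 ->
  adjoint_cohomology_zero g 1 ->
  principal_type k /\ partially_split k.
Proof.
move=> hk hL H0 H1; have [q [crd [vec [crdK vecK]]]] := vect_coordinates g.
have [nab nabP] := connection_exists hk hL crdK vecK.
split.
  exact: (ideal_principal_type hk hL crdK vecK H0 H1 nabP).
exact: (ideal_partially_split hk hL crdK vecK H0 H1 nabP).
Qed.
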